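(* Let $\mathcal A=TM\oplus(M\times\mathfrak g)$ be the transitive Lie algebroid described in the context, with $H^1(M)=\{0\}$. A quadruple $(\pi,\theta,0,\delta)$, with $\pi\in\Gamma(\wedge^2TM)$, $\theta\in\mathfrak X(M)\otimes\mathfrak g$ and $\delta:\mathfrak g\to\wedge^2\mathfrak g$ linear, is admissible (satisfies conditions (1)-(6) of the context with $\tau=0$) if and only if $\pi$ is a Poisson tensor, $\delta$ defines a Lie bialgebra $(\mathfrak g,\mathfrak g^* )$, and $\theta$ induces a right $\mathfrak g^*$-Poisson action on $M$. In this case, the dual Lie algebroid $\mathcal A^*$ of the Lie bialgebroid corresponding to $(\pi,\theta,0,\delta)$ is isomorphic to the matched pair Lie algebroid $T^*M\bowtie(M\times\mathfrak g^* )$ defined in the context. In other words, under the one-to-one correspondence between equivalence classes of admissible quadruples and transitive Lie bialgebroids $(\mathcal A,\mathcal A^* )$ described in the context, the classes of quadruples $(\pi,\theta,0,\delta)$ correspond to those transitive Lie bialgebroids $(\mathcal A,\mathcal A^* )$ for which $\mathcal A^*$ is the double of the matched pair $(T^*M,M\times\mathfrak g^* )$ of a Poisson group action.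
   Context: $M$ is a connected smooth manifold and $\mathfrak g$ a finite-dimensional real Lie algebra. $\mathcal A=TM\oplus(M\times\mathfrak g)$ has anchor the projection to $TM$ and bracket $[X+A,Y+B]=[X,Y]+(X(B)-Y(A)+[A,B])$ for $X,Y\in\mathfrak X(M)$, $A,B\in C^\infty(M,\mathfrak g)$. $[\cdot,\cdot]$ also denotes the Schouten bracket on $\Gamma(\wedge^*\mathcal A)$, with $[e,f]=\rho(e)f$, $[P,Q]=-(-1)^{(p-1)(q-1)}[Q,P]$, $[P,Q\wedge R]=[P,Q]\wedge R+(-1)^{(p-1)q}Q\wedge[P,R]$. $(\mathcal A,\mathcal A^* )$ is a Lie bialgebroid if $\mathcal A^*$ carries a Lie algebroid structure whose differential $d_*$ on $\Gamma(\wedge^*\mathcal A)$ satisfies $d_*[e_1,e_2]=[d_*e_1,e_2]+[e_1,d_*e_2]$. Notation: $(u\wedge v)(\alpha,\beta)=\alpha(u)\beta(v)-\alpha(v)\beta(u)$; $\langle\pi^{\#}\alpha,\beta\rangle=\pi(\alpha,\beta)$; for $\theta=\sum X_i\otimes A_i$ ($X_i\in\mathfrak X(M)$, $A_i\in\mathfrak g$): $\theta^{\#}(\alpha)=\sum\alpha(X_i)A_i$, $(\theta^{\#})^*\xi=\sum\xi(A_i)X_i$, $K=\sum X_i\wedge A_i$, $\delta\theta=\sum X_i\otimes\delta A_i$, $[\theta,\theta]=\sum_{i,j}[X_i,X_j]\otimes(A_i\wedge A_j)$, $[\tau,\theta]=\sum X_i\otimes[A_i,\tau]$. For $\tau=\sum_a\tau_ac_a$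 ($c_a\in\wedge^2\mathfrak g$), $\pi^{\#}(d\tau)=\sum_a\pi^{\#}(d\tau_a)\otimes c_a$; $\langle\mathrm{Alt}(\theta^{\#}d\tau),\xi\wedge\eta\wedge\zeta\rangle=\langle\theta^{\#}(d(\tau(\xi,\eta))),\zeta\rangle+\text{c.p.}$ $\delta$ is extended to a degree-one graded derivation of $\Gamma(\wedge^*\mathcal A)$ vanishing on $C^\infty(M)$ and $\mathfrak X(M)$. A quadruple $(\pi,\theta,\tau,\delta)$, $\tau\in C^\infty(M,\wedge^2\mathfrak g)$, is admissible if: (1) $\delta$ is a Lie algebra 1-cocycle, $\delta[A,B]=[\delta A,B]+[A,\delta B]$; (2) $\pi$ is Poisson; (3) $\theta^{\#}:(T^*M,\pi)\to\mathfrak g$ is a Lie algebroid morphism, i.e. $\theta^{\#}([\alpha,\beta]_\pi)=\pi^{\#}(\alpha)(\theta^{\#}\beta)-\pi^{\#}(\beta)(\theta^{\#}\alpha)+[\theta^{\#}\alpha,\theta^{\#}\beta]$, where $[\alpha,\beta]_\pi=L_{\pi^{\#}\alpha}\beta-L_{\pi^{\#}\beta}\alpha-d(\pi(\alpha,\beta))$; (4) $\delta\theta+\frac12[\theta,\theta]=[\tau,\theta]-\pi^{\#}(d\tau)$; (5) $T:=\delta\tau+\frac12[\tau,\tau]+\mathrm{Alt}(\theta^{\#}d\tau)$ is a constant element of $\wedge^3\mathfrak g$; (6) $\delta^2+[T,\,\cdot\,]=0$ on $\mathfrak g$. Quadruples are equivalent if they have the same $\pi,\theta$ and $\tau_1=\tau_2+r_0$,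 $\delta_1=\delta_2-[r_0,\,\cdot\,]$ for some $r_0\in\wedge^2\mathfrak g$. When $H^1(M)=0$, equivalence classes of admissible quadruples correspond one-to-one to transitive Lie bialgebroids $(\mathcal A,\mathcal A^* )$, the class of $(\pi,\theta,\tau,\delta)$ giving the Lie algebroid $\mathcal A^*$ with differential $d_*=[\pi+K-\tau,\,\cdot\,]-\delta$. $\delta$ defines a Lie bialgebra if it is a 1-cocycle and $\langle[\xi,\eta],A\rangle=\langle\xi\wedge\eta,\delta A\rangle$ defines a Lie bracket on $\mathfrak g^*$. $\theta$ induces a right $\mathfrak g^*$-Poisson action (infinitesimal, for the Lie bialgebra $(\mathfrak g^*,\mathfrak g)$) if $\varphi=-(\theta^{\#})^*:\mathfrak g^*\to\mathfrak X(M)$ is a Lie algebra morphism and $(L_{\varphi(\xi)}\pi)(\alpha,\beta)=-\langle\xi,[\varphi^*\alpha,\varphi^*\beta]\rangle$ for $\xi\in\mathfrak g^*$ and 1-forms $\alpha,\beta$, where $\varphi^*=-\theta^{\#}:T^*M\to M\times\mathfrak g$ is the dual map (this is the sign convention for which, given $\pi$ Poisson, the last identity is equivalent to (3)). Given such data, the matched pair Lie algebroid (double) $T^*M\bowtie(M\times\mathfrak g^* )$ of the Poisson action is $T^*M\oplus(M\times\mathfrak g^* )$, in which $T^*M$ is a Lie subalgebroid with its cotangent Lie algebroid structure of $\pi$, $M\times\mathfrak g^*$ is a Lie subalgebroid with the action Lie algebroid structure (anchor $\varphi$, bracket of constant sections that of $\mathfrak g^*$), and for $\alpha\in\Omega^1(M)$,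 $\xi\in C^\infty(M,\mathfrak g^* )$, $$[\alpha,\xi]=\phi(\alpha)(\xi)-\psi(\xi)(\alpha),\quad \phi(\alpha)(\xi)=L_{\pi^{\#}\alpha}\xi+\mathrm{ad}^*_{\theta^{\#}\alpha}\xi,\quad \psi(\xi)(\alpha)=-\langle\xi,d(\theta^{\#}\alpha)\rangle-i_{(\theta^{\#})^*\xi}d\alpha,$$ where $L_{\pi^\#\alpha}\xi$ is componentwise differentiation, $\langle\mathrm{ad}^*_A\xi,B\rangle=-\langle\xi,[A,B]\rangle$, and $\langle\cdot,\cdot\rangle$ pairs $\mathfrak g^*$ with $\mathfrak g$. *)

(* Defs.v *)
From HB Require Import structures.
From mathcomp Require Import all_boot all_order all_algebra.
From mathcomp Require Import all_classical all_reals all_analysis.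
From mathcomp Require Import ring.
Set Implicit Arguments.
Unset Strict Implicit.
Unset Printing Implicit Defensive.
Import Order.TTheory GRing.Theory Num.Theory.
Import numFieldNormedType.Exports.
Local Open Scope classical_set_scope.
Local Open Scope ring_scope.

Section Ck.
Context {R : realType} {V W : normedModType R}.

(* Used for open [U] only: all iterated directional derivatives up to order
   [k] exist and are continuous at every point of [U]. *)
Fixpoint Ck (k : nat) (U : set V) (f : V -> W) : Prop :=
  (forall x, U x -> {for x, continuous f}) /\
  if k is k'.+1 then
    forall v, (forall x, U x -> derivable f x v) /\ Ck k' U (fun x => 'D_v f x)
  else True.

Definition Cinfty (U : set V) (f : V -> W) := forall k, Ck k U f.

Lemma Ck_ext k (U : set V) (f g : V -> W) : open U ->
  (forall x, U x -> f x = g x) -> Ck k U f -> Ck k U g.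
Proof.
move=> oU.
have near_fg (f' g' : V -> W) : (forall x, U x -> f' x = g' x) ->
    forall x, U x -> \forall y \near x, f' y = g' y.
  by move=> fg x Ux; apply: filterS (open_nbhs_nbhs (conj oU Ux)).
have cont (f' g' : V -> W) : (forall x, U x -> f' x = g' x) ->
    (forall x, U x -> {for x, continuous f'}) ->
    forall x, U x -> {for x, continuous g'}.
  move=> fg cf x Ux; rewrite /prop_for /continuous_at -(fg x Ux).
  apply: cvg_trans (cf x Ux); apply: near_eq_cvg.
  by apply: filterS (near_fg _ _ fg x Ux).
elim: k f g => [|k IH] f g fg /= [cf Df]; split=> //; try exact: cont fg cf.
move=> v; have [dv Dv] := Df v; split.
  move=> x Ux; apply: near_eq_derivable (dv x Ux).
  exact: near_fg.
by apply: IH Dv => x Ux; apply: near_eq_derive; exact: near_fg.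
Qed.

Lemma Ck_cst k (U : set V) (c : W) : Ck k U (fun=> c).
Proof.
elim: k c => [|k IH] c /=; split=> //; try by move=> x _; exact: cvg_cst.
move=> v; split=> [x _|]; first exact: derivable_cst.
suff -> : (fun x : V => 'D_v (fun=> c) x) = (fun=> 0) by [].
by apply/funext => x; rewrite derive_cst.
Qed.

Lemma CkD k (U : set V) (f g : V -> W) : open U ->
  Ck k U f -> Ck k U g -> Ck k U (fun x => f x + g x).
Proof.
move=> oU; elim: k f g => [|k IH] f g /= [cf Df] [cg Dg];
  split=> //; try by move=> x Ux; apply: cvgD; [exact: cf|exact: cg].
move=> v; have [df Df'] := Df v; have [dg Dg'] := Dg v; split.
  by move=> x Ux; apply: derivableD; [exact: df|exact: dg].
apply: (Ck_ext oU _ (IH _ _ Df' Dg')) => x Ux.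
by rewrite -deriveD; [|exact: df|exact: dg].
Qed.

Lemma Ck_le k (U : set V) (f : V -> W) : Ck k.+1 U f -> Ck k U f.
Proof.
elim: k f => [|k IH] f; first by case.
move=> [cf Df]; split=> // v; have [df Df'] := Df v; split=> //.
exact: IH Df'.
Qed.

End Ck.

Lemma CkM (R : realType) (V : normedModType R) k (U : set V) (f g : V -> R) :
  open U -> Ck k U f -> Ck k U g -> Ck k U (fun x => f x * g x).
Proof.
move=> oU; elim: k f g => [|k IH] f g /=.
  by move=> [cf _] [cg _]; split=> // x Ux; apply: cvgM; [exact: cf|exact: cg].
move=> Cf Cg; have Cf' := Ck_le Cf; have Cg' := Ck_le Cg.
case: Cf Cg => [cf Df] [cg Dg].
split; first by move=> x Ux; apply: cvgM; [exact: cf|exact: cg].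
move=> v; have [df Df'] := Df v; have [dg Dg'] := Dg v; split.
  by move=> x Ux; apply: derivableM; [exact: df|exact: dg].
apply: (Ck_ext oU _ (CkD oU (IH _ _ Cf' Dg') (IH _ _ Cg' Df'))) => x Ux.
by rewrite -[LHS]deriveM; [|exact: df|exact: dg].
Qed.

Section Manifold.
Context {R : realType} {m : nat}.

Record chart (M : topologicalType) := Chart {
  cdom : set M;
  cmap : M -> 'rV[R]_m;
  cinv : 'rV[R]_m -> M;
  cdom_open : open cdom;
  cimg_open : open (cmap @` cdom);
  cmapK : forall x, cdom x -> cinv (cmap x) = x;
  cmap_cont : forall x, cdom x -> {for x, continuous cmap};
  cinv_cont : forall y, (cmap @` cdom) y -> {for y, continuous cinv} }.

Record manifold := Manifold {
  msort :> topologicalType;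
  atlas : set (chart msort);
  atlas_cover : forall x, exists2 c, atlas c & cdom c x;
  atlas_smooth : forall c1 c2, atlas c1 -> atlas c2 ->
    Cinfty (cmap c1 @` (cdom c1 `&` cdom c2)) (fun y => cmap c2 (cinv c1 y));
  manifold_hausdorff : hausdorff_space msort;
  manifold_second_countable : @second_countable msort }.

Definition smoothP (M : manifold) (f : M -> R) :=
  forall c, atlas c -> Cinfty (cmap c @` cdom c) (fun y => f (cinv c y)).
End Manifold.
Arguments manifold : clear implicits.

Section Smooth.
Context {R : realType} {m : nat} (M : manifold R m).

Lemma smooth_cst (c : R) : smoothP (fun _ : M => c).
Proof. by move=> ch _ k; exact: Ck_cst. Qed.

Lemma smoothD (f g : M -> R) : smoothP f -> smoothP g ->
  smoothP (fun x => f x + g x).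
Proof.
move=> sf sg c ac k.
by apply: CkD; [exact: cimg_open|exact: sf|exact: sg].
Qed.

Lemma smoothM (f g : M -> R) : smoothP f -> smoothP g ->
  smoothP (fun x => f x * g x).
Proof.
move=> sf sg c ac k.
by apply: CkM; [exact: cimg_open|exact: sf|exact: sg].
Qed.

Lemma smooth_sum (I : Type) (r : seq I) (f : I -> M -> R) :
  (forall i, smoothP (f i)) -> smoothP (fun x => \sum_(i <- r) f i x).
Proof.
move=> sf; elim: r => [|i r IH].
  have -> : (fun x => \sum_(i <- [::]) f i x) = (fun=> 0).
    by apply/funext => x; rewrite big_nil.
  exact: smooth_cst.
have -> : (fun x => \sum_(j <- i :: r) f j x) =
          (fun x => f i x + \sum_(j <- r) f j x).
  by apply/funext => x; rewrite big_cons.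
exact: smoothD.
Qed.

Record smooth := Smooth { sval :> M -> R ; svalP : smoothP sval }.

Lemma smooth_eq (f g : smooth) : (forall x, f x = g x) -> f = g.
Proof.
case: f g => [f fP] [g gP] /= /funext fg; rewrite fg in fP *.
by rewrite (Prop_irrelevance fP gP).
Qed.

HB.instance Definition _ := gen_eqMixin smooth.
HB.instance Definition _ := gen_choiceMixin smooth.

Definition scst (c : R) : smooth := Smooth (smooth_cst c).
Definition sadd (f g : smooth) : smooth := Smooth (smoothD (svalP f) (svalP g)).
Definition smul (f g : smooth) : smooth := Smooth (smoothM (svalP f) (svalP g)).
Definition sopp (f : smooth) : smooth := smul (scst (-1)) f.

Fact saddA : associative sadd.
Proof. by move=> f g h; apply: smooth_eq => x /=; rewrite addrA. Qed.
Fact saddC : commutative sadd.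
Proof. by move=> f g; apply: smooth_eq => x /=; rewrite addrC. Qed.
Fact sadd0 : left_id (scst 0) sadd.
Proof. by move=> f; apply: smooth_eq => x /=; rewrite add0r. Qed.
Fact saddN : left_inverse (scst 0) sopp sadd.
Proof. by move=> f; apply: smooth_eq => x /=; rewrite mulN1r addNr. Qed.
HB.instance Definition _ :=
  GRing.isZmodule.Build smooth saddA saddC sadd0 saddN.

Fact smulA : associative smul.
Proof. by move=> f g h; apply: smooth_eq => x /=; rewrite mulrA. Qed.
Fact smulC : commutative smul.
Proof. by move=> f g; apply: smooth_eq => x /=; rewrite mulrC. Qed.
Fact smul1 : left_id (scst 1) smul.
Proof. by move=> f; apply: smooth_eq => x /=; rewrite mul1r. Qed.
Fact smulDl : left_distributive smul sadd.
Proof. by move=> f g h; apply: smooth_eq => x /=; rewrite mulrDl. Qed.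
(* Only a [comPzRingType], since [manifold] includes the empty manifold. *)
HB.instance Definition _ :=
  GRing.Zmodule_isComPzRing.Build smooth smulA smulC smul1 smulDl.


(* [{scalar V}] is the type of linear functionals on [V]. *)
Record vsmooth (V : vectType R) := VSmooth {
  vsval :> M -> V;
  vsvalP : forall l : {scalar V}, smoothP (fun x => l (vsval x)) }.

Section VSmooth.
Context {V : vectType R}.

Lemma vsmooth_eq (f g : vsmooth V) : (forall x, f x = g x) -> f = g.
Proof.
case: f g => [f fP] [g gP] /= /funext fg; rewrite fg in fP *.
by rewrite (Prop_irrelevance fP gP).
Qed.

HB.instance Definition _ := gen_eqMixin (vsmooth V).
HB.instance Definition _ := gen_choiceMixin (vsmooth V).

Fact vcst_subproof (v : V) (l : {scalar V}) : smoothP (fun _ : M => l v).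
Proof. exact: smooth_cst. Qed.
Definition vcst (v : V) : vsmooth V := VSmooth (vcst_subproof v).

Fact vadd_subproof (f g : vsmooth V) (l : {scalar V}) :
  smoothP (fun x => l (f x + g x)).
Proof.
have -> : (fun x => l (f x + g x)) = (fun x => l (f x) + l (g x)).
  by apply/funext => x; rewrite linearD.
by apply: smoothD; exact: vsvalP.
Qed.
Definition vadd (f g : vsmooth V) : vsmooth V := VSmooth (vadd_subproof f g).

Fact vscale_subproof (a : smooth) (f : vsmooth V) (l : {scalar V}) :
  smoothP (fun x => l (a x *: f x)).
Proof.
have -> : (fun x => l (a x *: f x)) = (fun x => a x * l (f x)).
  by apply/funext => x; rewrite linearZ.
by apply: smoothM; [exact: svalP|exact: vsvalP].
Qed.
Definition vscale (a : smooth) (f : vsmooth V) : vsmooth V :=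
  VSmooth (vscale_subproof a f).

Fact vaddA : associative vadd.
Proof. by move=> f g h; apply: vsmooth_eq => x /=; rewrite addrA. Qed.
Fact vaddC : commutative vadd.
Proof. by move=> f g; apply: vsmooth_eq => x /=; rewrite addrC. Qed.
Fact vadd0 : left_id (vcst 0) vadd.
Proof. by move=> f; apply: vsmooth_eq => x /=; rewrite add0r. Qed.
Fact vaddN : left_inverse (vcst 0) (vscale (-1)) vadd.
Proof.
by move=> f; apply: vsmooth_eq => x /=; rewrite mulr1 scaleN1r addNr.
Qed.
HB.instance Definition _ :=
  GRing.isZmodule.Build (vsmooth V) vaddA vaddC vadd0 vaddN.

Fact vscaleA (a b : smooth) (f : vsmooth V) :
  vscale a (vscale b f) = vscale (a * b) f.
Proof. by apply: vsmooth_eq => x /=; rewrite scalerA. Qed.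
Fact vscale1 : left_id 1 vscale.
Proof. by move=> f; apply: vsmooth_eq => x /=; rewrite scale1r. Qed.
Fact vscaleDr : right_distributive vscale +%R.
Proof. by move=> a f g; apply: vsmooth_eq => x /=; rewrite scalerDr. Qed.
Fact vscaleDl (f : vsmooth V) : {morph vscale^~ f : a b / a + b}.
Proof. by move=> a b; apply: vsmooth_eq => x /=; rewrite scalerDl. Qed.
HB.instance Definition _ := GRing.Zmodule_isLmodule.Build smooth (vsmooth V)
  vscaleA vscale1 vscaleDr vscaleDl.

(* Coordinate functions in the fixed basis [vbasis fullv] of [V]. *)
Definition vcoord (f : vsmooth V) (k : 'I_(\dim {:V})) : smooth :=
  Smooth (vsvalP f (coord (vbasis fullv) k)).

End VSmooth.

Definition bilin (U V W : lmodType R) (b : U -> V -> W) : Prop :=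
  (forall c u u' v, b (c *: u + u') v = c *: b u v + b u' v) /\
  (forall c u v v', b u (c *: v + v') = c *: b u v + b u v').

Lemma bilin_coord (U V : vectType R) (W : lmodType R) (b : U -> V -> W) u v :
  bilin b -> b u v =
    \sum_(i < \dim {:U}) \sum_(j < \dim {:V})
      (coord (vbasis fullv) i u * coord (vbasis fullv) j v) *:
        b (vbasis fullv)`_i (vbasis fullv)`_j.
Proof.
move=> [bl br].
have b0l w : b 0 w = 0.
  by have := bl 1 0 0 w; rewrite scale1r addr0 scale1r => /eqP;
    rewrite -subr_eq0 opprD addrA subrr sub0r oppr_eq0 => /eqP.
have b0r w : b w 0 = 0.
  by have := br 1 w 0 0; rewrite scale1r addr0 scale1r => /eqP;
    rewrite -subr_eq0 opprD addrA subrr sub0r oppr_eq0 => /eqP.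
have suml n (a : 'I_n -> R) (e : 'I_n -> U) w :
    b (\sum_i a i *: e i) w = \sum_i a i *: b (e i) w.
  elim: n a e => [|n IH] a e; first by rewrite !big_ord0.
  by rewrite !big_ord_recl bl IH.
have sumr n (a : 'I_n -> R) (e : 'I_n -> V) w :
    b w (\sum_i a i *: e i) = \sum_i a i *: b w (e i).
  elim: n a e => [|n IH] a e; first by rewrite !big_ord0.
  by rewrite !big_ord_recl br IH.
rewrite {1}(coord_vbasis (memvf u)) suml; apply: eq_bigr => i _.
rewrite {1}(coord_vbasis (memvf v)) sumr scaler_sumr.
by apply: eq_bigr => j _; rewrite scalerA.
Qed.

(* Pointwise application of a bilinear map. *)
Section Pointwise.
Context {U V W : vectType R} (b : U -> V -> W) (hb : bilin b).

Fact vbil_subproof (f : vsmooth U) (g : vsmooth V) (l : {scalar W}) :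
  smoothP (fun x => l (b (f x) (g x))).
Proof.
have -> : (fun x => l (b (f x) (g x))) = (fun x =>
    \sum_(i < \dim {:U}) \sum_(j < \dim {:V})
      (vcoord f i x * vcoord g j x) *
        l (b (vbasis fullv)`_i (vbasis fullv)`_j)).
  apply/funext => x; rewrite (bilin_coord _ _ hb) linear_sum.
  apply: eq_bigr => i _; rewrite linear_sum; apply: eq_bigr => j _.
  by rewrite linearZ.
apply: smooth_sum => i; apply: smooth_sum => j.
apply: smoothM; last exact: smooth_cst.
by apply: smoothM; exact: svalP.
Qed.
Definition vbil (f : vsmooth U) (g : vsmooth V) : vsmooth W :=
  VSmooth (vbil_subproof f g).
End Pointwise.

End Smooth.

Section Tangent.
Context {R : realType} {m : nat} (M : manifold R m).
Local Notation C := (smooth M).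

(* Vector fields are the derivations of C^oo(M), 1-forms the C^oo(M)-linear
   functionals on vector fields. *)
Record vfield := VField {
  vf_fun :> C -> C;
  vf_lin : forall (c : R) f g, vf_fun (scst M c * f + g) =
                               scst M c * vf_fun f + vf_fun g;
  vf_leibniz : forall f g, vf_fun (f * g) = vf_fun f * g + f * vf_fun g }.

Lemma vf_eq (X Y : vfield) : (forall f, X f = Y f) -> X = Y.
Proof.
case: X Y => [X Xl XL] [Y Yl YL] /= /funext XY; rewrite XY in Xl XL *.
by rewrite (Prop_irrelevance Xl Yl) (Prop_irrelevance XL YL).
Qed.

HB.instance Definition _ := gen_eqMixin vfield.
HB.instance Definition _ := gen_choiceMixin vfield.

Program Definition vf0 : vfield := @VField (fun=> 0) _ _.
Next Obligation. by move=> * /=; rewrite mulr0 addr0. Qed.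
Next Obligation. by move=> * /=; rewrite mul0r mulr0 addr0. Qed.

Program Definition vf_add (X Y : vfield) : vfield :=
  @VField (fun f => X f + Y f) _ _.
Next Obligation. by move=> * /=; rewrite !vf_lin mulrDr addrACA. Qed.
Next Obligation. by move=> * /=; rewrite !vf_leibniz mulrDl mulrDr addrACA. Qed.

Program Definition vf_scale (a : C) (X : vfield) : vfield :=
  @VField (fun f => a * X f) _ _.
Next Obligation. by move=> * /=; rewrite vf_lin mulrDr mulrCA. Qed.
Next Obligation. by move=> * /=; rewrite vf_leibniz; ring. Qed.

Fact vf_addA : associative vf_add.
Proof. by move=> X Y Z; apply: vf_eq => f /=; rewrite addrA. Qed.
Fact vf_addC : commutative vf_add.
Proof. by move=> X Y; apply: vf_eq => f /=; rewrite addrC. Qed.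
Fact vf_add0 : left_id vf0 vf_add.
Proof. by move=> X; apply: vf_eq => f /=; rewrite add0r. Qed.
Fact vf_addN : left_inverse vf0 (vf_scale (-1)) vf_add.
Proof. by move=> X; apply: vf_eq => f /=; rewrite mulN1r addNr. Qed.
HB.instance Definition _ :=
  GRing.isZmodule.Build vfield vf_addA vf_addC vf_add0 vf_addN.

Fact vf_scaleA (a b : C) (X : vfield) :
  vf_scale a (vf_scale b X) = vf_scale (a * b) X.
Proof. by apply: vf_eq => f /=; rewrite mulrA. Qed.
Fact vf_scale1 : left_id 1 vf_scale.
Proof. by move=> X; apply: vf_eq => f /=; rewrite mul1r. Qed.
Fact vf_scaleDr : right_distributive vf_scale +%R.
Proof. by move=> a X Y; apply: vf_eq => f /=; rewrite mulrDr. Qed.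
Fact vf_scaleDl (X : vfield) : {morph vf_scale^~ X : a b / a + b}.
Proof. by move=> a b; apply: vf_eq => f /=; rewrite mulrDl. Qed.
HB.instance Definition _ := GRing.Zmodule_isLmodule.Build C vfield
  vf_scaleA vf_scale1 vf_scaleDr vf_scaleDl.

Lemma vfD (X : vfield) f g : X (f + g) = X f + X g.
Proof.
have := vf_lin X 1 f g; have -> : scst M 1 = 1 by [].
by rewrite !mul1r.
Qed.

Lemma vfN (X : vfield) f : X (- f) = - X f.
Proof.
have X0 : X 0 = 0 by apply: (addrI (X 0)); rewrite -vfD !addr0.
by apply/eqP; rewrite -addr_eq0 -vfD addNr X0.
Qed.

Program Definition vf_bracket (X Y : vfield) : vfield :=
  @VField (fun f => X (Y f) - Y (X f)) _ _.
Next Obligation. by move=> * /=; rewrite !vf_lin mulrBr opprD addrACA. Qed.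
Next Obligation. by move=> X Y f g /=; rewrite !vf_leibniz !vfD !vf_leibniz; ring. Qed.

Record form1 := Form1 {
  fm_fun :> vfield -> C;
  fm_lin : forall (f : C) X Y, fm_fun (f *: X + Y) = f * fm_fun X + fm_fun Y }.

Lemma fm_eq (a b : form1) : (forall X, a X = b X) -> a = b.
Proof.
case: a b => [a al] [b bl] /= /funext ab; rewrite ab in al *.
by rewrite (Prop_irrelevance al bl).
Qed.

HB.instance Definition _ := gen_eqMixin form1.
HB.instance Definition _ := gen_choiceMixin form1.

Program Definition fm0 : form1 := @Form1 (fun=> 0) _.
Next Obligation. by move=> * /=; rewrite mulr0 addr0. Qed.
Program Definition fm_add (a b : form1) : form1 :=
  @Form1 (fun X => a X + b X) _.
Next Obligation. by move=> * /=; rewrite !fm_lin mulrDr addrACA. Qed.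
Program Definition fm_scale (f : C) (a : form1) : form1 :=
  @Form1 (fun X => f * a X) _.
Next Obligation. by move=> * /=; rewrite fm_lin mulrDr mulrCA. Qed.

Fact fm_addA : associative fm_add.
Proof. by move=> a b c; apply: fm_eq => X /=; rewrite addrA. Qed.
Fact fm_addC : commutative fm_add.
Proof. by move=> a b; apply: fm_eq => X /=; rewrite addrC. Qed.
Fact fm_add0 : left_id fm0 fm_add.
Proof. by move=> a; apply: fm_eq => X /=; rewrite add0r. Qed.
Fact fm_addN : left_inverse fm0 (fm_scale (-1)) fm_add.
Proof. by move=> a; apply: fm_eq => X /=; rewrite mulN1r addNr. Qed.
HB.instance Definition _ :=
  GRing.isZmodule.Build form1 fm_addA fm_addC fm_add0 fm_addN.

Fact fm_scaleA (f g : C) (a : form1) :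
  fm_scale f (fm_scale g a) = fm_scale (f * g) a.
Proof. by apply: fm_eq => X /=; rewrite mulrA. Qed.
Fact fm_scale1 : left_id 1 fm_scale.
Proof. by move=> a; apply: fm_eq => X /=; rewrite mul1r. Qed.
Fact fm_scaleDr : right_distributive fm_scale +%R.
Proof. by move=> f a b; apply: fm_eq => X /=; rewrite mulrDr. Qed.
Fact fm_scaleDl (a : form1) : {morph fm_scale^~ a : f g / f + g}.
Proof. by move=> f g; apply: fm_eq => X /=; rewrite mulrDl. Qed.
HB.instance Definition _ := GRing.Zmodule_isLmodule.Build C form1
  fm_scaleA fm_scale1 fm_scaleDr fm_scaleDl.

Lemma fmD (a : form1) X Y : a (X + Y) = a X + a Y.
Proof. by have := fm_lin a 1 X Y; rewrite scale1r mul1r. Qed.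

Lemma fmZ (a : form1) f X : a (f *: X) = f * a X.
Proof.
have a0 : a 0 = 0 by apply: (addrI (a 0)); rewrite -fmD !addr0.
by rewrite -[f *: X]addr0 fm_lin a0 addr0.
Qed.

Lemma vf_bracketr (f : C) (X Y Z : vfield) :
  vf_bracket Z (f *: X + Y) =
  f *: vf_bracket Z X + (vf_bracket Z Y + Z f *: X).
Proof.
apply: vf_eq => g /=; rewrite vfD vf_leibniz.
by ring.
Qed.

Program Definition fm_d (f : C) : form1 := @Form1 (fun X => X f) _.
Next Obligation. by []. Qed.

Program Definition fm_Lie (Y : vfield) (a : form1) : form1 :=
  @Form1 (fun X => Y (a X) - a (vf_bracket Y X)) _.
Next Obligation.
move=> Y a f X X' /=; rewrite vf_bracketr !(fmD, fmZ) !(vfD, vf_leibniz) /=.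
by ring.
Qed.

(* The contraction of the 2-form [da] with [Y]. *)
Program Definition fm_id (Y : vfield) (a : form1) : form1 :=
  @Form1 (fun X => Y (a X) - X (a Y) - a (vf_bracket Y X)) _.
Next Obligation.
move=> Y a f X X' /=; rewrite vf_bracketr !(fmD, fmZ) !(vfD, vf_leibniz) /=.
by ring.
Qed.

Definition connected_manifold := [set: M] !=set0 /\ connected [set: M].

Definition closed1 (a : form1) :=
  forall X Y : vfield, X (a Y) - Y (a X) - a (vf_bracket X Y) = 0.

Definition H1_trivial := forall a : form1, closed1 a -> exists f, a = fm_d f.

(* Componentwise derivative of a vector-valued function. *)
Definition vder {V : vectType R} (X : vfield) (B : vsmooth M V) : vsmooth M V :=
  \sum_(k < \dim {:V}) X (vcoord B k) *: vcst M (vbasis fullv)`_k.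

End Tangent.

(* Exterior algebra of a K-module E, as finite sums of terms
   f *: (e_1 /\ ... /\ e_p), encoded as pairs (f, [:: e_1; ...; e_p]).
   Representatives of the same element of the exterior algebra are identified
   only through [ev], the evaluation on tuples of elements of a module F paired
   with E: equality in /\E is always expressed as equality of [ev].
   The elements of /\^2 E are in the same way written [:: (u_1, v_1); ...],
   meaning u_1 /\ v_1 + ... *)
Section Exterior.
Context {K : comPzRingType} {E F : lmodType K}.

Definition multi := seq (K * seq E).
Definition wedge2 := seq (E * E).

Definition homog (k : nat) (P : multi) : bool := all (fun t => size t.2 == k) P.
Definition mscale (c : K) (P : multi) : multi := [seq (c * t.1, t.2) | t <- P].
Definition multi1 (e : E) : multi := [:: (1, [:: e])].
Definition multi2 (c : wedge2) : multi := [seq (1, [:: p.1; p.2]) | p <- c].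

Definition rem_at {T : Type} (i : nat) (s : seq T) := take i s ++ drop i.+1 s.

Section Evaluation.
Variable pair : F -> E -> K.

Definition ev (P : multi) (a : seq F) : K :=
  \sum_(t <- P) t.1 *
    (if size t.2 == size a then
       \det (\matrix_(i < size a, j < size a) pair a`_i t.2`_j)
     else 0).

Definition ev2 (c : wedge2) (a b : F) : K :=
  \sum_(p <- c) (pair a p.1 * pair b p.2 - pair a p.2 * pair b p.1).
End Evaluation.

Section Schouten.
Variables (act : E -> K -> K) (br : E -> E -> E).

(* Schouten bracket of f *: (e_1 /\ ... /\ e_p) with g *: (e'_1 /\ ... /\ e'_q).
   The signs are those forced by [e, f] = act e f,
   [P, Q] = - (-1)^((p-1)(q-1)) [Q, P] and
   [P, Q /\ R] = [P, Q] /\ R + (-1)^((p-1)q) Q /\ [P, R]. *)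
Definition schouten1 (t u : K * seq E) : multi :=
  [seq (t.1 * u.1 * (-1) ^+ (i + j),
        br t.2`_i u.2`_j :: rem_at i t.2 ++ rem_at j u.2)
     | i <- iota 0 (size t.2), j <- iota 0 (size u.2)]
  ++ [seq (t.1 * (-1) ^+ ((size t.2).-1 - i) * act t.2`_i u.1,
           rem_at i t.2 ++ u.2) | i <- iota 0 (size t.2)]
  ++ [seq (u.1 * (-1) ^+ j.+1 * act u.2`_j t.1,
           t.2 ++ rem_at j u.2) | j <- iota 0 (size u.2)].

Definition schouten (P Q : multi) : multi :=
  flatten [seq schouten1 t u | t <- P, u <- Q].
End Schouten.

(* The K-linear degree-one derivation extending D : E -> /\^2 E. *)
Definition dext (D : E -> multi) (P : multi) : multi :=
  flatten [seq [seq (t.1 * (-1) ^+ i * d.1, take i t.2 ++ d.2 ++ drop i.+1 t.2)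
                  | d <- D t.2`_i]
             | t <- P, i <- iota 0 (size t.2)].

End Exterior.
Arguments multi {K} E.
Arguments wedge2 {K} E.

(* The differential of a Lie algebroid F, on the sections of /\ F^*. *)
Definition koszul {K : comPzRingType} {F : lmodType K}
    (act : F -> K -> K) (br : F -> F -> F) (P : seq F -> K) (a : seq F) : K :=
  \sum_(i < size a) (-1) ^+ i * act a`_i (P (rem_at i a)) +
  \sum_(i < size a) \sum_(j < size a | (i < j)%N)
    (-1) ^+ (i + j) * P (br a`_i a`_j :: rem_at i (rem_at j a)).

Section LieAlgebroid.
Context {R : realType} {m : nat} {M : manifold R m}.
Local Notation C := (smooth M).

Record algebroid (E : lmodType C) := Algebroid {
  anchor : E -> vfield M;
  brk : E -> E -> E }.

Definition is_lie_algebroid (E : lmodType C) (L : algebroid E) : Prop :=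
  [/\ forall (f : C) a b, anchor L (f *: a + b) = f *: anchor L a + anchor L b,
      [/\ forall (c : R) a b b',
            brk L a (scst M c *: b + b') = scst M c *: brk L a b + brk L a b',
          forall a b, brk L a b = - brk L b a &
          forall a b c, brk L a (brk L b c) + brk L b (brk L c a)
                        + brk L c (brk L a b) = 0],
      forall a b, anchor L (brk L a b) = vf_bracket (anchor L a) (anchor L b) &
      forall a (f : C) b, brk L a (f *: b) = f *: brk L a b + anchor L a f *: b].

Definition is_iso (E1 E2 : lmodType C) (L1 : algebroid E1) (L2 : algebroid E2)
    (h : E1 -> E2) : Prop :=
  [/\ bijective h,
      forall (f : C) a b, h (f *: a + b) = f *: h a + h b,
      forall a, anchor L2 (h a) = anchor L1 a &
      forall a b, h (brk L1 a b) = brk L2 (h a) (h b)].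

Definition isomorphic (E1 E2 : lmodType C) (L1 : algebroid E1)
    (L2 : algebroid E2) : Prop := exists h, is_iso L1 L2 h.

End LieAlgebroid.

Section LieAlgebra.
Context {R : realType}.

Definition is_lie_bracket (V : lmodType R) (b : V -> V -> V) : Prop :=
  [/\ bilin b, forall A, b A A = 0 &
      forall A B D, b A (b B D) + b B (b D A) + b D (b A B) = 0].

Record lieAlgebra := LieAlgebra {
  lsort :> vectType R;
  lbr : lsort -> lsort -> lsort;
  lbrP : is_lie_bracket lbr }.

Definition ldual (g : lieAlgebra) : vectType R := 'Hom(lsort g, R^o).

End LieAlgebra.
Arguments lieAlgebra : clear implicits.

Section Algebra.
Context {R : realType} (g : lieAlgebra R).
Local Notation g' := (ldual g).
Local Notation "[ A , B ]g" := (lbr A B).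

Definition gpair (xi : g') (A : g) : R := xi A.

(* [g] as a Lie algebroid over a point. *)
Definition gschouten : multi g -> multi g -> multi g :=
  schouten (fun _ _ => 0) (@lbr R g).

Record cobracket := Cobracket {
  cobr :> g -> wedge2 g;
  cobr_lin : forall (c : R) A B xi eta,
    ev2 gpair (cobr (c *: A + B)) xi eta =
    c * ev2 gpair (cobr A) xi eta + ev2 gpair (cobr B) xi eta }.

Definition is_cocycle (delta : cobracket) : Prop :=
  forall A B s, ev gpair (multi2 (delta [A, B]g)) s =
    ev gpair (gschouten (multi2 (delta A)) (multi1 B)
              ++ gschouten (multi1 A) (multi2 (delta B))) s.

Definition gdelta (delta : cobracket) : multi g -> multi g :=
  dext (fun A => multi2 (delta A)).

Section DualBracket.
Variables (delta : cobracket) (xi eta : g').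

Let f (A : g) : R^o := ev2 gpair (delta A) xi eta.
Fact dual_bracket_linear : linear f.
Proof. by move=> c A B; rewrite /f cobr_lin. Qed.
HB.instance Definition _ := GRing.isLinear.Build R g R^o *:%R f
  dual_bracket_linear.
Definition dual_bracket : g' := linfun f.

Lemma dual_bracketE A : dual_bracket A = ev2 gpair (delta A) xi eta.
Proof. by rewrite lfunE. Qed.
End DualBracket.

Lemma dual_bracket_bilin delta : bilin (dual_bracket delta).
Proof.
split=> c u v w; apply/lfunP => A.
all: rewrite !(dual_bracketE, add_lfunE, scale_lfunE) /ev2 scaler_sumr.
all: rewrite -big_split /=; apply: eq_bigr => p _.
all: by rewrite /gpair !(add_lfunE, scale_lfunE) /GRing.scale /=; ring.
Qed.

Definition is_lie_bialgebra (delta : cobracket) : Prop :=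
  is_cocycle delta /\ is_lie_bracket (dual_bracket delta).

Section AdStar.
Variables (A : g) (xi : g').
Let f (B : g) : R^o := - xi [A, B]g.
Fact ad_star_linear : linear f.
Proof.
have [[_ br] _ _] := lbrP g.
by move=> c B B'; rewrite /f br linearP opprD scalerN.
Qed.
HB.instance Definition _ := GRing.isLinear.Build R g R^o *:%R f ad_star_linear.
Definition ad_star : g' := linfun f.
Lemma ad_starE B : ad_star B = - xi [A, B]g.
Proof. by rewrite lfunE. Qed.
End AdStar.

Lemma ad_star_bilin : bilin ad_star.
Proof.
have [[bl _] _ _] := lbrP g.
split=> c u v w; apply/lfunP => A.
  by rewrite !(ad_starE, add_lfunE, scale_lfunE) bl linearP opprD scalerN.
by rewrite !(ad_starE, add_lfunE, scale_lfunE) opprD scalerN.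
Qed.

Fact lbr_bilin : bilin (@lbr R g). Proof. by case: (lbrP g). Qed.

Fact eval_bilin : bilin (fun (xi : g') (A : g) => (xi A : R^o)).
Proof.
split=> c u v w; first by rewrite add_lfunE scale_lfunE.
by rewrite linearP.
Qed.

End Algebra.

Section Transitive.
Context {R : realType} {m : nat} (M : manifold R m) (g : lieAlgebra R).
Local Notation C := (smooth M).
Local Notation X1 := (vfield M).
Local Notation O1 := (form1 M).
Local Notation g' := (ldual g).
Local Notation Cg := (vsmooth M g).
Local Notation Cg' := (vsmooth M g').
Local Notation cst := (scst M).

Definition vlie (A B : Cg) : Cg := vbil (lbr_bilin g) A B.

Fact vpair_subproof (xi : Cg') (A : Cg) : smoothP (fun x => xi x (A x)).
Proof.
have := @vsvalP _ _ _ _ (vbil (eval_bilin g) xi A).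
by move/(_ (GRing.Linear.clone _ _ _ _ (@idfun R^o) _)).
Qed.
Definition vpair (xi : Cg') (A : Cg) : C := Smooth (vpair_subproof xi A).

Lemma vpairP (xi : Cg') (f : C) (A B : Cg) :
  vpair xi (f *: A + B) = f * vpair xi A + vpair xi B.
Proof. by apply: smooth_eq => x /=; rewrite linearP. Qed.

Lemma vderP (f : C) (X Y : X1) (B : Cg) :
  vder (f *: X + Y) B = f *: vder X B + vder Y B.
Proof.
rewrite /vder scaler_sumr -big_split; apply: eq_bigr => k _ /=.
by rewrite scalerA -scalerDl.
Qed.

(* The 1-form <xi, dB>. *)
Program Definition vpair_d (xi : Cg') (B : Cg) : O1 :=
  @Form1 _ _ _ (fun X => vpair xi (vder X B)) _.
Next Obligation. by move=> xi B f X Y /=; rewrite vderP vpairP. Qed.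

Definition TM : algebroid X1 := Algebroid id (@vf_bracket R m M).

Definition TMpair (a : O1) (X : X1) : C := a X.
Definition TMschouten : multi X1 -> multi X1 -> multi X1 :=
  schouten (fun (X : X1) f => X f) (@vf_bracket R m M).

(* Sections of A = TM + (M x g) and of A^* = T^*M + (M x g^* ). *)
Definition GA : lmodType C := (X1 * Cg)%type.
Definition GA' : lmodType C := (O1 * Cg')%type.

Definition Apair (a : GA') (e : GA) : C := a.1 e.1 + vpair a.2 e.2.

Definition tralg : algebroid GA :=
  Algebroid (fun e : GA => e.1) (fun e e' : GA =>
    (vf_bracket e.1 e'.1, vder e.1 e'.2 - vder e'.1 e.2 + vlie e.2 e'.2)).

Definition Aschouten : multi GA -> multi GA -> multi GA :=
  schouten (fun (e : GA) f => anchor tralg e f) (brk tralg).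

Definition inX (X : X1) : GA := (X, 0).
Definition ing (A : g) : GA := (0, vcst M A).
Definition ing' (xi : g') : GA' := (0, vcst M xi).

(* [tensor] is X(M) (x) g; [wedge2_fun] is C^oo(M, /\^2 g), the list of the
   (tau_a, c_a) standing for the sum of the tau_a c_a. *)
Definition bivector := wedge2 X1.
Definition tensor := seq (X1 * g).
Definition wedge2_fun := seq (C * wedge2 g).

Definition pi_sharp (pi : bivector) (a : O1) : X1 :=
  \sum_(p <- pi) (a p.1 *: p.2 - a p.2 *: p.1).

Definition theta_sharp (theta : tensor) (a : O1) : Cg :=
  \sum_(t <- theta) a t.1 *: vcst M t.2.

Definition theta_star (theta : tensor) (xi : Cg') : X1 :=
  \sum_(t <- theta) vpair xi (vcst M t.2) *: t.1.

Definition koszul_bracket (pi : bivector) (a b : O1) : O1 :=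
  fm_Lie (pi_sharp pi a) b - fm_Lie (pi_sharp pi b) a - fm_d (ev2 TMpair pi a b).

Definition is_poisson (pi : bivector) : Prop :=
  forall s, ev TMpair (TMschouten (multi2 pi) (multi2 pi)) s = 0.

Definition tau_ev (tau : wedge2_fun) (xi eta : g') : C :=
  \sum_(t <- tau) t.1 * cst (ev2 (@gpair R g) t.2 xi eta).

Definition pi_multi (pi : bivector) : multi GA :=
  [seq (1, [:: inX p.1; inX p.2]) | p <- pi].
Definition K_multi (theta : tensor) : multi GA :=
  [seq (1, [:: inX t.1; ing t.2]) | t <- theta].
Definition tau_multi (tau : wedge2_fun) : multi GA :=
  flatten [seq [seq (t.1, [:: ing p.1; ing p.2]) | p <- t.2] | t <- tau].

(* The value of the extended cobracket on X + B; it vanishes on functions and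
   vector fields, hence is C^oo(M)-linear in B. *)
Definition delta_section (delta : cobracket g) (e : GA) : multi GA :=
  flatten [seq [seq (vcoord e.2 k, [:: ing p.1; ing p.2])
                  | p <- delta (vbasis fullv)`_k]
             | k <- enum 'I_(\dim {:g})].

Definition Adelta (delta : cobracket g) : multi GA -> multi GA :=
  dext (delta_section delta).

(* Elements of X(M) (x) /\^2 g, evaluated on (g^* )^2. *)
Definition tens2_ev (s : seq (X1 * wedge2 g)) (xi eta : g') : X1 :=
  \sum_(t <- s) cst (ev2 (@gpair R g) t.2 xi eta) *: t.1.

Definition ad_wedge2 (A : g) (c : wedge2 g) : wedge2 g :=
  [seq (lbr A p.1, p.2) | p <- c] ++ [seq (p.1, lbr A p.2) | p <- c].

Definition delta_theta (delta : cobracket g) (theta : tensor) :=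
  [seq (t.1, delta t.2) | t <- theta].
Definition theta_theta (theta : tensor) : seq (X1 * wedge2 g) :=
  [seq (vf_bracket t.1 u.1, [:: (t.2, u.2)]) | t <- theta, u <- theta].
Definition tau_theta (tau : wedge2_fun) (theta : tensor) :=
  [seq (a.1 *: t.1, ad_wedge2 t.2 a.2) | t <- theta, a <- tau].
Definition pi_dtau (pi : bivector) (tau : wedge2_fun) :=
  [seq (pi_sharp pi (fm_d a.1), a.2) | a <- tau].

Definition Alt_theta_dtau (theta : tensor) (tau : wedge2_fun)
    (xi eta zeta : g') : C :=
  let F x y z := vpair (vcst M z) (theta_sharp theta (fm_d (tau_ev tau x y))) in
  F xi eta zeta + F eta zeta xi + F zeta xi eta.

Definition T_ev (theta : tensor) (tau : wedge2_fun) (delta : cobracket g)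
    (xi eta zeta : g') : C :=
  ev Apair (Adelta delta (tau_multi tau)
            ++ mscale (cst 2^-1) (Aschouten (tau_multi tau) (tau_multi tau)))
     [:: ing' xi; ing' eta; ing' zeta]
  + Alt_theta_dtau theta tau xi eta zeta.

Record quadruple := Quadruple {
  qpi : bivector;
  qtheta : tensor;
  qtau : wedge2_fun;
  qdelta : cobracket g }.

Definition theta_morphism (pi : bivector) (theta : tensor) : Prop :=
  forall a b, theta_sharp theta (koszul_bracket pi a b) =
    vder (pi_sharp pi a) (theta_sharp theta b)
    - vder (pi_sharp pi b) (theta_sharp theta a)
    + vlie (theta_sharp theta a) (theta_sharp theta b).

Definition admissible (q : quadruple) : Prop :=
  let: Quadruple pi theta tau delta := q in
  [/\ is_cocycle delta,
      is_poisson pi,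
      theta_morphism pi theta,
      forall xi eta,
        tens2_ev (delta_theta delta theta) xi eta
        + cst 2^-1 *: tens2_ev (theta_theta theta) xi eta
        = tens2_ev (tau_theta tau theta) xi eta
          - tens2_ev (pi_dtau pi tau) xi eta &
      (* T is the constant T0, and delta^2 + [T, .] = 0 on g *)
      exists T0 : multi g,
        [/\ homog 3 T0,
            forall xi eta zeta, T_ev theta tau delta xi eta zeta =
              cst (ev (@gpair R g) T0 [:: xi; eta; zeta]) &
            forall (B : g) s,
              ev (@gpair R g) (gdelta delta (multi2 (delta B))
                               ++ gschouten T0 (multi1 B)) s = 0]].

Definition equivalent (q1 q2 : quadruple) : Prop :=
  [/\ forall a b, ev2 TMpair (qpi q1) a b = ev2 TMpair (qpi q2) a b,
      forall a, theta_sharp (qtheta q1) a = theta_sharp (qtheta q2) a &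
      exists r0 : wedge2 g,
        (forall xi eta, tau_ev (qtau q1) xi eta =
           tau_ev (qtau q2) xi eta + cst (ev2 (@gpair R g) r0 xi eta)) /\
        (forall (B : g) s, ev (@gpair R g) (multi2 (qdelta q1 B)) s =
           ev (@gpair R g) (multi2 (qdelta q2 B)) s
           - ev (@gpair R g) (gschouten (multi2 r0) (multi1 B)) s)].

(* d_* = [pi + K - tau, .] - delta, in all degrees. *)
Definition dstar (q : quadruple) (P : multi GA) : multi GA :=
  Aschouten (pi_multi (qpi q) ++ K_multi (qtheta q)
             ++ mscale (-1) (tau_multi (qtau q))) P
  ++ mscale (-1) (Adelta (qdelta q) P).

(* The differential of a Lie algebroid structure on A^*. *)
Definition dual_diff (L : algebroid GA') : (seq GA' -> C) -> seq GA' -> C :=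
  koszul (fun (a : GA') f => anchor L a f) (brk L).

(* Sections of /\^k A for which no expression by decomposables is given, such as
   d_* e, enter the Schouten bracket through representatives P1, P2. *)
Definition is_lie_bialgebroid (L : algebroid GA') : Prop :=
  is_lie_algebroid L /\
  forall e1 e2 : GA, exists P1 P2 : multi GA,
    [/\ homog 2 P1 /\ homog 2 P2,
        forall s, dual_diff L (ev Apair (multi1 e1)) s = ev Apair P1 s,
        forall s, dual_diff L (ev Apair (multi1 e2)) s = ev Apair P2 s &
        forall s, dual_diff L (ev Apair (multi1 (brk tralg e1 e2))) s =
          ev Apair (Aschouten P1 (multi1 e2) ++ Aschouten (multi1 e1) P2) s].

Definition corresponds (q : quadruple) (L : algebroid GA') : Prop :=
  is_lie_bialgebroid L /\
  forall P s, dual_diff L (ev Apair P) s = ev Apair (dstar q P) s.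

Definition action_field (theta : tensor) (xi : Cg') : X1 :=
  - theta_star theta xi.

(* The infinitesimal action is [action_field], i.e. -(theta^#)^*, and its dual
   map is -theta^#; L_X pi is the Schouten bracket [X, pi]. *)
Definition is_poisson_action (pi : bivector) (theta : tensor)
    (delta : cobracket g) : Prop :=
  (forall xi eta : g',
     action_field theta (vcst M (dual_bracket delta xi eta)) =
     vf_bracket (action_field theta (vcst M xi))
                (action_field theta (vcst M eta))) /\
  (forall (xi : g') (a b : O1),
     ev TMpair (TMschouten (multi1 (action_field theta (vcst M xi)))
                           (multi2 pi)) [:: a; b] =
     - vpair (vcst M xi) (vlie (- theta_sharp theta a) (- theta_sharp theta b))).

Definition mp_phi (pi : bivector) (theta : tensor) (a : O1) (xi : Cg') : Cg' :=
  vder (pi_sharp pi a) xi + vbil (ad_star_bilin g) (theta_sharp theta a) xi.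

Definition mp_psi (theta : tensor) (xi : Cg') (a : O1) : O1 :=
  - vpair_d xi (theta_sharp theta a) - fm_id (theta_star theta xi) a.

Definition action_bracket (theta : tensor) (delta : cobracket g)
    (xi eta : Cg') : Cg' :=
  vbil (dual_bracket_bilin delta) xi eta
  + vder (action_field theta xi) eta - vder (action_field theta eta) xi.

Definition mp_double (pi : bivector) (theta : tensor) (delta : cobracket g) :
    algebroid GA' :=
  Algebroid
    (fun a : GA' => pi_sharp pi a.1 + action_field theta a.2)
    (fun a b : GA' =>
      (koszul_bracket pi a.1 b.1 + mp_psi theta a.2 b.1 - mp_psi theta b.2 a.1,
       action_bracket theta delta a.2 b.2
       + mp_phi pi theta a.1 b.2 - mp_phi pi theta b.1 a.2)).

(* (pi, theta, delta) is a Poisson action of the Lie bialgebra dual to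
   (g, delta). *)
Definition poisson_action_data (pi : bivector) (theta : tensor)
    (delta : cobracket g) : Prop :=
  [/\ is_poisson pi, is_lie_bialgebra delta & is_poisson_action pi theta delta].

(* A^* and the double have the same underlying bundle T^*M + (M x g^* ); A^* is
   the double when the two Lie algebroid structures coincide on it. This is
   stronger than being isomorphic: an abstract isomorphism need not respect the
   two summands. *)
Definition is_double (L : algebroid GA') (pi : bivector) (theta : tensor)
    (delta : cobracket g) : Prop := is_iso L (mp_double pi theta delta) id.

End Transitive.

(* Main.v *)
From HB Require Import structures.
From mathcomp Require Import all_boot all_order all_algebra.
From mathcomp Require Import all_classical all_reals all_analysis.
From mathcomp Require Import ring.
Require Import Defs.
Set Implicit Arguments.
Unset Strict Implicit.
Unset Printing Implicit Defensive.
Import Order.TTheory GRing.Theory Num.Theory.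
Local Open Scope ring_scope.

(** When tau = 0 the tensor T vanishes, and delta^2 + [T, .] = 0 becomes
    delta^2 = 0, which is the Jacobi identity of the dual bracket
    ([lie_bracket_of_square], [square_of_lie_bracket]).  The conditions on theta
    are the two halves of the Poisson action.  Writing theta = sum X_t (x) A_t,
    the morphism property of theta^# and the condition on L_phi(xi) pi both
    amount to  sum_t (L_{X_t} pi)(a, b) A_t = [theta^# a, theta^# b]
    ([action_pi]), because
    [a, b]_pi (X) = pi^# a (b X) - pi^# b (a X) + (L_X pi)(a, b).  And both
    delta theta + 1/2 [theta, theta] = 0 and the fact that phi is a Lie morphism
    say that theta^* carries [xi, eta] to - [theta^* xi, theta^* eta] on constant
    xi, eta ([action_lie]).  This gives the first claim.

    The remaining claims follow from one observation: a Lie algebroid structure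
    on A^* is determined by its differential in degrees 0 and 1, since sections
    of A separate those of A^*.  The double satisfies
    <[a,b], e> = rho(a)<b,e> - rho(b)<a,e> - (d_* e)(a,b)  with
    d_* e = [pi + K, e] - delta e  ([brk_double]), and rho(a) f = (d_* f)(a)
    ([anchor_double]).  As the Koszul differential and [pi + K, .] - delta are
    both graded derivations, agreement in degrees 0 and 1 is agreement in all
    degrees; hence an L has d_* as its differential exactly when its anchor and
    bracket are those of the double ([dual_diff_dstar]).  So the isomorphism is
    the identity, and comparing quadruples reduces to comparing doubles
    ([double_eq], [equivalent_eq]).

    What has to be shown in addition is that the double is a Lie algebroid and a
    Lie bialgebroid.  For Pi = pi + K the components of
    [Pi, Pi] = 2 delta Pi  are [pi, pi] = 0, [action_pi] and [action_lie]
    ([maurer_cartan_of_action]).  Taking the Lie derivative of this equation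
    along e and using that the bracket of bivectors is symmetric yields
    d_*^2 e = 0 ([codiff_square]), which is the Jacobi identity paired with e
    ([jacobi_pair]); evaluating the equation on (a, b, df) gives the morphism
    property of the anchor ([anchor_morphism]).  Compatibility of d_* with the
    bracket of A is L_[e1,e2] = [L_e1, L_e2] together with the cocycle
    condition ([codiff_compat]).

    Elements of an exterior power are known only through their evaluations, so
    the computations are made with functions on lists of sections.  Forms are
    built by iterated wedge products with 1-forms, defined by recursion on the
    list of arguments; identities are proved by contracting with the first
    argument, as in Cartan calculus, and determinants enter only through
    Laplace expansion ([det_wedge]). *)

(** * Forms as functions on lists of arguments *)

Section Forms.
Context {K : comPzRingType} {F : Type}.
Implicit Types (P Q : seq F -> K) (w : F -> K) (h : F -> F -> K).

Definition contract (a : F) P : seq F -> K := fun s => P (a :: s).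

(** The product w /\ P with a 1-form w, unfolded by the rule
    i_a (w /\ P) = w(a) P - w /\ i_a P. *)
Fixpoint wedge1 w P (s : seq F) : K :=
  if s is a :: s' then w a * P s' - wedge1 w (contract a P) s' else 0.

(** The product h /\ P with a 2-form h, by the rule
    i_a (h /\ P) = (i_a h) /\ P + h /\ i_a P. *)
Fixpoint wedge2f h P (s : seq F) : K :=
  if s is a :: s' then wedge1 (h a) P s' + wedge2f h (contract a P) s' else 0.

Lemma contract_wedge1 a w P :
  contract a (wedge1 w P) = fun t => w a * P t - wedge1 w (contract a P) t.
Proof. by []. Qed.

Lemma wedge1_eql w w' P s : w =1 w' -> wedge1 w P s = wedge1 w' P s.
Proof. by move/funext->. Qed.

Lemma wedge1_eqr w P P' s : P =1 P' -> wedge1 w P s = wedge1 w P' s.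
Proof. by move/funext->. Qed.

Lemma wedge1_linr w c P Q s :
  wedge1 w (fun t => c * P t - Q t) s = c * wedge1 w P s - wedge1 w Q s.
Proof.
elim: s P Q => [|a s IH] P Q /=; first by ring.
by rewrite (IH (contract a P) (contract a Q)); ring.
Qed.

Lemma wedge1Dr w P Q s : wedge1 w (fun t => P t + Q t) s = wedge1 w P s + wedge1 w Q s.
Proof.
elim: s P Q => [|a s IH] P Q /=; first by ring.
by rewrite (IH (contract a P) (contract a Q)); ring.
Qed.

Lemma wedge1_linl w w' c P s :
  wedge1 (fun a => c * w a + w' a) P s = c * wedge1 w P s + wedge1 w' P s.
Proof.
elim: s P => [|a s IH] P /=; first by ring.
by rewrite IH; ring.
Qed.

Lemma wedge1Bl w w' P s :
  wedge1 (fun a => w a - w' a) P s = wedge1 w P s - wedge1 w' P s.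
Proof.
elim: s P => [|a s IH] P /=; first by ring.
by rewrite IH; ring.
Qed.

Lemma wedge1_anticomm w w' P s : wedge1 w (wedge1 w' P) s = - wedge1 w' (wedge1 w P) s.
Proof.
elim: s P => [|a s IH] P /=; first by rewrite oppr0.
by rewrite !contract_wedge1 !wedge1_linr IH; ring.
Qed.

Lemma wedge2f_linr h c P Q s :
  wedge2f h (fun t => c * P t - Q t) s = c * wedge2f h P s - wedge2f h Q s.
Proof.
elim: s P Q => [|a s IH] P Q /=; first by ring.
by rewrite (IH (contract a P) (contract a Q)) wedge1_linr; ring.
Qed.

Lemma wedge2f_linl h h' c P s :
  wedge2f (fun a b => c * h a b + h' a b) P s = c * wedge2f h P s + wedge2f h' P s.
Proof.
elim: s P => [|a s IH] P /=; first by ring.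
by rewrite IH wedge1_linl; ring.
Qed.

Lemma wedge1_0l P s : wedge1 (fun=> 0) P s = 0.
Proof. by elim: s P => [|a s IH] P //=; rewrite IH; ring. Qed.

Lemma wedge2f_0l P s : wedge2f (fun _ _ => 0) P s = 0.
Proof. by elim: s P => [|a s IH] P //=; rewrite IH wedge1_0l; ring. Qed.

Lemma wedge2f_decomp w w' P s :
  wedge2f (fun a b => w a * w' b - w' a * w b) P s = wedge1 w (wedge1 w' P) s.
Proof.
elim: s P => [|a s IH] P //=; rewrite IH.
rewrite (_ : wedge1 _ P s = w a * wedge1 w' P s - w' a * wedge1 w P s); last first.
  rewrite (@wedge1_eql _ (fun b => w a * w' b + (- w' a * w b + 0))) => [|b].
    by rewrite !wedge1_linl wedge1_0l; ring.
  by ring.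
rewrite [wedge1 w (contract a (wedge1 w' P)) s](@wedge1_eqr _ _
  (fun t => w' a * P t - wedge1 w' (contract a P) t)) //.
by rewrite wedge1_linr; ring.
Qed.

(** Degree two is even: h and w commute without a sign. *)
Lemma wedge2f_wedge1 h w P s : wedge2f h (wedge1 w P) s = wedge1 w (wedge2f h P) s.
Proof.
elim: s P => [|a s IH] P //=.
rewrite (_ : contract a (wedge1 w P) = fun t => w a * P t - wedge1 w (contract a P) t) //.
rewrite wedge2f_linr IH.
rewrite (_ : contract a (wedge2f h P) =
  fun t => wedge1 (h a) P t + wedge2f h (contract a P) t) //.
by rewrite wedge1Dr (wedge1_anticomm (h a)); ring.
Qed.

Section LieDerivative.
Variables (X : K -> K) (D : F -> F).
Hypothesis (XD : forall x y, X (x + y) = X x + X y).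
Hypothesis (XM : forall x y, X (x * y) = X x * y + x * X y).

(** The sum of the values of P obtained by applying D to one argument; it is the
    part of a Lie derivative that moves the arguments. *)
Fixpoint subst_sum P (s : seq F) : K :=
  if s is b :: s' then P (D b :: s') + subst_sum (contract b P) s' else 0.

Definition lieder P (s : seq F) : K := X (P s) - subst_sum P s.

Lemma lieder_cons P b s :
  lieder P (b :: s) = lieder (contract b P) s - P (D b :: s).
Proof. by rewrite /lieder /=; ring. Qed.

Lemma der0 : X 0 = 0.
Proof. by apply: (addrI (X 0)); rewrite -XD !addr0. Qed.
Lemma derN x : X (- x) = - X x.
Proof. by apply/eqP; rewrite -addr_eq0 -XD addNr der0. Qed.
Lemma der1 : X 1 = 0.
Proof.
have : X (1 * 1) = X 1 + X 1 by rewrite XM; ring.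
by rewrite mul1r => /eqP; rewrite addrC -subr_eq subrr => /eqP <-.
Qed.

Lemma lieder_lin c P Q s :
  lieder (fun t => c * P t - Q t) s
  = X c * P s + c * lieder P s - lieder Q s.
Proof.
elim: s P Q => [|b s IH] P Q; first by rewrite /lieder /= XD derN XM; ring.
rewrite !lieder_cons (_ : contract b _ = fun t => c * contract b P t - contract b Q t) //.
by rewrite IH /contract; ring.
Qed.

Lemma lieder_wedge1 w P s :
  lieder (wedge1 w P) s =
  wedge1 (fun b => X (w b) - w (D b)) P s + wedge1 w (lieder P) s.
Proof.
elim: s P => [|b s IH] P; first by rewrite /lieder /= der0; ring.
rewrite lieder_cons /=.
rewrite (_ : contract b (wedge1 w P) = fun t => w b * P t - wedge1 w (contract b P) t) //.
rewrite lieder_lin IH.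
rewrite (@wedge1_eqr _ (contract b (lieder P))
   (fun t => 1 * lieder (contract b P) t - contract (D b) P t)); last first.
  by move=> t; rewrite /contract lieder_cons mul1r.
by rewrite wedge1_linr; ring.
Qed.

End LieDerivative.

Section Koszul.
Variables (act : F -> K -> K) (br : F -> F -> F).
Hypothesis (actD : forall a x y, act a (x + y) = act a x + act a y).
Hypothesis (actM : forall a x y, act a (x * y) = act a x * y + x * act a y).

(** The Koszul differential in the form L_a = i_a d + d i_a, which, unlike the
    alternating sum, can be unfolded one argument at a time. *)
Fixpoint cartan_d P (s : seq F) : K :=
  if s is a :: s' then lieder (act a) (br a) P s' - cartan_d (contract a P) s' else 0.

Lemma cartan_d_lin c P Q s :
  cartan_d (fun t => c * P t - Q t) s =
  wedge1 (act^~ c) P s + c * cartan_d P s - cartan_d Q s.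
Proof.
elim: s P Q => [|a s IH] P Q /=; first by ring.
rewrite lieder_lin // (_ : contract a _ = fun t => c * contract a P t - contract a Q t) //.
by rewrite IH; ring.
Qed.

Definition koszul1 w a b := act a (w b) - act b (w a) - w (br a b).

(** d (w /\ P) = dw /\ P - w /\ dP. Contracting with the first argument turns
    the claim into the derivation property of L_a and the induction hypothesis. *)
Lemma cartan_d_wedge1 w P s :
  cartan_d (wedge1 w P) s = wedge2f (koszul1 w) P s - wedge1 w (cartan_d P) s.
Proof.
elim: s P => [|a s IH] P; first by rewrite /=; ring.
rewrite /= lieder_wedge1 //.
rewrite (_ : contract a (wedge1 w P) = fun t => w a * P t - wedge1 w (contract a P) t) //.
rewrite cartan_d_lin IH.
rewrite (@wedge1_eqr _ (contract a (cartan_d P))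
   (fun t => 1 * lieder (act a) (br a) P t - cartan_d (contract a P) t)); last first.
  by move=> t; rewrite /contract mul1r.
rewrite wedge1_linr.
rewrite (@wedge1_eql (koszul1 w a)
   (fun b => (fun b => act a (w b) - w (br a b)) b - act^~ (w a) b)); last first.
  by move=> b; rewrite /koszul1 /=; ring.
by rewrite (wedge1Bl (fun b => act a (w b) - w (br a b)) (act^~ (w a))); ring.
Qed.

End Koszul.

(** Antisymmetry under adjacent transpositions; it suffices for bringing an
    argument to the front, which is all that the Koszul formula asks for. *)
Definition alternating P :=
  forall s a b t, P (s ++ a :: b :: t) = - P (s ++ b :: a :: t).

Lemma alternating_contract a P : alternating P -> alternating (contract a P).
Proof. by move=> altP s; exact: (altP (a :: s)). Qed.

Lemma alternating_wedge1 w P : alternating P -> alternating (wedge1 w P).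
Proof.
move=> altP s; elim: s P altP => [|x s IH] P altP a b t /=.
  rewrite (_ : contract b (contract a P) =
    fun u => 0 * contract b (contract a P) u - contract a (contract b P) u).
    by rewrite wedge1_linr /contract; ring.
  by apply/funext => u; rewrite /contract (altP [::] a b u) /=; ring.
by rewrite altP (IH _ (alternating_contract x altP)) /contract; ring.
Qed.

Lemma alternating_lin c P Q : alternating P -> alternating Q ->
  alternating (fun t => c * P t + Q t).
Proof. by move=> aP aQ s a b t; rewrite aP aQ; ring. Qed.

End Forms.

(** * The Koszul formula and the determinant as iterated contractions *)

Section KoszulExpansion.
Context {K : comPzRingType} {F : lmodType K}.
Variables (act : F -> K -> K) (br : F -> F -> F).
Implicit Types (P : seq F -> K).

Lemma alternating_swap P a b t : alternating P ->
  P (a :: b :: t) = - P (b :: a :: t).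
Proof. by move=> altP; exact: (altP [::]). Qed.

Lemma subst_sum_rem (D : F -> F) P (s : seq F) : alternating P ->
  \sum_(i < size s) (-1) ^+ i * P (D s`_i :: rem_at i s) = subst_sum D P s.
Proof.
elim: s P => [|b s IH] P altP /=; first by rewrite big_ord0.
rewrite big_ord_recl /= {1}/rem_at /= drop0 mul1r; congr (_ + _).
rewrite -IH; last exact: alternating_contract.
apply: eq_bigr => i _; rewrite /contract /= [rem_at _ _]/= (alternating_swap _ _ _ altP).
by rewrite exprS /rem_at /=; ring.
Qed.

Lemma sum_lt_recl n (G : nat -> nat -> K) :
  \sum_(i < n.+1) \sum_(j < n.+1 | (i < j)%N) G i j =
  \sum_(j < n) G 0%N j.+1 +
  \sum_(i < n) \sum_(j < n | (i < j)%N) G i.+1 j.+1.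
Proof.
rewrite big_ord_recl; congr (_ + _).
  by rewrite big_mkcond big_ord_recl /= add0r.
apply: eq_bigr => i _.
by rewrite big_mkcond big_ord_recl /= add0r [RHS]big_mkcond.
Qed.

(** The terms of the Koszul sum that involve the first argument a are L_a; in the
    others a stands behind the bracket, and moving it to the front gives
    - d (i_a P). *)
Lemma koszul_cartan_d P s : alternating P -> koszul act br P s = cartan_d act br P s.
Proof.
elim: s P => [|a s IH] P altP; first by rewrite /koszul /= !big_ord0 addr0.
rewrite /= -(IH _ (alternating_contract a altP)) /koszul /=.
rewrite big_ord_recl (sum_lt_recl _ (fun i j => (-1) ^+ (i + j) *
  P (br (a :: s)`_i (a :: s)`_j :: rem_at i (rem_at j (a :: s))))) /=.
rewrite mul1r {1}/rem_at /= drop0 /lieder -(subst_sum_rem _ _ altP).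
rewrite (_ : \sum_(i < size s) _ = - \sum_(i < size s)
   (-1) ^+ i * act s`_i (contract a P (rem_at i s))); last first.
  by rewrite -sumrN; apply: eq_bigr => i _; rewrite exprS /rem_at /contract /=; ring.
rewrite (_ : \sum_(j < size s) (-1) ^+ (0 + j.+1) * _ = - \sum_(j < size s)
   (-1) ^+ j * P (br a s`_j :: rem_at j s)); last first.
  rewrite -sumrN; apply: eq_bigr => i _; rewrite add0n exprS /=.
  by rewrite {1}/rem_at /= drop0; ring.
rewrite (_ : \sum_(i < size s) \sum_(j < size s | _) _ =
   - \sum_(i < size s) \sum_(j < size s | (i < j)%N)
    (-1) ^+ (i + j) * contract a P (br s`_i s`_j :: rem_at i (rem_at j s))); last first.
  rewrite -sumrN; apply: eq_bigr => i _; rewrite -sumrN; apply: eq_bigr => j _.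
  rewrite /contract (alternating_swap _ _ _ altP) addSn addnS !exprS /rem_at /=.
  by ring.
by ring.
Qed.
End KoszulExpansion.

Definition unit_form {K : comPzRingType} {F : Type} (s : seq F) : K :=
  (nilp s)%:R.

Section Wedge.
Context {K : comPzRingType} {E F : lmodType K} (pair : F -> E -> K).

Definition wedge (es : seq E) : seq F -> K :=
  foldr (fun e => wedge1 (pair^~ e)) unit_form es.

Lemma alternating_wedge es : alternating (wedge es).
Proof.
elim: es => [|e es IH] /=; last exact: alternating_wedge1.
by move=> [|x s] a b t /=; rewrite oppr0.
Qed.

Lemma wedge1_sum w (P : seq F -> K) (s : seq F) :
  wedge1 w P s = \sum_(i < size s) (-1) ^+ i * w s`_i * P (rem_at i s).
Proof.
elim: s P => [|a s IH] P /=; first by rewrite big_ord0.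
rewrite big_ord_recl /= {1}/rem_at /= drop0 mul1r; congr (_ + _).
rewrite IH -sumrN; apply: eq_bigr => i _.
by rewrite exprS /rem_at /contract /=; ring.
Qed.

Lemma size_rem_at (T : Type) i (s : seq T) : (i < size s)%N ->
  size (rem_at i s) = (size s).-1.
Proof.
move=> lt_i; rewrite /rem_at size_cat size_takel ?size_drop; last exact: ltnW.
by rewrite subnS -!subn1 addnBA ?subn_gt0 // subnKC // ltnW.
Qed.

Lemma wedge_size es s : size es != size s -> wedge es s = 0.
Proof.
elim: es s => [|e es IH] s ne; first by case: s ne.
rewrite /= wedge1_sum big1 // => i _; rewrite IH ?mulr0 // size_rem_at //.
have : (0 < size s)%N by apply: leq_ltn_trans (ltn_ord i).
by move: ne; case: (size s).
Qed.

Lemma nth_rem_at (s : seq F) i j : (i <= size s)%N -> (rem_at i s)`_j = s`_(bump i j).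
Proof.
move=> le_i; rewrite /rem_at nth_cat size_takel // /bump.
case: ltnP => [lt|ge]; first by rewrite nth_take.
by rewrite nth_drop /= add1n addSn subnKC.
Qed.

Lemma wedge1_sumr (I : Type) (r : seq I) w (c : I -> K) (P : I -> seq F -> K) s :
  wedge1 w (fun t => \sum_(i <- r) c i * P i t) s = \sum_(i <- r) c i * wedge1 w (P i) s.
Proof.
rewrite wedge1_sum; under eq_bigr do rewrite mulr_sumr.
rewrite exchange_big; apply: eq_bigr => i _ /=; rewrite wedge1_sum mulr_sumr.
by apply: eq_bigr => j _; ring.
Qed.

(** Laplace expansion along the first column is the sum [wedge1_sum]. *)
Lemma det_wedge n (es : seq E) (s : seq F) : size es = n -> size s = n ->
  \det (\matrix_(i < n, j < n) pair s`_i es`_j) = wedge es s.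
Proof.
elim: n es s => [|n IH] [|e es] // s; first by case: s => // _ _; rewrite det_mx00.
move=> [se] ss; rewrite /= wedge1_sum (expand_det_col _ ord0) ss.
apply: eq_bigr => i _; rewrite mxE /= /cofactor addn0 -(IH es) //; last first.
  by rewrite size_rem_at ss.
rewrite mulrCA mulrA; congr (_ * \det _).
by apply/matrixP => j k; rewrite !mxE nth_rem_at ?ss ?(ltnW (ltn_ord i)) //= lift0.
Qed.

Lemma ev_wedge P s : ev pair P s = \sum_(t <- P) t.1 * wedge t.2 s.
Proof.
rewrite /ev; apply: eq_bigr => t _; congr (_ * _).
by case: eqP => [/det_wedge->//|/eqP/wedge_size->].
Qed.

Definition wedge_onto (es : seq E) (Q : seq F -> K) : seq F -> K :=
  foldr (fun e => wedge1 (pair^~ e)) Q es.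

(** Two consecutive factors form an even element, so they move to the front
    without a sign. *)
Lemma wedge_bring2 es x y es' :
  wedge (es ++ x :: y :: es') = wedge (x :: y :: es ++ es').
Proof.
elim: es => [//|e es IH]; rewrite /= IH /=; apply/funext => s.
rewrite wedge1_anticomm (wedge1_eqr _ _ (fun t => wedge1_anticomm _ _ _ t)).
have wedge1N w P u : wedge1 w (fun t => - P t) u = - wedge1 w P u.
  by have := wedge1_linr w 0 P P u; rewrite mul0r sub0r => <-; congr wedge1;
     apply/funext => t; ring.
by rewrite wedge1N opprK.
Qed.

Lemma wedge2f_ev (D : multi E) Q s : homog 2 D ->
  wedge2f (fun a b => ev pair D [:: a; b]) Q s =
  \sum_(d <- D) d.1 * wedge_onto d.2 Q s.
Proof.
elim: D => [|[c es] D IH] /=.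
  move=> _; rewrite big_nil -[RHS](wedge2f_0l Q s); congr wedge2f.
  by apply/funext => a; apply/funext => b; rewrite ev_wedge big_nil.
case: es => [|x [|y []]] //= hD; rewrite big_cons -IH //= -wedge2f_decomp -wedge2f_linl.
congr wedge2f; apply/funext => a; apply/funext => b.
by rewrite !ev_wedge big_cons /= /contract /= /unit_form /=; ring.
Qed.

(** The image of e_1 /\ ... /\ e_p under the graded derivation of degree one
    whose value on each e is the 2-form D e. The Koszul differential, the
    bracket with a bivector and the extended cobracket all take this form. *)
Fixpoint dwedge (D : E -> F -> F -> K) (es : seq E) : seq F -> K :=
  if es is e :: es' then
    fun s => wedge2f (D e) (wedge es') s - wedge1 (pair^~ e) (dwedge D es') s
  else fun=> 0.

Lemma dwedge_sum D es s :
  dwedge D es s = \sum_(j <- iota 0 (size es))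
    (-1) ^+ j * wedge2f (D es`_j) (wedge (rem_at j es)) s.
Proof.
elim: es s => [|e es IH] s /=; first by rewrite big_nil.
rewrite big_cons /= {1}/rem_at /= drop0 mul1r; congr (_ + _).
rewrite (funext IH) wedge1_sumr -sumrN -[1%N]addn0 iotaDl big_map.
apply: eq_bigr => j _; rewrite /= -wedge2f_wedge1 /rem_at /= exprS.
by ring.
Qed.

Lemma ev_dext (D : E -> multi E) P s : (forall e, homog 2 (D e)) ->
  ev pair (dext D P) s =
  \sum_(t <- P) t.1 * dwedge (fun e a b => ev pair (D e) [:: a; b]) t.2 s.
Proof.
move=> hD; rewrite ev_wedge /dext big_flatten /= big_allpairs_dep.
apply: eq_bigr => t _; rewrite dwedge_sum mulr_sumr; apply: eq_bigr => i _.
rewrite big_map wedge2f_ev // !mulr_sumr big_seq [RHS]big_seq; apply: eq_bigr => d.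
move=> /(allP (hD _)); case: d => c [|x [|y []]] //= _.
by rewrite wedge_bring2 /= /rem_at; ring.
Qed.

End Wedge.

(** * The Schouten bracket through evaluations *)

Lemma lieder_unit (K : comPzRingType) (F : Type) (X : K -> K) (D : F -> F) s :
  (forall x y, X (x + y) = X x + X y) ->
  (forall x y, X (x * y) = X x * y + x * X y) ->
  lieder X D unit_form s = 0.
Proof.
move=> XD XM; rewrite /lieder (_ : X _ = 0); last first.
  by case: s => [|? ?]; rewrite ?(der1 XM) // (der0 XD).
rewrite (_ : subst_sum _ _ _ = 0) ?subr0 //; case: s => //= b s; rewrite add0r.
by rewrite /contract /=; elim: s => //= ? ? ->; rewrite addr0.
Qed.

Section SchoutenForms.
Context {K : comPzRingType} {E F : lmodType K} (pair : F -> E -> K).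
Variables (act : E -> K -> K) (br : E -> E -> E).
Hypothesis (actD : forall e x y, act e (x + y) = act e x + act e y).
Hypothesis (actM : forall e x y, act e (x * y) = act e x * y + x * act e y).
Local Notation wedge := (wedge pair).
Local Notation ev := (ev pair).

Let act1 e : act e 1 = 0. Proof. exact: der1. Qed.

(** LD e is the Lie derivative along e on sections of the dual module. *)
Definition dual_lie (LD : E -> F -> F) := forall e a e',
  pair (LD e a) e' = act e (pair a e') - pair a (br e e').

Lemma rem_at0 (T : Type) (x : T) s : rem_at 0 (x :: s) = s.
Proof. by rewrite /rem_at /= drop0. Qed.

Lemma ev_cat P Q s : ev (P ++ Q) s = ev P s + ev Q s.
Proof. by rewrite /Defs.ev big_cat. Qed.

Lemma ev_mscale c P s : ev (mscale c P) s = c * ev P s.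
Proof.
by rewrite /Defs.ev big_map mulr_sumr; apply: eq_bigr => t _; rewrite mulrA.
Qed.

Lemma ev_cons t P s : ev (t :: P) s = t.1 * wedge t.2 s + ev P s.
Proof. by rewrite !ev_wedge big_cons. Qed.

Lemma ev_schouten P Q s : ev (schouten act br P Q) s =
  \sum_(t <- P) \sum_(u <- Q) ev (schouten1 act br t u) s.
Proof.
rewrite ev_wedge /schouten big_flatten /= big_allpairs_dep.
by apply: eq_bigr => t _; apply: eq_bigr => u _; rewrite ev_wedge.
Qed.

Section LieOnForms.
Variable (LD : E -> F -> F).
Hypothesis LDP : dual_lie LD.

Lemma lieder_wedge e es s : lieder (act e) (LD e) (wedge es) s =
  \sum_(j <- iota 0 (size es)) (-1) ^+ j * wedge (br e es`_j :: rem_at j es) s.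
Proof.
elim: es s => [|x es IH] s; first by rewrite big_nil lieder_unit.
rewrite [wedge (x :: es)]/= lieder_wedge1 //= (funext IH) wedge1_sumr big_cons.
rewrite rem_at0 mul1r; congr (_ + _).
  by apply: wedge1_eql => a; rewrite LDP; ring.
rewrite -[1%N]addn0 iotaDl big_map.
apply: eq_bigr => j _; rewrite /= wedge1_anticomm /rem_at /= exprS.
by ring.
Qed.

Lemma lieder_ev e P s : lieder (act e) (LD e) (ev P) s =
  \sum_(t <- P) (act e t.1 * wedge t.2 s + t.1 * lieder (act e) (LD e) (wedge t.2) s).
Proof.
elim: P => [|t P IH].
  rewrite big_nil (_ : ev [::] = fun s => 0 * unit_form s - 0); last first.
    by apply/funext => u; rewrite ev_wedge big_nil; ring.
  rewrite (lieder_lin _ (actD e) (actM e)) (der0 (actD e)).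
  rewrite [lieder _ _ (fun=> 0) s](_ : _ = 0); first by ring.
  rewrite /lieder (der0 (actD e)) sub0r.
  by elim: s => [|b s]; rewrite /= ?oppr0 // opprD => ->; rewrite oppr0 addr0.
rewrite big_cons -IH.
have N Q : lieder (act e) (LD e) (fun s => - Q s) s = - lieder (act e) (LD e) Q s.
  have := lieder_lin (LD e) (actD e) (actM e) 0 Q Q s.
  rewrite (der0 (actD e)) !mul0r !add0r => <-.
  by congr lieder; apply/funext => u /=; ring.
rewrite (_ : ev (t :: P) = fun s => t.1 * wedge t.2 s - (- ev P s)); last first.
  by apply/funext => u; rewrite ev_cons opprK.
by rewrite lieder_lin // N; ring.
Qed.

(** The bracket with a section e is the Lie derivative along e: both are
    derivations of the wedge product with value [e, x] on a section x. *)
Lemma ev_schouten1l e P s :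
  ev (schouten act br (multi1 e) P) s = lieder (act e) (LD e) (ev P) s.
Proof.
rewrite ev_schouten big_seq1 lieder_ev; apply: eq_bigr => -[f es] _ /=.
rewrite /schouten1 /= cats0 ev_cat ev_cons ev_wedge big_map lieder_wedge mulr_sumr.
rewrite addrC -addrA [ev _ _](_ : _ = 0) ?add0r; last first.
  by rewrite ev_wedge big_map big1 // => j _ /=; rewrite act1; ring.
rewrite /= subnn expr0 !mul1r; congr (_ + _).
by apply: eq_bigr => j _; rewrite add0n; ring.
Qed.

Hypothesis (brN : forall x y, br x y = - br y x).
Hypothesis (pairN : forall a x, pair a (- x) = - pair a x).

Lemma wedgeNl x es s : wedge (- x :: es) s = - wedge (x :: es) s.
Proof.
rewrite /= !wedge1_sum -sumrN; apply: eq_bigr => i _.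
by rewrite pairN; ring.
Qed.

Lemma ev_schouten1r e P s :
  ev (schouten act br P (multi1 e)) s = - lieder (act e) (LD e) (ev P) s.
Proof.
rewrite ev_schouten exchange_big big_seq1 lieder_ev -sumrN.
apply: eq_bigr => -[f es] _ /=.
rewrite /schouten1 !ev_cat ev_wedge big_allpairs_dep /=.
rewrite ev_wedge big_map /= [X in _ + (X + _)]big1 => [|j _]; last first.
  by rewrite act1; ring.
rewrite ev_wedge big_seq1 /= add0r cats0 lieder_wedge mulr_sumr opprD addrC.
congr (_ + _); first by ring.
rewrite -sumrN; apply: eq_bigr => j _.
rewrite big_seq1 -[wedge1 _ _ _]/(wedge (br es`_j e :: rem_at j es ++ rem_at 0 [:: e]) s).
rewrite brN wedgeNl addn0.
by rewrite rem_at0 cats0; ring.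
Qed.
End LieOnForms.

Definition wedge_val x y a b := pair a x * pair b y - pair a y * pair b x.

(** The value at a of [Pi, f], that is Pi(a, df). *)
Definition hamiltonian (Pi : wedge2 E) (f : K) (a : F) : K :=
  \sum_(p <- Pi) (pair a p.1 * act p.2 f - pair a p.2 * act p.1 f).

(** The 2-form [Pi, e]. *)
Definition bracket_biv (Pi : wedge2 E) (e : E) (a b : F) : K :=
  \sum_(p <- Pi) (wedge_val (br p.1 e) p.2 a b + wedge_val p.1 (br p.2 e) a b).

Lemma wedge1_suml (I : Type) (r : seq I) (w : I -> F -> K) P s :
  wedge1 (fun a => \sum_(i <- r) w i a) P s = \sum_(i <- r) wedge1 (w i) P s.
Proof.
rewrite wedge1_sum; under eq_bigr do rewrite mulr_sumr mulr_suml.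
by rewrite exchange_big; apply: eq_bigr => i _; rewrite wedge1_sum.
Qed.

Lemma wedge2f_suml (I : Type) (r : seq I) (h : I -> F -> F -> K) P s :
  wedge2f (fun a b => \sum_(i <- r) h i a b) P s = \sum_(i <- r) wedge2f (h i) P s.
Proof.
elim: s P => [|a s IH] P /=; first by rewrite big1.
by rewrite IH wedge1_suml big_split.
Qed.

Lemma dwedge_suml (I : Type) (r : seq I) (D : I -> E -> F -> F -> K) es s :
  dwedge pair (fun e a b => \sum_(i <- r) D i e a b) es s =
  \sum_(i <- r) dwedge pair (D i) es s.
Proof.
rewrite dwedge_sum; under eq_bigr do rewrite wedge2f_suml mulr_sumr.
by rewrite exchange_big; apply: eq_bigr => i _; rewrite dwedge_sum.
Qed.

Lemma ev_schouten_pair u v f es s :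
  ev (schouten1 act br (1, [:: u; v]) (f, es)) s =
  wedge1 (fun a => pair a u * act v f - pair a v * act u f) (wedge es) s +
  f * dwedge pair (fun e a b => wedge_val (br u e) v a b + wedge_val u (br v e) a b) es s.
Proof.
rewrite /schouten1 !ev_cat dwedge_sum.
rewrite [X in _ + (_ + X)](_ : _ = 0) ?addr0; last first.
  by rewrite ev_wedge big_map big1 // => j _ /=; rewrite act1; ring.
rewrite addrC; congr (_ + _).
  rewrite ev_wedge /= !big_cons big_nil /rem_at /= subnn subn0.
  have -> : (fun a => pair a u * act v f - pair a v * act u f) =
      (fun a => act v f * pair a u + (- act u f * pair a v + 0)).
    by apply/funext => a; ring.
  by rewrite !wedge1_linl wedge1_0l; ring.
rewrite !ev_wedge big_nil addr0 !big_map -big_split /= mulr_sumr.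
apply: eq_bigr => j _.
rewrite /rem_at /= -/(rem_at j es).
have -> : (fun a b => wedge_val (br u es`_j) v a b + wedge_val u (br v es`_j) a b) =
    (fun a b => 1 * wedge_val (br u es`_j) v a b + wedge_val u (br v es`_j) a b).
  by apply/funext => a; apply/funext => b; ring.
rewrite wedge2f_linl !wedge2f_decomp [wedge1 (pair^~ u) _ _]wedge1_anticomm.
by rewrite add0n add1n exprS; ring.
Qed.

(** The bracket with a bivector is a graded derivation, determined by its values
    on functions and on sections. *)
Lemma ev_schouten_biv (Pi : wedge2 E) P s :
  ev (schouten act br (multi2 Pi) P) s =
  \sum_(t <- P) (wedge1 (hamiltonian Pi t.1) (wedge t.2) s +
                  t.1 * dwedge pair (bracket_biv Pi) t.2 s).
Proof.
rewrite ev_schouten exchange_big; apply: eq_bigr => -[f es] _ /=.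
rewrite /multi2 big_map /hamiltonian /bracket_biv wedge1_suml dwedge_suml mulr_sumr -big_split.
by apply: eq_bigr => p _; rewrite ev_schouten_pair.
Qed.

End SchoutenForms.

Section KoszulEv.
Context {K : comPzRingType} {E F : lmodType K} (pair : F -> E -> K).
Variables (act : F -> K -> K) (br : F -> F -> F).
Hypothesis (actD : forall e x y, act e (x + y) = act e x + act e y).
Hypothesis (actM : forall e x y, act e (x * y) = act e x * y + x * act e y).

Lemma alternating_ev P : alternating (ev pair P).
Proof.
elim: P => [|t P IH].
  by move=> s a b u; rewrite !ev_wedge !big_nil oppr0.
rewrite (_ : ev pair _ = fun s => t.1 * wedge pair t.2 s + ev pair P s).
  by apply: alternating_lin => //; exact: alternating_wedge.
by apply/funext => s; rewrite ev_cons.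
Qed.

Let act0 a : act a 0 = 0. Proof. exact: (der0 (actD a)). Qed.

Lemma cartan_d_0 s : cartan_d act br (fun=> 0) s = 0.
Proof.
elim: s => //= a s IH; rewrite [cartan_d _ _ _ _]IH /lieder act0.
rewrite [subst_sum _ _ _](_ : _ = 0) ?subrr //.
by elim: s {IH} => //= ? ? ->; rewrite addr0.
Qed.

Lemma cartan_d_linZD c P Q s :
  cartan_d act br (fun t => c * P t + Q t) s =
  wedge1 (act^~ c) P s + c * cartan_d act br P s + cartan_d act br Q s.
Proof.
have act_const0 (P' : seq F -> K) u : wedge1 (act^~ 0) P' u = 0.
  by apply: etrans (wedge1_0l P' u); apply: wedge1_eql => x.
have cartan_dN (P' : seq F -> K) u : cartan_d act br (fun t => - P' t) u = - cartan_d act br P' u.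
  rewrite (_ : (fun t => - P' t) = fun t => 0 * P' t - P' t).
    by rewrite cartan_d_lin // act_const0; ring.
  by apply/funext => t; ring.
rewrite (_ : (fun t => _) = fun t => c * P t - - Q t).
  by rewrite cartan_d_lin // cartan_dN opprK.
by apply/funext => t; ring.
Qed.

Lemma cartan_d_unit s : cartan_d act br unit_form s = 0.
Proof.
by case: s => //= a s; rewrite lieder_unit // [cartan_d _ _ _ _]cartan_d_0 subrr.
Qed.

Lemma cartan_d_wedge es s :
  cartan_d act br (wedge pair es) s = dwedge pair (fun e => koszul1 act br (pair^~ e)) es s.
Proof.
elim: es s => [|e es IH] s; first exact: cartan_d_unit.
by rewrite /= cartan_d_wedge1 // (funext IH).
Qed.

(** The Koszul differential is the graded derivation determined by the anchor in
    degree 0 and by the bracket in degree 1. *)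
Lemma koszul_ev P s :
  koszul act br (ev pair P) s =
  \sum_(t <- P) (wedge1 (act^~ t.1) (wedge pair t.2) s +
    t.1 * dwedge pair (fun e => koszul1 act br (pair^~ e)) t.2 s).
Proof.
rewrite koszul_cartan_d; last exact: alternating_ev.
elim: P => [|t P IH].
  rewrite big_nil -[RHS](cartan_d_0 s); congr cartan_d; apply/funext => u.
  by rewrite ev_wedge big_nil.
rewrite big_cons -IH -cartan_d_wedge -cartan_d_linZD; congr cartan_d; apply/funext => u.
by rewrite ev_cons.
Qed.
End KoszulEv.

Section Derivation2.
Context {K : comPzRingType} {E F : lmodType K} (pair : F -> E -> K).
Implicit Types (P : seq F -> K) (h : F -> F -> K).

Definition wedge3f h (y : E) (a b c : F) : K :=
  h a b * pair c y + h b c * pair a y + h c a * pair b y.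

(** The value on a bivector of the graded derivation of degree one that sends x
    to the 2-form T x. *)
Definition extend_der (T : E -> F -> F -> K) (Om : wedge2 E) (a b c : F) : K :=
  \sum_(p <- Om) (wedge3f (T p.1) p.2 a b c - wedge3f (T p.2) p.1 a b c).

Lemma dwedge1 D e a b : dwedge pair D [:: e] [:: a; b] = D e a b.
Proof. by rewrite /= /contract /unit_form /=; ring. Qed.

Lemma dwedge2 D x y a b c : (forall e a b, D e a b = - D e b a) ->
  dwedge pair D [:: x; y] [:: a; b; c] =
  wedge3f (D x) y a b c - wedge3f (D y) x a b c.
Proof.
move=> DN; rewrite /= /contract /unit_form /wedge3f /= (DN x c a) (DN y c a).
by rewrite /contract; ring.
Qed.

Lemma wedge1_vanish w P (s : seq F) :
  (forall u, (size u).+1 = size s -> P u = 0) -> wedge1 w P s = 0.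
Proof.
move=> P0; rewrite wedge1_sum big1 // => i _; rewrite P0 ?mulr0 // size_rem_at //.
by rewrite prednK // (leq_ltn_trans _ (ltn_ord i)).
Qed.

Lemma wedge2f_vanish h P (s : seq F) :
  (forall u, (size u).+2 = size s -> P u = 0) -> wedge2f h P s = 0.
Proof.
elim: s P => //= a s IH P P0; rewrite wedge1_vanish ?IH ?addr0 //.
  by move=> u su; apply: P0; rewrite /= su.
by move=> u su; apply: P0; rewrite su.
Qed.

Lemma subst_sum_vanish (D : F -> F) P (s : seq F) :
  (forall u, size u = size s -> P u = 0) -> subst_sum D P s = 0.
Proof.
elim: s P => //= a s IH P P0; rewrite P0 // IH ?addr0 // => u su.
by apply: P0; rewrite /= su.
Qed.

Lemma dwedge_size D es s : size s != (size es).+1 -> dwedge pair D es s = 0.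
Proof.
move=> ss; rewrite dwedge_sum big_seq big1 // => j; rewrite mem_iota add0n => /andP[_ lt_j].
rewrite wedge2f_vanish ?mulr0 // => u su; apply: wedge_size; apply: contra ss.
by rewrite size_rem_at // -su => /eqP <-; rewrite prednK // (leq_ltn_trans _ lt_j).
Qed.

Lemma ev_multi2 (c : wedge2 E) a b : ev pair (multi2 c) [:: a; b] = ev2 pair c a b.
Proof.
rewrite ev_wedge big_map; apply: eq_bigr => p _.
by rewrite /= /contract /unit_form /=; ring.
Qed.

Lemma ev_homog n (Q : multi E) s : homog n Q -> size s != n -> ev pair Q s = 0.
Proof.
move=> /allP hP ss; rewrite ev_wedge big_seq big1 // => t /hP/eqP st.
by rewrite wedge_size ?mulr0 // st eq_sym.
Qed.

End Derivation2.

Section SmoothFacts.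
Context {R : realType} {m : nat} {M : manifold R m}.
Local Notation C := (smooth M).

Lemma smooth_double_eq0 (f : C) : f + f = 0 -> f = 0.
Proof.
move=> /(congr1 (fun h : C => (h : M -> R))) f2; apply: smooth_eq => x.
have /= := congr1 (@^~ x) f2 => /eqP.
by rewrite -mulr2n mulrn_eq0 /= => /eqP.
Qed.

(** Used for identities between double sums that hold only after exchanging the
    two indices. *)
Lemma sum_antisym (I : Type) (r : seq I) (G : I -> I -> C) :
  (forall p q, G p q + G q p = 0) -> \sum_(p <- r) \sum_(q <- r) G p q = 0.
Proof.
move=> GN; apply: smooth_double_eq0; rewrite {2}exchange_big -big_split /=.
by apply: big1 => p _; rewrite -big_split; apply: big1 => q _; exact: GN.
Qed.

Lemma vf0 (X : vfield M) : X 0 = 0. Proof. exact: der0 (vfD X). Qed.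
Lemma vfB (X : vfield M) f h : X (f - h) = X f - X h.
Proof. by rewrite vfD vfN. Qed.
Lemma vf_sum (I : Type) (r : seq I) (X : vfield M) (f : I -> C) :
  X (\sum_(i <- r) f i) = \sum_(i <- r) X (f i).
Proof.
by elim: r => [|i r IH]; rewrite ?big_nil ?vf0 // !big_cons vfD IH.
Qed.
End SmoothFacts.

(** * Brackets twisted by a bivector and a cobracket *)

Section TwistedBracket.
Context {R : realType} {m : nat} {M : manifold R m}.
Local Notation C := (smooth M).
Context {E F : lmodType C} (A : algebroid E) (pair : F -> E -> C).
Hypothesis A_lie : is_lie_algebroid A.
Hypothesis pairEP : forall a f x y, pair a (f *: x + y) = f * pair a x + pair a y.
Hypothesis pairFP : forall x f a b, pair (f *: a + b) x = f * pair a x + pair b x.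
Hypothesis pair_sep : forall a b, (forall x, pair a x = pair b x) -> a = b.
Local Notation act := (anchor A).
Local Notation br := (brk A).
Variables (LD : E -> F -> F) (dF : C -> F).
Hypothesis LDP : dual_lie pair (fun e f => act e f) br LD.
Hypothesis dFP : forall f x, pair (dF f) x = act x f.
Implicit Types (Om Pi : wedge2 E) (h : F -> F -> C).
Local Notation w2 := (wedge_val pair).
Local Notation w3 := (wedge3f pair).
Local Notation extend := (extend_der pair).

Lemma pairED a x y : pair a (x + y) = pair a x + pair a y.
Proof. by rewrite -[x in LHS]scale1r pairEP mul1r. Qed.
Lemma pairE0 a : pair a 0 = 0.
Proof. by apply: (addrI (pair a 0)); rewrite -pairED !addr0. Qed.
Lemma pairEZ a f x : pair a (f *: x) = f * pair a x.
Proof. by rewrite -[_ *: _]addr0 pairEP pairE0 addr0. Qed.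
Lemma pairEN a x : pair a (- x) = - pair a x.
Proof. by rewrite -scaleN1r pairEZ mulN1r. Qed.
Lemma pairFD x a b : pair (a + b) x = pair a x + pair b x.
Proof. by rewrite -[a in LHS]scale1r pairFP mul1r. Qed.
Lemma pairF0 x : pair 0 x = 0.
Proof. by apply: (addrI (pair 0 x)); rewrite -pairFD !addr0. Qed.
Lemma pairFZ x f a : pair (f *: a) x = f * pair a x.
Proof. by rewrite -[_ *: _]addr0 pairFP pairF0 addr0. Qed.
Lemma pairFN x a : pair (- a) x = - pair a x.
Proof. by rewrite -scaleN1r pairFZ mulN1r. Qed.

Lemma brN x y : br x y = - br y x. Proof. by case: A_lie => _ []. Qed.
Lemma act_br x y f : act (br x y) f = act x (act y f) - act y (act x f).
Proof. by case: A_lie => _ _ -> _. Qed.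
Lemma brNr x y : br x (- y) = - br x y.
Proof.
case: A_lie => _ _ _ /(_ x (-1) y); rewrite !scaleN1r => ->.
by rewrite vfN (der1 (vf_leibniz _)) oppr0 scale0r addr0.
Qed.
Lemma br_jacobi x y z : br x (br y z) = br (br x y) z + br y (br x z).
Proof.
case: A_lie => _ [_ _ /(_ x y z) J] _ _.
rewrite (brN (br x y)) (brN x z) brNr -opprD addrC; apply/eqP.
by rewrite -addr_eq0 addrA J.
Qed.

Definition lie2 (e : E) h (a b : F) : C :=
  act e (h a b) - h (LD e a) b - h a (LD e b).

Definition lie3 (e : E) (t : F -> F -> F -> C) (a b c : F) : C :=
  act e (t a b c) - t (LD e a) b c - t a (LD e b) c - t a b (LD e c).

(** A bivector representing the Lie derivative of Om along e. *)
Definition lie_list (e : E) Om : wedge2 E :=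
  [seq (br e p.1, p.2) | p <- Om] ++ [seq (p.1, br e p.2) | p <- Om].

(** The Schouten bracket of two bivectors, as the derivation [Om', .] applied to
    Om; it involves Om' only through its evaluation. *)
Definition biv_bracket Om Om' : F -> F -> F -> C :=
  extend (fun u a b => - lie2 u (ev2 pair Om') a b) Om.

Lemma lie2_wedge_val e x y a b :
  lie2 e (w2 x y) a b = w2 (br e x) y a b + w2 x (br e y) a b.
Proof. by rewrite /lie2 /wedge_val !LDP vfB !vf_leibniz; ring. Qed.

Lemma lie2_ev2 e Om : lie2 e (ev2 pair Om) = ev2 pair (lie_list e Om).
Proof.
apply/funext => a; apply/funext => b; rewrite /lie2 /ev2 big_cat !big_map /=.
rewrite vf_sum -!sumrB -big_split; apply: eq_bigr => p _ /=.
exact: (lie2_wedge_val e p.1 p.2).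
Qed.

Lemma lie2_ev2_sum e Om a b : lie2 e (ev2 pair Om) a b =
  \sum_(p <- Om) (w2 (br e p.1) p.2 a b + w2 p.1 (br e p.2) a b).
Proof. by rewrite lie2_ev2 /ev2 big_cat !big_map /= -big_split. Qed.

Lemma lie2_comm e u Om a b :
  lie2 e (lie2 u (ev2 pair Om)) a b =
  lie2 (br e u) (ev2 pair Om) a b + lie2 u (lie2 e (ev2 pair Om)) a b.
Proof.
rewrite !lie2_ev2 /ev2 !big_cat !big_map /= !big_cat !big_map /=.
rewrite -!big_split; apply: eq_bigr => p _ /=.
by rewrite !(br_jacobi e u) !pairED; ring.
Qed.

Lemma lie3_wedge3f e h y a b c :
  lie3 e (w3 h y) a b c = w3 (lie2 e h) y a b c + w3 h (br e y) a b c.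
Proof. by rewrite /lie3 /wedge3f /lie2 !LDP !vfD !vf_leibniz; ring. Qed.

(** L_e commutes with the derivation extending T up to the derivation extending
    T' = [L_e, T]. *)
Lemma lie3_extend_der e T T' Om :
  (forall u a b, lie2 e (T u) a b = T (br e u) a b + T' u a b) ->
  forall a b c, lie3 e (extend T Om) a b c = extend T (lie_list e Om) a b c + extend T' Om a b c.
Proof.
move=> TT' a b c; rewrite /extend_der big_cat !big_map /= -!big_split /=.
rewrite /lie3 vf_sum -!sumrB; apply: eq_bigr => p _.
have := lie3_wedge3f e (T p.1) p.2 a b c; have := lie3_wedge3f e (T p.2) p.1 a b c.
rewrite /lie3 vfB => e1 e2.
have -> : forall x1 x2 x3 x4 y1 y2 y3 y4 : C,
  x1 - y1 - (x2 - y2) - (x3 - y3) - (x4 - y4) =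
  (x1 - x2 - x3 - x4) - (y1 - y2 - y3 - y4) by move=> *; ring.
by rewrite e1 e2 /wedge3f !TT'; ring.
Qed.

(** Seen from Om' or from Om, the bracket has the same terms for each pair of
    decomposable summands. This symmetry is what makes L_e [Pi, Pi] equal to
    2 [Pi, L_e Pi]. *)
Lemma biv_bracketC Om Om' a b c : biv_bracket Om Om' a b c = biv_bracket Om' Om a b c.
Proof.
have expand O O' : biv_bracket O O' a b c = \sum_(p <- O) \sum_(q <- O')
   (w3 (fun a b => - (w2 (br p.1 q.1) q.2 a b + w2 q.1 (br p.1 q.2) a b)) p.2 a b c
  - w3 (fun a b => - (w2 (br p.2 q.1) q.2 a b + w2 q.1 (br p.2 q.2) a b)) p.1 a b c).
  apply: eq_bigr => p _; rewrite /wedge3f !lie2_ev2 /ev2 !big_cat !big_map /=.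
  rewrite -!big_split /= -!sumrN !mulr_suml -!big_split /= -sumrN -big_split.
  by apply: eq_bigr => q _; rewrite /wedge_val /=; ring.
rewrite !expand exchange_big; apply: eq_bigr => q _; apply: eq_bigr => p _.
rewrite (brN p.1 q.1) (brN p.1 q.2) (brN p.2 q.1) (brN p.2 q.2).
by rewrite /wedge3f /wedge_val !pairEN; ring.
Qed.

Lemma bracket_bivE Pi e a b : bracket_biv pair br Pi e a b = - lie2 e (ev2 pair Pi) a b.
Proof.
rewrite lie2_ev2 /ev2 big_cat !big_map /= -big_split -sumrN; apply: eq_bigr => p _.
by rewrite (brN _ e) (brN p.2 e) /wedge_val /= !pairEN; ring.
Qed.

Lemma lieder_lie2 e (P : seq F -> C) a b :
  lieder (act e) (LD e) P [:: a; b] = lie2 e (fun a b => P [:: a; b]) a b.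
Proof. by rewrite /lieder /= /contract /lie2; ring. Qed.

Lemma ev_schouten_bivectors Pi Om a b c :
  ev pair (schouten (fun e f => act e f) br (multi2 Pi) (multi2 Om)) [:: a; b; c] =
  biv_bracket Om Pi a b c.
Proof.
rewrite ev_schouten_biv; try by move=> *; rewrite ?vfD ?vf_leibniz.
rewrite big_map; apply: eq_bigr => p _.
rewrite dwedge2 => [|e x y]; last first.
  rewrite /bracket_biv -sumrN; apply: eq_bigr => q _; rewrite /wedge_val; ring.
have ham1 x : hamiltonian pair (fun e f => act e f) Pi 1 x = 0.
  by rewrite /hamiltonian big1 // => q _; rewrite !(der1 (vf_leibniz _)); ring.
by rewrite /= !ham1 /wedge3f !bracket_bivE; ring.
Qed.

Section MaurerCartan.
Variables (Pi : wedge2 E) (delta : E -> wedge2 E).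
Let Pi2 := ev2 pair Pi.
Let dl e := ev2 pair (delta e).
Hypothesis dl_exact : forall x a f, dl x a (dF f) = 0.
Hypothesis dl_cocycle : forall x y a b,
  dl (br x y) a b = lie2 x (dl y) a b - lie2 y (dl x) a b.
Hypothesis dl_square : forall x a b c, extend dl (delta x) a b c = 0.
Hypothesis maurer_cartan : forall a b c,
  biv_bracket Pi Pi a b c = extend dl Pi a b c + extend dl Pi a b c.

(** The 2-form d_* e = [Pi, e] - delta e. *)
Definition codiff (e : E) (a b : F) : C := - lie2 e Pi2 a b - dl e a b.

Lemma codiff_compat e1 e2 a b :
  codiff (br e1 e2) a b = lie2 e1 (codiff e2) a b - lie2 e2 (codiff e1) a b.
Proof.
have lieB e h1 h2 : lie2 e (fun a b => - h1 a b - h2 a b) a b =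
    - lie2 e h1 a b - lie2 e h2 a b.
  by rewrite /lie2 vfB vfN; ring.
rewrite /codiff !lieB dl_cocycle.
by rewrite [lie2 e1 (lie2 e2 _) _ _]lie2_comm; ring.
Qed.

(** d_*^2 e = 0. Applying L_e to [Pi, Pi] = 2 delta Pi gives
    2 [Pi, L_e Pi] = 2 (delta (L_e Pi) - [Pi, delta e]), hence
    d_* (- L_e Pi - delta e) = delta^2 e = 0. *)
Lemma codiff_square e a b c : extend codiff (lie_list e Pi ++ delta e) a b c = 0.
Proof.
have split_extend Om : extend codiff Om a b c = biv_bracket Om Pi a b c - extend dl Om a b c.
  rewrite /biv_bracket /extend_der -sumrB; apply: eq_bigr => p _.
  by rewrite /wedge3f /codiff; ring.
have mc_e : lie3 e (biv_bracket Pi Pi) a b c =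
     lie3 e (extend dl Pi) a b c + lie3 e (extend dl Pi) a b c.
  by rewrite /lie3 !maurer_cartan vfD; ring.
have bb : lie3 e (biv_bracket Pi Pi) a b c =
    biv_bracket (lie_list e Pi) Pi a b c + biv_bracket Pi (lie_list e Pi) a b c.
  apply: lie3_extend_der => u x y; rewrite -lie2_ev2.
  have lieN h : lie2 e (fun a b => - h a b) x y = - lie2 e h x y.
    by rewrite /lie2 vfN; ring.
  by rewrite lieN lie2_comm; ring.
have bd : lie3 e (extend dl Pi) a b c =
    extend dl (lie_list e Pi) a b c - biv_bracket Pi (delta e) a b c.
  rewrite (@lie3_extend_der e dl (fun u => lie2 u (dl e))) => [|u x y]; last first.
    by rewrite dl_cocycle; ring.
  congr (_ + _); rewrite /biv_bracket /extend_der -sumrN.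
  by apply: eq_bigr => p _; rewrite /wedge3f /dl; ring.
have extend_cat T O O' : extend T (O ++ O') a b c = extend T O a b c + extend T O' a b c.
  by rewrite /extend_der big_cat.
rewrite extend_cat !split_extend dl_square.
apply: smooth_double_eq0; move: mc_e; rewrite bb bd !(biv_bracketC Pi) => /eqP.
by rewrite -subr_eq0 => /eqP mc0; apply: etrans mc0; ring.
Qed.

Variable (B : algebroid F).
Hypothesis anchorB : forall a f, anchor B a f = hamiltonian pair (fun e f => act e f) Pi f a.
Hypothesis brkB : forall a b e, pair (brk B a b) e =
  anchor B a (pair b e) - anchor B b (pair a e) - codiff e a b.

Lemma codiffE e : codiff e = fun a b => - ev2 pair (lie_list e Pi ++ delta e) a b.
Proof.
apply/funext => a; apply/funext => b.
by rewrite /codiff lie2_ev2 /dl /ev2 [in RHS]big_cat /=; ring.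
Qed.

(** The difference of the two sides is, up to the factor -2, the equation
    [Pi, Pi] = 2 delta Pi evaluated on (a, b, df); the terms of delta that see df
    vanish. *)
Lemma anchor_morphism a b f : anchor B (brk B a b) f =
  anchor B a (anchor B b f) - anchor B b (anchor B a f).
Proof.
apply/eqP; rewrite -subr_eq0; apply/eqP.
have dl_exactl x a' f' : dl x (dF f') a' = 0.
  rewrite -[RHS]oppr0 -(dl_exact x a' f') /dl /ev2 -sumrN.
  by apply: eq_bigr => p _; ring.
have diff : anchor B (brk B a b) f -
    (anchor B a (anchor B b f) - anchor B b (anchor B a f)) =
  \sum_(p <- Pi) (codiff p.2 a b * act p.1 f - codiff p.1 a b * act p.2 f
    - pair b p.1 * anchor B a (act p.2 f) + pair b p.2 * anchor B a (act p.1 f)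
    + pair a p.1 * anchor B b (act p.2 f) - pair a p.2 * anchor B b (act p.1 f)).
  rewrite [anchor B b f]anchorB [anchor B a f]anchorB [anchor B (brk _ _ _) f]anchorB.
  rewrite /hamiltonian !vf_sum -!sumrB; apply: eq_bigr => p _.
  by rewrite !brkB !(vfB, vf_leibniz); ring.
have /eqP := maurer_cartan a b (dF f); rewrite -subr_eq0 => /eqP mc.
apply: smooth_double_eq0; rewrite -[LHS]addr0 -[X in _ + X = _]mc diff.
rewrite /biv_bracket /extend_der -!big_split -sumrB -big_split /=.
(* The contribution of a pair of decomposable summands; L stands for the Lie
   derivative of q along a section and r for the anchor defined by q. *)
pose G (p q : E * E) : C :=
  let L u a b := w2 (br u q.1) q.2 a b + w2 q.1 (br u q.2) a b in
  let r a f := pair a q.1 * act q.2 f - pair a q.2 * act q.1 f in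
  let c := dF f in
  L p.1 a b * act p.2 f - L p.2 a b * act p.1 f
  - L p.1 b c * pair a p.2 - L p.1 c a * pair b p.2
  + L p.2 b c * pair a p.1 + L p.2 c a * pair b p.1
  - (pair b p.1 * r a (act p.2 f) + pair b p.1 * r a (act p.2 f))
  + (pair b p.2 * r a (act p.1 f) + pair b p.2 * r a (act p.1 f))
  + (pair a p.1 * r b (act p.2 f) + pair a p.1 * r b (act p.2 f))
  - (pair a p.2 * r b (act p.1 f) + pair a p.2 * r b (act p.1 f)).
transitivity (\sum_(p <- Pi) \sum_(q <- Pi) G p q).
  apply: eq_bigr => p _.
  have lie_sum u x y : lie2 u Pi2 x y =
      \sum_(q <- Pi) (w2 (br u q.1) q.2 x y + w2 q.1 (br u q.2) x y).
    by rewrite lie2_ev2 /ev2 big_cat !big_map /= -big_split.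
  rewrite /G !(big_split, sumrN) /= -!mulr_sumr -!mulr_suml -!lie_sum.
  rewrite !anchorB /hamiltonian /wedge3f /codiff -/Pi2 !dl_exact !dl_exactl !dFP.
  by ring.
apply: sum_antisym => p q; rewrite /G /wedge_val /= !dFP !act_br.
rewrite (brN q.1 p.1) (brN q.1 p.2) (brN q.2 p.1) (brN q.2 p.2) !pairEN.
by ring.
Qed.

(** Expanding the three nested brackets by duality, all terms with anchors cancel
    by the morphism and Leibniz rules, and d_* (d_* e) remains. *)
Lemma jacobi_pair a b c e :
  pair (brk B a (brk B b c)) e + pair (brk B b (brk B c a)) e +
  pair (brk B c (brk B a b)) e = extend codiff (lie_list e Pi ++ delta e) a b c.
Proof.
rewrite !(brkB _ (brk B _ _)) !brkB !anchor_morphism.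
set Om := lie_list e Pi ++ delta e.
pose X a b c := anchor B a (ev2 pair Om b c) + ev2 pair Om a (brk B b c).
have X_sum : X a b c + X b c a + X c a b = extend codiff Om a b c.
  rewrite /X /ev2 !vf_sum -!big_split; apply: eq_bigr => p _ /=.
  by rewrite !brkB !(vfB, vf_leibniz) /wedge3f; ring.
by rewrite -X_sum /X !codiffE -/Om /= !(vfB, vfN); ring.
Qed.

Lemma twisted_bracket_lie : is_lie_algebroid B.
Proof.
have brk_eq a b c : (forall e, anchor B a (pair b e) - anchor B b (pair a e)
    - codiff e a b = pair c e) -> brk B a b = c.
  by move=> H; apply: pair_sep => e; rewrite brkB H.
have anc_lin f a b : anchor B (f *: a + b) = f *: anchor B a + anchor B b.
  apply: vf_eq => h /=; rewrite !anchorB /hamiltonian mulr_sumr -big_split.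
  by apply: eq_bigr => p _ /=; rewrite !pairFP; ring.
have codiffN e a b : codiff e a b = - codiff e b a.
  rewrite codiffE /=; congr (- _); rewrite /ev2 -sumrN.
  by apply: eq_bigr => p _; ring.
have codiff_linr e f a b c : codiff e a (f *: b + c) = f * codiff e a b + codiff e a c.
  rewrite codiffE /ev2 mulrN mulr_sumr -opprD -big_split /=.
  by congr (- _); apply: eq_bigr => p _ /=; rewrite !pairFP; ring.
have anc_lin0 f a k : anchor B (f *: a) k = f * anchor B a k.
  by rewrite !anchorB /hamiltonian mulr_sumr; apply: eq_bigr => p _ /=; rewrite !pairFZ; ring.
split=> //.
- split.
  + move=> c a b b'; apply: brk_eq => e; rewrite !pairFP !brkB codiff_linr.
    by rewrite anc_lin /= vf_lin; ring.
  + by move=> a b; apply: brk_eq => e; rewrite pairFN brkB codiffN; ring.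
  + by move=> a b c; apply: pair_sep => e; rewrite !pairFD jacobi_pair codiff_square pairF0.
- by move=> a b; apply: vf_eq => f; rewrite anchor_morphism.
- move=> a f b; apply: brk_eq => e; rewrite pairFP !pairFZ brkB.
  have -> : codiff e a (f *: b) = f * codiff e a b.
    have := codiff_linr e f a b 0; rewrite addr0 => ->.
    have := codiff_linr e (-1) a 0 0; rewrite scaler0 addr0 mulN1r addNr => ->.
    by rewrite addr0.
  by rewrite anc_lin0 vf_leibniz; ring.
Qed.

End MaurerCartan.

End TwistedBracket.

(** * Vector-valued functions and their derivatives *)

Section VectorValued.
Context {R : realType} {m : nat} {M : manifold R m}.
Local Notation C := (smooth M).
Local Notation X1 := (vfield M).
Implicit Types (V W U : vectType R) (X Y : X1).

Lemma smooth_sumE (I : Type) (r : seq I) (f : I -> C) x :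
  (\sum_(i <- r) f i) x = \sum_(i <- r) f i x.
Proof. by elim: r => [|i r IH]; rewrite ?big_nil // !big_cons /= IH. Qed.

Lemma vsmooth_sumE V (I : Type) (r : seq I) (f : I -> vsmooth M V) x :
  (\sum_(i <- r) f i) x = \sum_(i <- r) f i x.
Proof. by elim: r => [|i r IH]; rewrite ?big_nil // !big_cons /= IH. Qed.

Lemma smooth_oppE (f : C) x : (- f) x = - f x.
Proof. by rewrite /= mulN1r. Qed.

Lemma vsmooth_oppE V (f : vsmooth M V) x : (- f) x = - f x.
Proof. by rewrite /= mulr1 scaleN1r. Qed.

Lemma vf_scst X (c : R) : X (scst M c) = 0.
Proof.
have := vf_lin X c 1 0; rewrite vf0 (der1 (vf_leibniz X)) mulr0 !addr0.
by move=> <-; congr (vf_fun X _); apply: smooth_eq => x /=; rewrite mulr1.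
Qed.

Lemma vcoordD V (f h : vsmooth M V) k : vcoord (f + h) k = vcoord f k + vcoord h k.
Proof. by apply: smooth_eq => x /=; rewrite linearD. Qed.

Lemma vcoordZ V (a : C) (f : vsmooth M V) k : vcoord (a *: f) k = a * vcoord f k.
Proof. by apply: smooth_eq => x /=; rewrite linearZ. Qed.

Lemma vcoord_cst V (v : V) k :
  vcoord (vcst M v) k = scst M (coord (vbasis fullv) k v).
Proof. exact: smooth_eq. Qed.

Lemma vdecomp V (f : vsmooth M V) :
  f = \sum_(k < \dim {:V}) vcoord f k *: vcst M (vbasis fullv)`_k.
Proof.
apply: vsmooth_eq => x; rewrite vsmooth_sumE {1}(coord_vbasis (memvf (f x))).
by apply: eq_bigr.
Qed.

Lemma vcoord_inj V (f h : vsmooth M V) : (forall k, vcoord f k = vcoord h k) -> f = h.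
Proof.
by move=> fh; rewrite (vdecomp f) (vdecomp h); apply: eq_bigr => k _; rewrite fh.
Qed.

Lemma vcoord_sum V (c : 'I_(\dim {:V}) -> C) k :
  vcoord (\sum_(j < \dim {:V}) c j *: vcst M (vbasis fullv)`_j) k = c k.
Proof.
apply: smooth_eq => x; rewrite /= vsmooth_sumE /=.
exact/coord_sum_free/basis_free/vbasisP.
Qed.

Lemma vcoord_vder V X (f : vsmooth M V) k : vcoord (vder X f) k = X (vcoord f k).
Proof. exact: vcoord_sum. Qed.

Lemma vderD V X (f h : vsmooth M V) : vder X (f + h) = vder X f + vder X h.
Proof. by apply: vcoord_inj => k; rewrite !(vcoordD, vcoord_vder) vfD. Qed.

Lemma vderZ V X (a : C) (f : vsmooth M V) :
  vder X (a *: f) = X a *: f + a *: vder X f.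
Proof.
by apply: vcoord_inj => k; rewrite !(vcoordD, vcoordZ, vcoord_vder) vf_leibniz.
Qed.

Lemma vder_cst V X (v : V) : vder X (vcst M v) = 0.
Proof.
apply: vcoord_inj => k; rewrite vcoord_vder vcoord_cst vf_scst.
by apply: smooth_eq => x /=; rewrite linear0.
Qed.

Lemma vderDl V (f : vsmooth M V) a X Y : vder (a *: X + Y) f = a *: vder X f + vder Y f.
Proof. by apply: vcoord_inj => k; rewrite !(vcoordD, vcoordZ, vcoord_vder). Qed.

Lemma vder_bracket V X Y (f : vsmooth M V) :
  vder (vf_bracket X Y) f = vder X (vder Y f) - vder Y (vder X f).
Proof.
apply: vcoord_inj => k; rewrite -scaleN1r !(vcoordD, vcoordZ, vcoord_vder) /=.
by rewrite mulN1r.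
Qed.

Lemma vder0 V X : vder X (0 : vsmooth M V) = 0.
Proof. by apply: (addrI (vder X 0)); rewrite -vderD !addr0. Qed.

Lemma vder_sum V X (I : Type) (r : seq I) (f : I -> vsmooth M V) :
  vder X (\sum_(i <- r) f i) = \sum_(i <- r) vder X (f i).
Proof. by elim: r => [|i r IH]; rewrite ?big_nil ?vder0 // !big_cons vderD IH. Qed.

Section Bilinear.
Context {U V W : vectType R} (b : U -> V -> W) (hb : bilin b).

Lemma vbilDl a f f' h : vbil (M := M) hb (a *: f + f') h = a *: vbil hb f h + vbil hb f' h.
Proof. by apply: vsmooth_eq => x /=; rewrite hb.1. Qed.

Lemma vbil0l h : vbil (M := M) hb 0 h = 0.
Proof.
apply: (addrI (vbil hb 0 h)); rewrite addr0.
by have := vbilDl 1 0 0 h; rewrite !scale1r addr0.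
Qed.

Lemma vbilDr a f h h' : vbil (M := M) hb f (a *: h + h') = a *: vbil hb f h + vbil hb f h'.
Proof. by apply: vsmooth_eq => x /=; rewrite hb.2. Qed.

Lemma vbil_decomp f h : vbil (M := M) hb f h =
  \sum_(i < \dim {:U}) \sum_(j < \dim {:V}) (vcoord f i * vcoord h j) *:
    vcst M (b (vbasis fullv)`_i (vbasis fullv)`_j).
Proof.
apply: vsmooth_eq => x /=; rewrite (bilin_coord _ _ hb) vsmooth_sumE.
by apply: eq_bigr => i _; rewrite vsmooth_sumE.
Qed.

(** Leibniz rule, obtained from the coordinates in fixed bases because the value
    of a bilinear map on constants is constant. *)
Lemma vder_vbil X f h :
  vder X (vbil (M := M) hb f h) = vbil hb (vder X f) h + vbil hb f (vder X h).
Proof.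
rewrite !vbil_decomp vder_sum -big_split; apply: eq_bigr => i _.
rewrite vder_sum -big_split; apply: eq_bigr => j _ /=.
by rewrite vderZ vder_cst scaler0 addr0 vf_leibniz scalerDl !vcoord_vder.
Qed.
End Bilinear.

End VectorValued.

Section Pairing.
Context {R : realType} {m : nat} {M : manifold R m} {g : lieAlgebra R}.
Local Notation C := (smooth M).
Local Notation X1 := (vfield M).
Local Notation g' := (ldual g).
Local Notation Cg := (vsmooth M g).
Local Notation Cg' := (vsmooth M g').

Lemma vpairPl (f : C) (xi eta : Cg') (A : Cg) :
  vpair (f *: xi + eta) A = f * vpair xi A + vpair eta A.
Proof. by apply: smooth_eq => x /=; rewrite add_lfunE scale_lfunE. Qed.

Lemma vf_vpair (X : X1) (xi : Cg') (A : Cg) :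
  X (vpair xi A) = vpair (vder X xi) A + vpair xi (vder X A).
Proof.
have vpairE eta B : vpair eta B = \sum_(i < \dim {:g'}) \sum_(j < \dim {:g})
    (vcoord eta i * vcoord B j) * scst M ((vbasis {:g'})`_i (vbasis {:g})`_j).
  apply: smooth_eq => x; rewrite smooth_sumE /= (bilin_coord _ _ (eval_bilin g)).
  by apply: eq_bigr => i _; rewrite smooth_sumE.
rewrite !vpairE vf_sum -big_split; apply: eq_bigr => i _.
rewrite vf_sum -big_split; apply: eq_bigr => j _ /=.
by rewrite !vf_leibniz vf_scst !vcoord_vder; ring.
Qed.

Lemma vpair_sepl (xi eta : Cg') :
  (forall A : g, vpair xi (vcst M A) = vpair eta (vcst M A)) -> xi = eta.
Proof.
move=> e; apply: vsmooth_eq => x; apply/lfunP => A.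
exact: (congr1 (fun f : C => f x) (e A)).
Qed.

Lemma vpair_sepr (A B : Cg) :
  (forall xi : g', vpair (vcst M xi) A = vpair (vcst M xi) B) -> A = B.
Proof.
move=> e; apply: vcoord_inj => k; apply: smooth_eq => x.
have := congr1 (fun f : C => f x) (e (linfun (coord (vbasis {:g}) k : g -> R^o))).
by rewrite /= !lfunE.
Qed.

End Pairing.

(** * The transitive Lie algebroid and its dual *)

Section TangentAlgebroid.
Context {R : realType} {m : nat} (M : manifold R m).
Local Notation C := (smooth M).
Local Notation X1 := (vfield M).
Local Notation O1 := (form1 M).

Lemma vf_bracketN (X Y : X1) : vf_bracket X Y = - vf_bracket Y X.
Proof. by apply: vf_eq => f /=; ring. Qed.

Lemma vf_bracketl (f : C) (X Y Z : X1) :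
  vf_bracket (f *: X + Y) Z = f *: vf_bracket X Z + (vf_bracket Y Z - Z f *: X).
Proof.
rewrite vf_bracketN vf_bracketr (vf_bracketN X Z) (vf_bracketN Y Z) scalerN.
by rewrite !opprD.
Qed.

Lemma TM_lie : is_lie_algebroid (TM M).
Proof.
split=> //.
- split=> [c X Y Y'|X Y|X Y Z].
  + by rewrite /= vf_bracketr vf_scst scale0r addr0.
  + exact: vf_bracketN.
  + by apply: vf_eq => f /=; rewrite !vfB; ring.
- move=> X f Y; rewrite /= -[f *: Y]addr0 vf_bracketr.
  rewrite (_ : vf_bracket X 0 = 0) ?add0r //.
  by apply: vf_eq => h /=; rewrite vf0 subrr.
Qed.

Lemma fm_Lie_dual :
  dual_lie (@TMpair R m M) (fun X f => X f) (@vf_bracket R m M) (@fm_Lie R m M).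
Proof. by []. Qed.

Lemma TMpair_linr (a : O1) (f : C) (X Y : X1) :
  TMpair a (f *: X + Y) = f * TMpair a X + TMpair a Y.
Proof. exact: fm_lin. Qed.

Lemma fm0r (a : O1) : a 0 = 0.
Proof. by apply: (addrI (a 0)); rewrite -fmD !addr0. Qed.

End TangentAlgebroid.

Lemma lbrN (R : realType) (g : lieAlgebra R) (B D : g) : lbr B D = - lbr D B.
Proof.
have [[bl br] alt _] := lbrP g.
have lD (w w' z : g) : lbr (w + w') z = lbr w z + lbr w' z.
  by have := bl 1 w w' z; rewrite !scale1r.
have rD (w z z' : g) : lbr w (z + z') = lbr w z + lbr w z'.
  by have := br 1 w z z'; rewrite !scale1r.
have := alt (B + D); rewrite lD !rD !alt add0r addr0 => /eqP.
by rewrite addr_eq0 => /eqP.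
Qed.

Section TransitiveAlgebroid.
Context {R : realType} {m : nat} (M : manifold R m) (g : lieAlgebra R).
Local Notation g' := (ldual g).
Local Notation Cg := (vsmooth M g).
Local Notation Cg' := (vsmooth M g').
Local Notation A := (tralg M g).

Lemma vlieN (B D : Cg) : vlie B D = - vlie D B.
Proof. by apply: vsmooth_eq => x; rewrite vsmooth_oppE /= lbrN. Qed.

Lemma vlieDl a (B B' D : Cg) : vlie (a *: B + B') D = a *: vlie B D + vlie B' D.
Proof. exact: vbilDl. Qed.
Lemma vlieDr a (B D D' : Cg) : vlie B (a *: D + D') = a *: vlie B D + vlie B D'.
Proof. exact: vbilDr. Qed.

Lemma vlie_jacobi (B D D' : Cg) :
  vlie B (vlie D D') + vlie D (vlie D' B) + vlie D' (vlie B D) = 0.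
Proof.
by have [_ _ J] := lbrP g; apply: vsmooth_eq => x /=; rewrite J.
Qed.

Lemma vpairDr (xi : Cg') (B D : Cg) : vpair xi (B + D) = vpair xi B + vpair xi D.
Proof. by have := vpairP xi 1 B D; rewrite scale1r mul1r. Qed.
Lemma vpair0r (xi : Cg') : vpair xi (0 : Cg) = 0.
Proof. by apply: (addrI (vpair xi 0)); rewrite -vpairDr !addr0. Qed.
Lemma vpairZr (xi : Cg') f (B : Cg) : vpair xi (f *: B) = f * vpair xi B.
Proof. by rewrite -[_ *: _]addr0 vpairP vpair0r addr0. Qed.
Lemma vpairNr (xi : Cg') (B : Cg) : vpair xi (- B) = - vpair xi B.
Proof. by rewrite -scaleN1r vpairZr mulN1r. Qed.
Lemma vpairDl (xi eta : Cg') (B : Cg) : vpair (xi + eta) B = vpair xi B + vpair eta B.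
Proof. by have := vpairPl 1 xi eta B; rewrite scale1r mul1r. Qed.
Lemma vpair0l (B : Cg) : vpair (0 : Cg') B = 0.
Proof. by apply: (addrI (vpair 0 B)); rewrite -vpairDl !addr0. Qed.
Lemma vpairZl f (xi : Cg') (B : Cg) : vpair (f *: xi) B = f * vpair xi B.
Proof. by rewrite -[_ *: _]addr0 vpairPl vpair0l addr0. Qed.
Lemma vpairNl (xi : Cg') (B : Cg) : vpair (- xi) B = - vpair xi B.
Proof. by rewrite -scaleN1r vpairZl mulN1r. Qed.
Definition vpairE := (vpairDr, vpairNr, vpairZr, vpairDl, vpairNl, vpairZl, vpair0r, vpair0l).

Lemma vpair_sumr (xi : Cg') (I : Type) (r : seq I) (F : I -> Cg) :
  vpair xi (\sum_(i <- r) F i) = \sum_(i <- r) vpair xi (F i).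
Proof. by elim: r => [|i r IH]; rewrite ?big_nil ?vpair0r // !big_cons vpairDr IH. Qed.

Lemma vlieD_r (B D D' : Cg) : vlie B (D + D') = vlie B D + vlie B D'.
Proof. by have := vlieDr 1 B D D'; rewrite !scale1r. Qed.
Lemma vlie0r (B : Cg) : vlie B 0 = 0.
Proof. by apply: (addrI (vlie B 0)); rewrite -vlieD_r !addr0. Qed.
Lemma vlieN_r (B D : Cg) : vlie B (- D) = - vlie B D.
Proof. by apply/eqP; rewrite -addr_eq0 -vlieD_r addNr vlie0r. Qed.

Lemma vder0l {V : vectType R} (f : vsmooth M V) : vder 0 f = 0.
Proof.
apply: vcoord_inj => k; rewrite vcoord_vder /=.
by apply: smooth_eq => x /=; rewrite linear0.
Qed.

Lemma vderN {V : vectType R} X (f : vsmooth M V) : vder X (- f) = - vder X f.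
Proof. by apply/eqP; rewrite -addr_eq0 -vderD addNr vder0. Qed.

(** The g-components are compared by pairing with constant elements of the dual,
    which turns identities of vector-valued functions into ring identities. *)
Lemma tralg_lie : is_lie_algebroid A.
Proof.
have [_ [TM_linr TM_anti TM_jac] _ TM_leib] := TM_lie M.
split=> //.
- split=> [c [X B] [Y D] [Y' D']|[X B] [Y D]|[X B] [Y D] [Z E]]; congr pair => /=.
  + exact: (TM_linr c X Y Y').
  + apply: vpair_sepr => xi.
    by rewrite vderD vderZ vf_scst vlieDr vderDl !(scale0r, vpairE); ring.
  + exact: TM_anti.
  + by apply: vpair_sepr => xi; rewrite vlieN !vpairE; ring.
  + exact: (TM_jac X Y Z).
  + apply: vpair_sepr => xi.
    rewrite !vder_bracket !(vderD, vderN, vlieD_r, vlieN_r) !vder_vbil.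
    have := congr1 (vpair (vcst M xi)) (vlie_jacobi B D E).
    rewrite -![vbil _ _ _]/(vlie _ _).
    rewrite (vlieN (vder X D)) (vlieN (vder Y E)) (vlieN (vder Z B)).
    by rewrite !vpairE => J; apply: etrans J; ring.
- move=> [X B] f [Y D]; congr pair => /=; first exact: TM_leib.
  apply: vpair_sepr => xi.
  rewrite -[f *: D]addr0 vlieDr vlie0r addr0 vderZ -[f *: Y]addr0 vderDl.
  by rewrite vder0l !vpairE; ring.
Qed.

End TransitiveAlgebroid.

Section DualOfTransitive.
Context {R : realType} {m : nat} (M : manifold R m) (g : lieAlgebra R).
Local Notation C := (smooth M).
Local Notation X1 := (vfield M).
Local Notation g' := (ldual g).
Local Notation Cg := (vsmooth M g).
Local Notation Cg' := (vsmooth M g').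
Local Notation GA := (GA M g).
Local Notation GA' := (GA' M g).
Local Notation A := (tralg M g).
Local Notation Ap := (@Apair R m M g).

Lemma Apair_linr (a : GA') (f : C) (x y : GA) : Ap a (f *: x + y) = f * Ap a x + Ap a y.
Proof. by rewrite /Apair /= fm_lin vpairP; ring. Qed.

Lemma Apair_linl (x : GA) (f : C) (a b : GA') : Ap (f *: a + b) x = f * Ap a x + Ap b x.
Proof. by rewrite /Apair /= vpairPl; ring. Qed.

(** 1-forms are determined by vector fields, and functions with values in the dual
    of g by the constant elements of g. *)
Lemma Apair_sep (a b : GA') : (forall x, Ap a x = Ap b x) -> a = b.
Proof.
case: a b => [a xi] [b eta] ab; congr pair.
  apply: fm_eq => X; have := ab (X, 0).
  by rewrite /Apair /= !vpair0r !addr0.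
apply: vpair_sepl => B; have := ab (0, vcst M B).
by rewrite /Apair /= !fm0r !add0r.
Qed.

(** The term <xi, dB> of the form component is dual to the summand - Y(B) of
    [X + B, Y] = [X, Y] - Y(B). *)
Definition dual_Lie (e : GA) (a : GA') : GA' :=
  (fm_Lie e.1 a.1 + vpair_d a.2 e.2, vder e.1 a.2 + vbil (ad_star_bilin g) e.2 a.2).

Lemma vpair_ad_star (B D : Cg) (xi : Cg') :
  vpair (vbil (ad_star_bilin g) B xi) D = - vpair xi (vlie B D).
Proof. by apply: smooth_eq => x; rewrite smooth_oppE /= ad_starE. Qed.

Lemma dual_LieP : dual_lie Ap (fun e f => anchor A e f) (brk A) dual_Lie.
Proof.
move=> [X B] [a xi] [Y D]; rewrite /Apair /= !vpairE vpair_ad_star vfD vf_vpair.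
by ring.
Qed.

Definition dual_d (f : C) : GA' := (fm_d f, 0).

Lemma dual_dP f x : Ap (dual_d f) x = anchor A x f.
Proof. by rewrite /Apair /= vpair0l addr0. Qed.

Section Cobracket.
Variable delta : cobracket g.

Definition vdual (xi eta : Cg') : Cg' := vbil (dual_bracket_bilin delta) xi eta.

(** The coefficients are absorbed into the first factors, so that the extended
    cobracket takes values in lists of pairs. *)
Definition delta_list (e : GA) : wedge2 GA :=
  flatten [seq [seq (vcoord e.2 k *: ing M p.1, ing M p.2)
                  | p <- delta (vbasis fullv)`_k] | k <- enum 'I_(\dim {:g})].

Lemma ev_delta_section (e : GA) (a b : GA') :
  ev Ap (delta_section delta e) [:: a; b] = ev2 Ap (delta_list e) a b.
Proof.
rewrite ev_wedge /ev2 !big_flatten !big_map; apply: eq_bigr => k _.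
rewrite !big_map; apply: eq_bigr => p _.
have ApZ c f x : Ap c (f *: x) = f * Ap c x.
  by have := pairEZ Apair_linr c f x.
by rewrite /= /contract /unit_form /= !ApZ; ring.
Qed.

Lemma ApingE (a : GA') (B : g) : Ap a (ing M B) = vpair a.2 (vcst M B).
Proof.
by rewrite /Apair /= fm0r add0r.
Qed.

Lemma ApinXE (a : GA') (X : X1) : Ap a (inX g X) = a.1 X.
Proof. by rewrite /Apair /= vpair0r addr0. Qed.

(** Both sides are linear over functions in the g-component, and on basis elements
    this is the definition of the dual bracket. *)
Lemma ev2_delta_list (e : GA) (a b : GA') :
  ev2 Ap (delta_list e) a b = vpair (vdual a.2 b.2) e.2.
Proof.
have ApZ c f x : Ap c (f *: x) = f * Ap c x.
  by have := pairEZ Apair_linr c f x.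
apply: smooth_eq => x /=; rewrite [in RHS](coord_vbasis (memvf (e.2 x))) linear_sum.
rewrite /ev2 big_flatten big_map big_enum smooth_sumE; apply: eq_bigr => k _.
rewrite linearZ /= dual_bracketE /ev2 big_map smooth_sumE scaler_sumr.
apply: eq_bigr => p _; rewrite !ApZ !ApingE /= -!mulrA.
by rewrite /GRing.scale /= /gpair; ring.
Qed.

End Cobracket.

End DualOfTransitive.

(** * The two halves of a Poisson action *)

Section PoissonAction.
Context {R : realType} {m : nat} (M : manifold R m) (g : lieAlgebra R).
Local Notation X1 := (vfield M).
Local Notation O1 := (form1 M).
Local Notation g' := (ldual g).
Local Notation Cg := (vsmooth M g).
Local Notation Cg' := (vsmooth M g').
Local Notation cst := (scst M).
Local Notation GA := (GA M g).
Local Notation GA' := (GA' M g).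
Local Notation Ap := (@Apair R m M g).
Local Notation TMp := (@TMpair R m M).
Local Notation lieT := (lie2 (TM M) (@fm_Lie R m M)).
Variables (pi : bivector M) (theta : tensor M g) (delta : cobracket g).

Local Notation pi2 := (ev2 TMp pi).

Definition pi_list : wedge2 GA := [seq (inX g p.1, inX g p.2) | p <- pi].
Definition K_list : wedge2 GA := [seq (inX g t.1, ing M t.2) | t <- theta].

Lemma ev2_pi_list a b : ev2 Ap pi_list a b = pi2 a.1 b.1.
Proof. by rewrite /ev2 big_map; apply: eq_bigr => p _; rewrite /= !ApinXE. Qed.

Lemma fm_sum (a : O1) (I : Type) (r : seq I) (F : I -> X1) :
  a (\sum_(i <- r) F i) = \sum_(i <- r) a (F i).
Proof.
by elim: r => [|i r IH]; rewrite ?big_nil ?fm0r // !big_cons fmD IH.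
Qed.

Lemma fmN (a : O1) X : a (- X) = - a X.
Proof. by rewrite -scaleN1r fmZ mulN1r. Qed.

Lemma theta_starE (a : O1) (xi : Cg') :
  a (theta_star theta xi) = vpair xi (theta_sharp theta a).
Proof.
rewrite fm_sum /theta_sharp.
elim: theta => [|t s IH]; first by rewrite !big_nil vpair0r.
by rewrite !big_cons IH !vpairE fmZ mulrC.
Qed.

Lemma pi_sharpE (a b : O1) : b (pi_sharp pi a) = pi2 a b.
Proof.
rewrite fm_sum; apply: eq_bigr => p _.
by rewrite fmD fmN !fmZ.
Qed.

Lemma pi2N (a b : O1) : pi2 a b = - pi2 b a.
Proof. by rewrite /ev2 -sumrN; apply: eq_bigr => p _; ring. Qed.

Lemma ev2_K_list (a b : GA') : ev2 Ap K_list a b =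
  a.1 (theta_star theta b.2) - b.1 (theta_star theta a.2).
Proof.
rewrite !fm_sum /ev2 big_map -sumrB; apply: eq_bigr => t _.
by rewrite /= !ApinXE !ApingE !fmZ; ring.
Qed.

Definition piK_list := pi_list ++ K_list.

Lemma ev2_piK_list (a b : GA') : ev2 Ap piK_list a b =
  pi2 a.1 b.1 + a.1 (theta_star theta b.2) - b.1 (theta_star theta a.2).
Proof. by rewrite /ev2 big_cat -/(ev2 _ _ _ _) -addrA -ev2_K_list -ev2_pi_list. Qed.

Lemma vf_bracket_suml (I : Type) (r : seq I) (F : I -> X1) X :
  vf_bracket (\sum_(i <- r) F i) X = \sum_(i <- r) vf_bracket (F i) X.
Proof.
have vbD Y Z : vf_bracket (Y + Z) X = vf_bracket Y X + vf_bracket Z X.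
  by apply: vf_eq => f /=; rewrite vfD; ring.
have vb0 : vf_bracket 0 X = 0 by apply: vf_eq => f /=; rewrite vf0 subrr.
by elim: r => [|i r IH]; rewrite ?big_nil // !big_cons vbD IH.
Qed.

(** Pairing with X makes [pi^# a, X] and [pi^# b, X] appear; expanding them by the
    Leibniz rule produces the Lie derivative of pi along X. *)
Lemma koszul_bracketE (a b : O1) X : koszul_bracket pi a b X =
  pi_sharp pi a (b X) - pi_sharp pi b (a X) + lieT X pi2 a b.
Proof.
have bracket_sharp (c d : O1) : d (vf_bracket (pi_sharp pi c) X) =
    - X (pi2 c d) + pi2 c (fm_Lie X d).
  rewrite vf_bracket_suml fm_sum /ev2 vf_sum -sumrN -!big_split.
  apply: eq_bigr => p _; rewrite /TMpair /=.
  rewrite vf_bracketN -scaleNr vf_bracketr -[(- _) *: p.1]addr0 vf_bracketr.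
  rewrite (_ : vf_bracket X 0 = 0) ?add0r; last by apply: vf_eq => f /=; rewrite vf0 subrr.
  by rewrite fmN !fmD !fmZ vfN vfB !vf_leibniz; ring.
rewrite /koszul_bracket /= !bracket_sharp /lie2 (pi2N b a) vfN (pi2N b (fm_Lie X a)).
by ring.
Qed.

(** The condition on L_phi(xi) pi with the parameter xi removed; in this form it
    also applies to non-constant xi. *)
Definition action_pi := forall a b,
  \sum_(t <- theta) lieT t.1 pi2 a b *: vcst M t.2 =
  vlie (theta_sharp theta a) (theta_sharp theta b).

Definition action_lie := forall xi eta : g',
  theta_star theta (vcst M (dual_bracket delta xi eta)) =
  - vf_bracket (theta_star theta (vcst M xi)) (theta_star theta (vcst M eta)).

Lemma vder_theta_sharp X a :
  vder X (theta_sharp theta a) = \sum_(t <- theta) X (a t.1) *: vcst M t.2.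
Proof.
rewrite vder_sum; apply: eq_bigr => t _.
by rewrite vderZ vder_cst scaler0 addr0.
Qed.

Lemma theta_morphism_pi : theta_morphism pi theta <-> action_pi.
Proof.
have koszulE a b : theta_sharp theta (koszul_bracket pi a b) =
    vder (pi_sharp pi a) (theta_sharp theta b)
    - vder (pi_sharp pi b) (theta_sharp theta a)
    + \sum_(t <- theta) lieT t.1 pi2 a b *: vcst M t.2.
  rewrite !vder_theta_sharp -sumrB -big_split; apply: eq_bigr => t _.
  by rewrite koszul_bracketE scalerDl scalerBl.
split=> H a b; last by rewrite koszulE H.
by have := H a b; rewrite koszulE => /addrI.
Qed.

Lemma pi2_linl f (a a' b : O1) : pi2 (f *: a + a') b = f * pi2 a b + pi2 a' b.
Proof.
rewrite /ev2 mulr_sumr -big_split; apply: eq_bigr => p _.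
by rewrite /TMpair /=; ring.
Qed.

Lemma pi2_linr f (a b b' : O1) : pi2 a (f *: b + b') = f * pi2 a b + pi2 a b'.
Proof. by rewrite pi2N pi2_linl (pi2N b a) (pi2N b' a); ring. Qed.

Lemma lieT_lin (c : R) X Y a b :
  lieT (cst c *: X + Y) pi2 a b = cst c * lieT X pi2 a b + lieT Y pi2 a b.
Proof.
have LD (d : O1) : fm_Lie (cst c *: X + Y) d = cst c *: fm_Lie X d + fm_Lie Y d.
  apply: fm_eq => Z; rewrite /= vf_bracketl vf_scst scale0r subr0 fm_lin.
  by ring.
by rewrite /lie2 /= !LD pi2_linl pi2_linr; ring.
Qed.

Lemma lieT_sum (I : Type) (r : seq I) (c : I -> R) (X : I -> X1) a b :
  lieT (\sum_(i <- r) cst (c i) *: X i) pi2 a b =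
  \sum_(i <- r) cst (c i) * lieT (X i) pi2 a b.
Proof.
elim: r => [|i r IH]; last by rewrite !big_cons lieT_lin IH.
rewrite !big_nil; apply: (addrI (lieT 0 pi2 a b)); rewrite addr0.
by have := lieT_lin 1 0 0 a b; rewrite scaler0 addr0 mul1r => <-.
Qed.

Lemma TM_schouten1l (X : X1) P s :
  ev TMp (TMschouten (multi1 X) P) s = lieder X (fm_Lie X) (ev TMp P) s.
Proof.
apply: (ev_schouten1l (act := fun (X : X1) f => X f)).
- exact: vfD.
- exact: vf_leibniz.
- exact: fm_Lie_dual.
Qed.

Lemma vlieNN (B D : Cg) : vlie (- B) (- D) = vlie B D.
Proof. by rewrite vlieN_r (vlieN (- B)) vlieN_r opprK (vlieN D) opprK. Qed.

(** For constant xi the field phi(xi) is a combination of the X_t with constant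
    coefficients, and only then is L_phi(xi) the combination of the L_{X_t}. *)
Lemma action_piE :
  (forall (xi : g') (a b : O1),
     ev TMp (TMschouten (multi1 (action_field theta (vcst M xi)))
                        (multi2 pi)) [:: a; b] =
     - vpair (vcst M xi) (vlie (- theta_sharp theta a) (- theta_sharp theta b)))
  <-> action_pi.
Proof.
have evE (xi : g') a b : ev TMp (TMschouten (multi1 (action_field theta (vcst M xi)))
    (multi2 pi)) [:: a; b] =
    - vpair (vcst M xi) (\sum_(t <- theta) lieT t.1 pi2 a b *: vcst M t.2).
  have -> : action_field theta (vcst M xi) = \sum_(t <- theta) cst (- xi t.2) *: t.1.
    rewrite /action_field -scaleN1r /theta_star scaler_sumr; apply: eq_bigr => t _.
    by rewrite scalerA mulN1r; congr (_ *: _); apply: smooth_eq => x; rewrite smooth_oppE.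
  set X := \sum_(t <- theta) _.
  rewrite TM_schouten1l (lieder_lie2 (TM M) _ X).
  rewrite (_ : (fun a b => _) = pi2); last first.
    by apply/funext => c; apply/funext => d; rewrite ev_multi2.
  rewrite lieT_sum.
  rewrite vpair_sumr -sumrN; apply: eq_bigr => t _; rewrite vpairZr mulrC -mulrN.
  by congr (_ * _); apply: smooth_eq => x; rewrite smooth_oppE.
split=> H; last first.
  by move=> xi a b; rewrite evE H vlieNN.
move=> a b; apply: vpair_sepr => xi; apply: oppr_inj; rewrite -evE H.
by rewrite vlieNN.
Qed.

End PoissonAction.

(** * The Maurer-Cartan equation of pi + K *)

Section MaurerCartanEquation.
Context {R : realType} {m : nat} (M : manifold R m) (g : lieAlgebra R).
Local Notation C := (smooth M).
Local Notation X1 := (vfield M).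
Local Notation O1 := (form1 M).
Local Notation g' := (ldual g).
Local Notation Cg := (vsmooth M g).
Local Notation Cg' := (vsmooth M g').
Local Notation cst := (scst M).
Local Notation GA := (GA M g).
Local Notation GA' := (GA' M g).
Local Notation A := (tralg M g).
Local Notation Ap := (@Apair R m M g).
Local Notation TMp := (@TMpair R m M).
Local Notation lieT := (lie2 (TM M) (@fm_Lie R m M)).
Local Notation lieA := (lie2 A (@dual_Lie R m M g)).
Variables (pi : bivector M) (theta : tensor M g) (delta : cobracket g).
Local Notation pi2 := (ev2 TMp pi).

Lemma theta_star_cst (xi : g') :
  theta_star theta (vcst M xi) = \sum_(t <- theta) cst (xi t.2) *: t.1.
Proof. by apply: eq_bigr => t _; congr (_ *: _); apply: smooth_eq. Qed.

Lemma bracket_theta_star (xi eta : g') :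
  vf_bracket (theta_star theta (vcst M xi)) (theta_star theta (vcst M eta)) =
  \sum_(t <- theta) \sum_(u <- theta) cst (xi t.2 * eta u.2) *: vf_bracket t.1 u.1.
Proof.
rewrite !theta_star_cst vf_bracket_suml; apply: eq_bigr => t _.
rewrite vf_bracketN vf_bracket_suml.
apply: vf_eq => f; rewrite -scaleN1r scaler_sumr.
congr (vf_fun _ f); apply: eq_bigr => u _; apply: vf_eq => h /=.
have mulcst x y : cst (x * y) = cst x * cst y by exact: smooth_eq.
by rewrite !vf_leibniz !vf_scst mulcst; ring.
Qed.

Lemma action_lie_field : action_lie theta delta <-> forall xi eta : g',
  action_field theta (vcst M (dual_bracket delta xi eta)) =
  vf_bracket (action_field theta (vcst M xi)) (action_field theta (vcst M eta)).
Proof.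
have NN (X Y : X1) : vf_bracket (- X) (- Y) = vf_bracket X Y.
  by apply: vf_eq => f; rewrite /= !(mulN1r, vfN); ring.
split=> H xi eta; rewrite /action_field.
  by rewrite H opprK NN.
by apply: oppr_inj; rewrite opprK -NN; exact: H.
Qed.

(** By antisymmetry of the bracket of vector fields, the tensor [theta, theta]
    evaluated on (xi, eta) is 2 [theta^* xi, theta^* eta]; hence the factor 1/2. *)
Lemma action_lie_tensor : action_lie theta delta <-> forall xi eta,
  tens2_ev (delta_theta delta theta) xi eta
  + cst 2^-1 *: tens2_ev (theta_theta theta) xi eta = 0.
Proof.
have deltaE xi eta : tens2_ev (delta_theta delta theta) xi eta =
    theta_star theta (vcst M (dual_bracket delta xi eta)).
  rewrite theta_star_cst /tens2_ev big_map; apply: eq_bigr => t _.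
  by rewrite dual_bracketE.
have thetaE xi eta : cst 2^-1 *: tens2_ev (theta_theta theta) xi eta =
    vf_bracket (theta_star theta (vcst M xi)) (theta_star theta (vcst M eta)).
  rewrite bracket_theta_star /tens2_ev big_allpairs_dep /=; set S := RHS.
  have swap : \sum_(t <- theta) \sum_(u <- theta)
      cst (xi u.2 * eta t.2) *: vf_bracket t.1 u.1 = (-1) *: S.
    rewrite exchange_big scaler_sumr; apply: eq_bigr => t _ /=.
    rewrite scaler_sumr; apply: eq_bigr => u _ /=.
    by rewrite vf_bracketN scalerN -scaleN1r.
  have -> : \sum_(t <- theta) \sum_(u <- theta)
      cst (ev2 (@gpair R g) [:: (t.2, u.2)] xi eta) *: vf_bracket t.1 u.1 = S + S.
    rewrite -[X in _ = _ + X]scale1r -[1 in RHS]opprK scaleNr -swap.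
    rewrite -scaleN1r scaler_sumr -big_split; apply: eq_bigr => t _ /=.
    rewrite scaler_sumr -big_split; apply: eq_bigr => u _ /=.
    rewrite scalerA -scalerDl; congr (_ *: _); apply: smooth_eq => x /=.
    by rewrite /ev2 big_seq1 /gpair /=; ring.
  rewrite -mulr2n -[S *+ 2]scaler_nat scalerA (_ : _ * _ = 1) ?scale1r //.
  apply: smooth_eq => x.
  have natE n : (n%:R : C) x = n%:R by elim: n => // n IH; rewrite -!natr1 /= IH.
  by rewrite -[LHS]/(2^-1 * (2%:R : C) x) natE mulVf // pnatr_eq0.
split=> H xi eta; first by rewrite deltaE thetaE H addNr.
by apply/eqP; rewrite -addr_eq0 -deltaE -thetaE H.
Qed.

(** delta x evaluated on (a, b) is x evaluated on the dual bracket of a and b, so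
    the derivation acts on arguments instead of factors. *)
Lemma extend_vdual Om (a b c : GA') :
  extend_der Ap (fun e => ev2 Ap (delta_list delta e)) Om a b c =
  ev2 Ap Om (0, vdual delta a.2 b.2) c + ev2 Ap Om (0, vdual delta b.2 c.2) a +
  ev2 Ap Om (0, vdual delta c.2 a.2) b.
Proof.
rewrite /extend_der /ev2 -!big_split; apply: eq_bigr => p _ /=.
rewrite /wedge3f -!/(ev2 Ap _ _ _) !ev2_delta_list.
have pair0 xi (e : GA) : Ap (0, xi) e = vpair xi e.2 by rewrite /Apair /= add0r.
by rewrite !pair0; ring.
Qed.

Local Notation PiL := (pi_list g pi).
Local Notation KL := (K_list theta).

Lemma brk_inX X Y : brk A (inX g X) (inX g Y) = inX g (vf_bracket X Y).
Proof.
congr pair => /=; rewrite !vder0 subrr add0r.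
by rewrite vlie0r.
Qed.

Lemma brk_inX_ing X B : brk A (inX g X) (ing M B) = 0.
Proof.
congr pair => /=; first by apply: vf_eq => f /=; rewrite vf0 subrr.
by rewrite vder_cst vder0l subrr add0r vlieN vlie0r oppr0.
Qed.

Lemma brk_ing B D : brk A (ing M B) (ing M D) = ing M (lbr B D).
Proof.
congr pair => /=; first by apply: vf_eq => f /=; rewrite subrr.
by rewrite !vder0l subrr add0r; apply: vsmooth_eq.
Qed.

Lemma brk_ing_inX B X : brk A (ing M B) (inX g X) = 0.
Proof. by rewrite (brN (tralg_lie M g)) brk_inX_ing oppr0. Qed.

Let lieA_sum := lie2_ev2_sum (@dual_LieP _ _ M g).

Lemma Ap0r a : Ap a 0 = 0.
Proof. exact: pairE0 (@Apair_linr _ _ M g) a. Qed.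

Lemma lieA_inX_pi X a b : lieA (inX g X) (ev2 Ap PiL) a b = lieT X pi2 a.1 b.1.
Proof.
rewrite lieA_sum (lie2_ev2_sum (A := TM M) (@fm_Lie_dual _ _ M)) big_map.
by apply: eq_bigr => p _; rewrite !brk_inX /wedge_val !ApinXE.
Qed.

Lemma lieA_ing_pi B a b : lieA (ing M B) (ev2 Ap PiL) a b = 0.
Proof.
rewrite lieA_sum big_map; apply: big1 => p _.
by rewrite !brk_ing_inX /wedge_val !Ap0r; ring.
Qed.

Lemma lieA_inX_K X a b : lieA (inX g X) (ev2 Ap KL) a b =
  \sum_(u <- theta) wedge_val Ap (inX g (vf_bracket X u.1)) (ing M u.2) a b.
Proof.
rewrite lieA_sum big_map; apply: eq_bigr => u _.
by rewrite brk_inX_ing brk_inX /wedge_val !Ap0r; ring.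
Qed.

Lemma lieA_ing_K B a b : lieA (ing M B) (ev2 Ap KL) a b =
  \sum_(u <- theta) wedge_val Ap (inX g u.1) (ing M (lbr B u.2)) a b.
Proof.
rewrite lieA_sum big_map; apply: eq_bigr => u _.
by rewrite brk_ing_inX brk_ing /wedge_val !Ap0r; ring.
Qed.

Local Notation BrA := (biv_bracket A Ap (@dual_Lie R m M g)).

Lemma biv_bracket_pi_pi a b c : BrA PiL PiL a b c =
  biv_bracket (TM M) TMp (@fm_Lie R m M) pi pi a.1 b.1 c.1.
Proof.
rewrite /biv_bracket /extend_der big_map; apply: eq_bigr => p _.
by rewrite /wedge3f !lieA_inX_pi !ApinXE.
Qed.

(** The part of the equation that takes two 1-forms and one element of the dual of
    g. It occurs in [K, pi] and, with the opposite sign, in [K, K]. *)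
Definition theta_lie_form (a b c : GA') : C :=
  vpair c.2 (vlie (theta_sharp theta a.1) (theta_sharp theta b.1)).
Local Notation N := theta_lie_form.

Lemma biv_bracket_K_pi a b c : action_pi pi theta ->
  BrA KL PiL a b c = - (N a b c + N b c a + N c a b).
Proof.
move=> Hpi; rewrite /theta_lie_form -!Hpi !vpair_sumr -!big_split -sumrN /biv_bracket /extend_der big_map.
apply: eq_bigr => t _ /=.
by rewrite /wedge3f !lieA_inX_pi !lieA_ing_pi !ApinXE !ApingE !vpairZr; ring.
Qed.

(** The part of [K, K] that takes one 1-form and two elements of the dual of g. *)
Definition theta_bracket_form (a b c : GA') : C := \sum_(t <- theta) \sum_(u <- theta)
  a.1 (vf_bracket t.1 u.1) * (vpair b.2 (vcst M t.2) * vpair c.2 (vcst M u.2)).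

Lemma theta_star_at (a : O1) (xi : Cg') x :
  a (theta_star theta xi) x = \sum_(t <- theta) xi x t.2 * a t.1 x.
Proof. by rewrite fm_sum smooth_sumE; apply: eq_bigr => t _; rewrite fmZ. Qed.

(** Constant xi and eta suffice: at a point x the double sum involves the sections
    of the dual of g only through their values at x. *)
Lemma theta_bracket_formE a b c : action_lie theta delta ->
  theta_bracket_form a b c = - a.1 (theta_star theta (vdual delta b.2 c.2)).
Proof.
move=> Hlie; apply: smooth_eq => x; rewrite smooth_oppE theta_star_at.
have := congr1 (fun X => a.1 X x) (Hlie (b.2 x) (c.2 x)).
rewrite theta_star_at bracket_theta_star fmN smooth_oppE => ->; rewrite opprK.
rewrite fm_sum !smooth_sumE; apply: eq_bigr => t _.
rewrite fm_sum !smooth_sumE; apply: eq_bigr => u _.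
by rewrite fmZ /= mulrC.
Qed.

Lemma biv_bracket_K_K a b c :
  BrA KL KL a b c =
  (theta_bracket_form a b c + theta_bracket_form b c a + theta_bracket_form c a b)
  + (theta_bracket_form a b c + theta_bracket_form b c a + theta_bracket_form c a b)
  + (N a b c + N b c a + N c a b) + (N a b c + N b c a + N c a b).
Proof.
pose SS (F : X1 * g -> X1 * g -> C) := \sum_(t <- theta) \sum_(u <- theta) F t u.
have SSD F G : SS F + SS G = SS (fun t u => F t u + G t u).
  by rewrite /SS -big_split; apply: eq_bigr => t _; rewrite -big_split.
have SSN F : - SS F = SS (fun t u => - F t u).
  by rewrite /SS -sumrN; apply: eq_bigr => t _; rewrite -sumrN.
pose cu (t u : X1 * g) (x y z : GA') :=
  x.1 (vf_bracket t.1 u.1) * (vpair y.2 (vcst M t.2) * vpair z.2 (vcst M u.2)).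
pose nu (t u : X1 * g) (x y z : GA') :=
  x.1 t.1 * (y.1 u.1 * vpair z.2 (vcst M (lbr t.2 u.2))).
have bracket_formE x y z : theta_bracket_form x y z = SS (fun t u => cu t u x y z) by [].
have bracket_formN x y z : theta_bracket_form x y z = - SS (fun t u => cu t u x z y).
  rewrite /SS exchange_big -sumrN; apply: eq_bigr => t _; rewrite -sumrN.
  by apply: eq_bigr => u _; rewrite /cu vf_bracketN fmN; ring.
have NE x y z : N x y z = SS (fun t u => nu t u x y z).
  have vlie_suml (I : Type) (r : seq I) (F : I -> Cg) B :
      vlie (\sum_(i <- r) F i) B = \sum_(i <- r) vlie (F i) B.
    elim: r => [|i r IH]; first by rewrite !big_nil vlieN vlie0r oppr0.
    by rewrite !big_cons -IH vlieN vlieD_r opprD -!vlieN.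
  rewrite /theta_lie_form /theta_sharp vlie_suml vpair_sumr; apply: eq_bigr => t _.
  rewrite vlieN vlie_suml vpairNr vpair_sumr -sumrN; apply: eq_bigr => u _.
  rewrite -[_ *: _]addr0 -[x.1 t.1 *: _]addr0 vlieDl vlieDr.
  rewrite vlie0r addr0 [vlie 0 _]vlieN vlie0r oppr0 addr0 !vpairE /nu.
  rewrite vlieN vpairNr (_ : vlie (vcst M t.2) _ = vcst M (lbr t.2 u.2));
    last exact: vsmooth_eq.
  by ring.
have NN x y z : N x y z = - SS (fun t u => nu t u y x z).
  by rewrite -NE /theta_lie_form vlieN vpairNr.
have cub2 x y z : theta_bracket_form x y z + theta_bracket_form x y z =
    SS (fun t u => cu t u x y z + - cu t u x z y).
  by rewrite {1}bracket_formE bracket_formN SSN SSD.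
have N2 x y z : N x y z + N x y z = SS (fun t u => nu t u x y z + - nu t u y x z).
  by rewrite {1}NE NN SSN SSD.
transitivity ((theta_bracket_form a b c + theta_bracket_form a b c) + (theta_bracket_form b c a + theta_bracket_form b c a) +
  (theta_bracket_form c a b + theta_bracket_form c a b) + (N a b c + N a b c) + (N b c a + N b c a)
  + (N c a b + N c a b)); last by ring.
rewrite !cub2 !N2 !SSD /biv_bracket /extend_der big_map; apply: eq_bigr => t _.
rewrite /wedge3f !lieA_inX_K !lieA_ing_K -!sumrN !mulr_suml -!big_split /= -sumrN.
rewrite -big_split /=; apply: eq_bigr => u _.
by rewrite /wedge_val !ApinXE !ApingE /cu /nu; ring.
Qed.

(** By symmetry [Pi, Pi] = [pi, pi] + 2 [K, pi] + [K, K]. The terms with two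
    1-forms cancel and those with one 1-form are 2 delta Pi. *)
Lemma maurer_cartan_of_action : is_poisson pi -> action_pi pi theta ->
  action_lie theta delta -> forall a b c,
  BrA (piK_list pi theta) (piK_list pi theta) a b c =
  extend_der Ap (fun e => ev2 Ap (delta_list delta e)) (piK_list pi theta) a b c +
  extend_der Ap (fun e => ev2 Ap (delta_list delta e)) (piK_list pi theta) a b c.
Proof.
move=> Hpois Hpi Hlie a b c.
have split1 O1 O2 O a' b' c' : BrA (O1 ++ O2) O a' b' c' = BrA O1 O a' b' c' + BrA O2 O a' b' c'.
  by rewrite /biv_bracket /extend_der big_cat.
have BrAC := biv_bracketC (tralg_lie M g) (@Apair_linr _ _ M g) (@dual_LieP _ _ M g).
rewrite {1}/piK_list split1 ![BrA _ (piK_list _ _) _ _ _]BrAC /piK_list !split1.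
rewrite (BrAC PiL KL) biv_bracket_pi_pi biv_bracket_K_pi // biv_bracket_K_K !theta_bracket_formE //.
rewrite [biv_bracket _ _ _ _ _ _ _ _](_ : _ = 0); last first.
  rewrite -(ev_schouten_bivectors (TM_lie M) (@TMpair_linr _ _ M) (@fm_Lie_dual _ _ M)).
  exact: Hpois.
rewrite extend_vdual !ev2_piK_list /=.
have fm00 (X : X1) : (0 : O1) X = 0 by [].
have pi20 (x : O1) : pi2 0 x = 0.
  by rewrite /ev2 big1 // => p _; rewrite /TMpair !fm00; ring.
by rewrite ?fm00 !pi20; ring.
Qed.

End MaurerCartanEquation.

(** * The double of the Poisson action *)

Section LieBialgebra.
Context {R : realType} {g : lieAlgebra R}.
Local Notation g' := (ldual g).
Local Notation gp := (@gpair R g).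

Lemma ad_star_dual : dual_lie gp (fun _ _ => 0) (@lbr R g) (@ad_star R g).
Proof. by move=> e a e'; rewrite /gpair ad_starE sub0r. Qed.

Lemma gschouten1l (B : g) P s : ev gp (gschouten (multi1 B) P) s =
  - subst_sum (ad_star B) (ev gp P) s.
Proof.
rewrite /gschouten (ev_schouten1l _ _ ad_star_dual); first by rewrite /lieder sub0r.
- by move=> *; rewrite addr0.
- by move=> *; rewrite mul0r mulr0 addr0.
Qed.

Lemma gschouten1r (B : g) P s : ev gp (gschouten P (multi1 B)) s =
  subst_sum (ad_star B) (ev gp P) s.
Proof.
rewrite /gschouten (ev_schouten1r _ _ ad_star_dual).
- by rewrite /lieder sub0r opprK.
- by move=> *; rewrite addr0.
- by move=> *; rewrite mul0r mulr0 addr0.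
- exact: lbrN.
- by move=> a x; rewrite /gpair linearN.
Qed.

Variable delta : cobracket g.

Lemma dual_bracketN (xi eta : g') : dual_bracket delta xi eta = - dual_bracket delta eta xi.
Proof.
apply/lfunP => B; rewrite opp_lfunE !dual_bracketE /ev2 -sumrN.
by apply: eq_bigr => p _; ring.
Qed.

(** The cocycle condition in terms of the dual bracket: the Lie derivative along A
    on the dual of g is the coadjoint action. *)
Lemma cocycle_dual_bracket : is_cocycle delta -> forall (A B : g) (xi eta : g'),
  dual_bracket delta xi eta (lbr A B) =
  dual_bracket delta (ad_star B xi) eta A + dual_bracket delta xi (ad_star B eta) A
  - dual_bracket delta (ad_star A xi) eta B - dual_bracket delta xi (ad_star A eta) B.
Proof.
move=> H A B xi eta; have := H A B [:: xi; eta].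
rewrite ev_cat gschouten1l gschouten1r /= /contract !ev_multi2 !dual_bracketE => ->.
by ring.
Qed.

End LieBialgebra.

Section Double.
Context {R : realType} {m : nat} (M : manifold R m) (g : lieAlgebra R).
Local Notation C := (smooth M).
Local Notation X1 := (vfield M).
Local Notation O1 := (form1 M).
Local Notation g' := (ldual g).
Local Notation Cg := (vsmooth M g).
Local Notation Cg' := (vsmooth M g').
Local Notation GA := (GA M g).
Local Notation GA' := (GA' M g).
Local Notation A := (tralg M g).
Local Notation Ap := (@Apair R m M g).
Local Notation TMp := (@TMpair R m M).
Local Notation lieA := (lie2 A (@dual_Lie R m M g)).
Variables (pi : bivector M) (theta : tensor M g) (delta : cobracket g).
Local Notation pi2 := (ev2 TMp pi).
Local Notation PiK := (piK_list pi theta).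
Local Notation dl := (delta_list delta).
Local Notation dA := (codiff A Ap (@dual_Lie R m M g) PiK dl).
Local Notation double := (mp_double pi theta delta).

Lemma anchor_double a f : anchor double a f = hamiltonian Ap (fun e f => anchor A e f) PiK f a.
Proof.
have hamE O : hamiltonian Ap (fun e f => anchor A e f) O f a = ev2 Ap O a (dual_d g f).
  by apply: eq_bigr => p _; rewrite !dual_dP.
rewrite hamE ev2_piK_list /= -(pi_sharpE pi) /=.
have ts0 : theta_star theta (0 : Cg') = 0.
  by rewrite /theta_star big1 // => t _; rewrite vpair0l scale0r.
by rewrite ts0 fm0r addr0 mulN1r.
Qed.

Lemma vderNl {V : vectType R} X (f : vsmooth M V) : vder (- X) f = - vder X f.
Proof.
by rewrite -scaleN1r -[_ *: X]addr0 vderDl vder0l addr0 scaleN1r.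
Qed.

(** The terms in pi are [koszul_bracketE]; the others match once every occurrence
    of theta^* is moved to theta^# by duality and the derivatives of pairings are
    expanded. *)
Lemma brk_double a b e : Ap (brk double a b) e =
  anchor double a (Ap b e) - anchor double b (Ap a e) - dA e a b.
Proof.
case: a b e => [a xi] [b eta] [Z B].
rewrite /codiff ev2_delta_list /lie2 !ev2_piK_list.
have psiE (zeta : Cg') (c : O1) : mp_psi theta zeta c Z =
    - vpair zeta (vder Z (theta_sharp theta c))
    - (theta_star theta zeta (c Z) - Z (vpair zeta (theta_sharp theta c))
       - c (vf_bracket (theta_star theta zeta) Z)).
  by rewrite -theta_starE /= !mulN1r.
have phiE (zeta : Cg') (c : O1) : vpair (mp_phi pi theta c zeta) B =
    vpair (vder (pi_sharp pi c) zeta) B - vpair zeta (vlie (theta_sharp theta c) B).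
  by rewrite vpairDl vpair_ad_star.
have anchorE (zeta : Cg') (c : O1) f : anchor double (c, zeta) f =
    pi_sharp pi c f - theta_star theta zeta f by rewrite /= mulN1r.
have brE : Ap (brk double (a, xi) (b, eta)) (Z, B) =
    koszul_bracket pi a b Z + mp_psi theta xi b Z - mp_psi theta eta a Z
    + (vpair (vdual delta xi eta) B - vpair (vder (theta_star theta xi) eta) B
       + vpair (vder (theta_star theta eta) xi) B
       + vpair (mp_phi pi theta a eta) B - vpair (mp_phi pi theta b xi) B).
  have -> : brk double (a, xi) (b, eta) =
    (koszul_bracket pi a b + mp_psi theta xi b - mp_psi theta eta a,
     action_bracket theta delta xi eta + mp_phi pi theta a eta - mp_phi pi theta b xi) by [].
  have ApE x y : Ap (x, y) (Z, B) = x Z + vpair y B by [].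
  have fmDE (x y z : O1) : (x + y - z) Z = x Z + y Z - z Z by rewrite /= mulN1r.
  rewrite ApE fmDE; congr (_ + _).
  by rewrite /action_bracket /action_field !vderNl !vpairE; ring.
have ApE x y : Ap (x, y) (Z, B) = x Z + vpair y B by [].
have dual_LieE x y : dual_Lie (Z, B) (x, y) =
  (fm_Lie Z x + vpair_d y B, vder Z y + vbil (ad_star_bilin g) B y) by [].
have fst_pair (x : O1) (y : Cg') : (x, y).1 = x by [].
have snd_pair (x : O1) (y : Cg') : (x, y).2 = y by [].
have ancA f : anchor A (Z, B) f = Z f by [].
have fstZ (x : X1) (y : Cg) : (x, y).2 = y by [].
rewrite brE koszul_bracketE !psiE !phiE !anchorE !ApE !dual_LieE ancA.
rewrite !fst_pair !snd_pair !fstZ.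
have pi2D (x x' y : O1) : pi2 (x + x') y = pi2 x y + pi2 x' y.
  by rewrite -[x in LHS]scale1r pi2_linl mul1r.
have pi2D' (x y y' : O1) : pi2 x (y + y') = pi2 x y + pi2 x y'.
  by rewrite (pi2N pi) pi2D !(pi2N pi x) !(pi2N pi _ x); ring.
have fmE (x y : O1) X : (x + y) X = x X + y X by [].
have vdE (z : Cg') X : vpair_d z B X = vpair z (vder X B) by [].
have LieE (x : O1) (z : Cg') : (fm_Lie Z x) (theta_star theta z) =
  Z (x (theta_star theta z)) - x (vf_bracket Z (theta_star theta z)) by [].
have pi2d (x : O1) (z : Cg') : pi2 x (vpair_d z B) = vpair z (vder (pi_sharp pi x) B).
  by rewrite -pi_sharpE.
rewrite !pi2D !pi2D' (pi2N pi (vpair_d _ _)) !pi2d !fmE !vdE !LieE.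
rewrite !theta_starE !vpairDl !vpair_ad_star !vfD !vfN !vf_vpair.
rewrite (vlieN B) (vlieN B) !vpairNr (vf_bracketN Z) (vf_bracketN Z) !fmN.
by rewrite /lie2; ring.
Qed.

Lemma double_unique (L : algebroid GA') :
  (forall a f, anchor L a f = anchor double a f) ->
  (forall a b e, Ap (brk L a b) e = Ap (brk double a b) e) ->
  anchor L = anchor double /\ brk L = brk double.
Proof.
move=> anc br; split; apply/funext => a; first exact/vf_eq/anc.
by apply/funext => b; apply: Apair_sep => e; rewrite br.
Qed.

Lemma ev_dstar P s : ev Ap (dstar (Quadruple pi theta [::] delta) P) s =
  \sum_(t <- P) (wedge1 (hamiltonian Ap (fun e f => anchor A e f) PiK t.1) (wedge Ap t.2) s
                 + t.1 * dwedge Ap dA t.2 s).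
Proof.
have -> : dstar (Quadruple pi theta [::] delta) P =
    Aschouten (multi2 PiK) P ++ mscale (-1) (Adelta delta P).
  by rewrite /dstar /= cats0 /piK_list /multi2 map_cat -!map_comp.
rewrite ev_cat ev_mscale /Aschouten ev_schouten_biv; last by move=> *; exact: vf_leibniz.
rewrite /Adelta ev_dext; last first.
  by move=> e; apply/allP => t /flattenP[s' /mapP[k _ ->] /mapP[p _ ->]].
rewrite mulN1r -sumrB; apply: eq_bigr => t _; rewrite -addrA; congr (_ + _).
rewrite -mulrBr; congr (_ * _).
have dwedgeB D D' es : dwedge Ap D es s - dwedge Ap D' es s =
    dwedge Ap (fun e a b => D e a b - D' e a b) es s.
  rewrite !dwedge_sum -sumrB; apply: eq_bigr => j _; rewrite -mulrBr; congr (_ * _).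
  have -> : (fun a b => D es`_j a b - D' es`_j a b) =
      (fun a b => -1 * D' es`_j a b + D es`_j a b).
    by apply/funext => x; apply/funext => y; ring.
  by rewrite wedge2f_linl; ring.
rewrite dwedgeB; congr dwedge; apply/funext => e; apply/funext => a; apply/funext => b.
by rewrite ev_delta_section (bracket_bivE (tralg_lie M g) (@Apair_linr _ _ M g) (@dual_LieP _ _ M g)).
Qed.

Lemma dual_diffE (L : algebroid GA') P s : dual_diff L (ev Ap P) s =
  \sum_(t <- P) (wedge1 (fun a => anchor L a t.1) (wedge Ap t.2) s
     + t.1 * dwedge Ap (fun e a b => anchor L a (Ap b e) - anchor L b (Ap a e)
                                  - Ap (brk L a b) e) t.2 s).
Proof.
rewrite /dual_diff koszul_ev //; first by move=> *; exact: vfD.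
by move=> *; exact: vf_leibniz.
Qed.

(** Degree 0 of the equality determines the anchor, degree 1 then determines the
    bracket; conversely both sides are derivations that agree in these degrees. *)
Lemma dual_diff_dstar (L : algebroid GA') :
  (forall P s, dual_diff L (ev Ap P) s =
               ev Ap (dstar (Quadruple pi theta [::] delta) P) s) <->
  anchor L = anchor double /\ brk L = brk double.
Proof.
split=> [H|[anc br] P s]; last first.
  rewrite dual_diffE ev_dstar anc br; apply: eq_bigr => t _.
  congr (_ + _ * _); first by apply: wedge1_eql => a; exact: anchor_double.
  congr (dwedge _ _ _ _).
  by apply/funext => e; apply/funext => a; apply/funext => b; rewrite brk_double; ring.
have anc a f : anchor L a f = anchor double a f.
  have wedge11 (w : GA' -> C) : wedge1 w (wedge Ap [::]) [:: a] = w a.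
    by rewrite /= /unit_form /=; ring.
  have dwedge0 D : dwedge Ap D [::] [:: a] = 0 by [].
  have := H [:: (f, [::])] [:: a].
  by rewrite dual_diffE ev_dstar !big_seq1 !wedge11 !dwedge0 !mulr0 !addr0 anchor_double.
apply: double_unique => // a b e.
have := H (multi1 e) [:: a; b]; rewrite dual_diffE ev_dstar !big_seq1 !dwedge1 !mul1r.
have wedge1_d1 (w : GA' -> C) s : (forall a, w a = 0) -> wedge1 w (wedge Ap [:: e]) s = 0.
  by move=> w0; apply: etrans (wedge1_0l (wedge Ap [:: e]) s); apply: wedge1_eql.
rewrite !wedge1_d1 ?add0r; first last.
- by move=> c; exact: (der1 (vf_leibniz _)).
- by move=> c; rewrite -anchor_double; exact: (der1 (vf_leibniz _)).
rewrite brk_double -!anc => <-; ring.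
Qed.

Lemma vdualDl (xi xi' eta : Cg') :
  vdual delta (xi + xi') eta = vdual delta xi eta + vdual delta xi' eta.
Proof. by have := vbilDl (dual_bracket_bilin delta) 1 xi xi' eta; rewrite !scale1r. Qed.

Lemma vdualDr (xi eta eta' : Cg') :
  vdual delta xi (eta + eta') = vdual delta xi eta + vdual delta xi eta'.
Proof. by have := vbilDr (dual_bracket_bilin delta) 1 xi eta eta'; rewrite !scale1r. Qed.

Local Notation ads := (vbil (ad_star_bilin g)).

(** Both sides are bilinear over functions, so the identity holds pointwise. *)
Lemma vdual_cocycle : is_cocycle delta -> forall (B D : Cg) (xi eta : Cg'),
  vpair (vdual delta xi eta) (vlie B D) =
  vpair (vdual delta (ads D xi) eta) B + vpair (vdual delta xi (ads D eta)) B
  - vpair (vdual delta (ads B xi) eta) D - vpair (vdual delta xi (ads B eta)) D.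
Proof.
move=> Hcoc B D xi eta; apply: smooth_eq => x.
have /= -> := cocycle_dual_bracket Hcoc (B x) (D x) (xi x) (eta x).
by rewrite !mulN1r.
Qed.

(** The derivatives of the functions cancel by the Leibniz rule, because the dual
    bracket has constant structure; the pointwise identity remains. *)
Lemma delta_list_cocycle : is_cocycle delta -> forall (x y : GA) a b,
  ev2 Ap (dl (brk A x y)) a b =
  lieA x (ev2 Ap (dl y)) a b - lieA y (ev2 Ap (dl x)) a b.
Proof.
move=> Hcoc [Z B] [Y D] a b; rewrite /lie2 !ev2_delta_list.
rewrite -[(brk _ _ _).2]/(vder Z D - vder Y B + vlie B D).
rewrite -[anchor _ _]/Z -[anchor _ _]/Y.
rewrite -![(dual_Lie _ _).2]/(vder _ _ + vbil (ad_star_bilin g) _ _).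
rewrite !vdualDl !vdualDr !vf_vpair !vder_vbil.
rewrite -![vbil (dual_bracket_bilin delta) _ _]/(vdual delta _ _).
by rewrite !vpairE vdual_cocycle //; ring.
Qed.

(** By [extend_vdual], delta^2 x evaluated on (a, b, c) is the Jacobi sum of the
    dual bracket evaluated on x. *)
Lemma delta_list_square : is_lie_bracket (dual_bracket delta) -> forall (x : GA) a b c,
  extend_der Ap (fun e => ev2 Ap (dl e)) (dl x) a b c = 0.
Proof.
move=> [_ _ J] x a b c; rewrite extend_vdual !ev2_delta_list -!vpairDl /=.
apply: smooth_eq => y; rewrite /= (dual_bracketN delta (dual_bracket _ _ _)).
rewrite (dual_bracketN delta (dual_bracket _ (b.2 y) _)).
rewrite (dual_bracketN delta (dual_bracket _ (c.2 y) (a.2 y))).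
have := J (c.2 y) (a.2 y) (b.2 y) => e.
by rewrite -!opprD e oppr0 zero_lfunE.
Qed.

Lemma double_lie : is_poisson pi -> action_pi pi theta -> action_lie theta delta ->
  is_lie_bialgebra delta -> is_lie_algebroid double.
Proof.
move=> Hpois Hpi Hlie [Hcoc Hbr].
apply: (twisted_bracket_lie (tralg_lie M g) (@Apair_linr _ _ M g) (@Apair_linl _ _ M g)
  (@Apair_sep _ _ M g) (@dual_LieP _ _ M g) (@dual_dP _ _ M g)
  (delta := dl) (Pi := PiK)).
- move=> x a f; rewrite ev2_delta_list /=.
  rewrite (_ : vdual _ _ _ = 0) ?vpair0l //.
  by apply: (addrI (vdual delta a.2 0)); rewrite -vdualDr !addr0.
- by move=> x y a b; exact: (delta_list_cocycle Hcoc).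
- by move=> x a b c; exact: (delta_list_square Hbr).
- exact: maurer_cartan_of_action.
- exact: anchor_double.
- exact: brk_double.
Qed.

End Double.

Section Bialgebroid.
Context {R : realType} {m : nat} (M : manifold R m) (g : lieAlgebra R).
Local Notation GA := (GA M g).
Local Notation GA' := (GA' M g).
Local Notation A := (tralg M g).
Local Notation Ap := (@Apair R m M g).
Variables (pi : bivector M) (theta : tensor M g) (delta : cobracket g).
Local Notation PiK := (piK_list pi theta).
Local Notation dl := (delta_list delta).
Local Notation dA := (codiff A Ap (@dual_Lie R m M g) PiK dl).
Local Notation double := (mp_double pi theta delta).

(** d_* e is represented by - L_e Pi - delta e, a list of pairs taken
    with coefficient -1. Only pairs of arguments matter: all terms vanish on lists of
    another length. *)
Lemma double_lie_bialgebroid : is_poisson pi -> action_pi pi theta ->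
  action_lie theta delta -> is_lie_bialgebra delta -> is_lie_bialgebroid double.
Proof.
move=> Hpois Hpi Hlie Hbi; split; first exact: double_lie.
pose P e : multi GA := mscale (-1) (multi2 (lie_list A e PiK ++ dl e)).
have homogP e : homog 2 (P e).
  by apply/allP => t /mapP[u /mapP[p _ ->] ->].
have evP e a b : ev Ap (P e) [:: a; b] = dA e a b.
  by rewrite ev_mscale ev_multi2 (codiffE (@dual_LieP _ _ M g)) mulN1r.
have small s : size s != 2 \/ exists a b, s = [:: a; b] :> seq GA'.
  by case: s => [|a [|b [|c s]]]; [left|left|right; exists a, b|left].
have diffE e s : dual_diff double (ev Ap (multi1 e)) s = ev Ap (P e) s.
  rewrite dual_diffE big_seq1 mul1r.
  rewrite [wedge1 _ _ _](_ : _ = 0) ?add0r; last first.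
    apply: etrans (wedge1_0l (wedge Ap [:: e]) s); apply: wedge1_eql => a.
    exact: (der1 (vf_leibniz _)).
  have [ss|[a [b ->]]] := small s; first by rewrite dwedge_size // (ev_homog _ (homogP e)).
  by rewrite dwedge1 brk_double evP; ring.
have lieder_small e e' s : size s != 2 ->
    lieder (anchor A e) (dual_Lie e) (ev Ap (P e')) s = 0.
  move=> ss; rewrite /lieder (ev_homog _ (homogP e')) // vf0 subst_sum_vanish ?subrr //.
  by move=> u su; rewrite (ev_homog _ (homogP e')) // su.
move=> e1 e2; exists (P e1), (P e2); split=> // s; rewrite diffE ev_cat /Aschouten.
rewrite (ev_schouten1r _ _ (@dual_LieP _ _ M g)); first last.
- by move=> a x; exact: (pairEN (@Apair_linr _ _ M g)).
- exact: (brN (tralg_lie M g)).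
- by move=> *; exact: vf_leibniz.
- by move=> *; exact: vfD.
rewrite (ev_schouten1l _ _ (@dual_LieP _ _ M g)); first last.
- by move=> *; exact: vf_leibniz.
- by move=> *; exact: vfD.
have [ss|[a [b ->]]] := small s.
  by rewrite !lieder_small // (ev_homog _ (homogP _)) //; ring.
rewrite evP !(lieder_lie2 A (@dual_Lie R m M g)).
rewrite (codiff_compat (tralg_lie M g) (@Apair_linr _ _ M g) (@dual_LieP _ _ M g)).
  have evPE e : (fun a b => ev Ap (P e) [:: a; b]) = dA e.
    by apply/funext => x; apply/funext => y.
  by rewrite !evPE addrC.
by case: Hbi => Hcoc _ x y c d; exact: (delta_list_cocycle Hcoc).
Qed.

End Bialgebroid.

(** * Admissible quadruples with vanishing tau *)

Section Conditions.
Context {R : realType} {m : nat} (M : manifold R m) (g : lieAlgebra R).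
Local Notation C := (smooth M).
Local Notation g' := (ldual g).
Variables (pi : bivector M) (theta : tensor M g) (delta : cobracket g).
Local Notation gp := (@gpair R g).
Local Notation q := (Quadruple pi theta [::] delta).

(** Evaluated on three covectors, delta u /\ v - u /\ delta v becomes a sum in which
    each delta is replaced by a dual bracket of two of them. *)
Lemma square_jacobi (B : g) (xi eta zeta : g') :
  ev gp (gdelta delta (multi2 (delta B))) [:: xi; eta; zeta] =
  - (dual_bracket delta zeta (dual_bracket delta xi eta)
     + dual_bracket delta xi (dual_bracket delta eta zeta)
     + dual_bracket delta eta (dual_bracket delta zeta xi)) B.
Proof.
rewrite (dual_bracketN delta zeta) (dual_bracketN delta xi (dual_bracket _ _ _)).
rewrite (dual_bracketN delta eta (dual_bracket _ _ _)) -!opprD opp_lfunE opprK.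
rewrite !add_lfunE !dual_bracketE /gdelta ev_dext; last first.
  by move=> e; apply/allP => t /mapP[p _ ->].
rewrite big_map /ev2 -!big_split; apply: eq_bigr => p _.
rewrite dwedge2 => [|e x y]; last first.
  by rewrite !ev_multi2 /ev2 -sumrN; apply: eq_bigr => ? _; ring.
rewrite /wedge3f !ev_multi2 -!dual_bracketE /=.
by rewrite /gpair; ring.
Qed.

Lemma lie_bracket_of_square :
  (forall (B : g) xi eta zeta,
     ev gp (gdelta delta (multi2 (delta B))) [:: xi; eta; zeta] = 0) ->
  is_lie_bracket (dual_bracket delta).
Proof.
move=> H; split=> [|xi|zeta xi eta]; first exact: dual_bracket_bilin.
  apply/lfunP => B; rewrite dual_bracketE zero_lfunE /ev2 big1 // => p _.
  by rewrite mulrC subrr.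
by apply/lfunP => B; apply: oppr_inj; rewrite zero_lfunE oppr0 -square_jacobi H.
Qed.

Lemma square_of_lie_bracket : is_lie_bracket (dual_bracket delta) ->
  forall (B : g) s, ev gp (gdelta delta (multi2 (delta B))) s = 0.
Proof.
move=> [_ _ J] B s.
have [ss|[xi [eta [zeta ->]]]] : size s != 3 \/ exists x y z, s = [:: x; y; z].
- case: s => [|x [|y [|z [|t s]]]]; try by left.
  by right; exists x, y, z.
- rewrite /gdelta ev_dext; last by move=> e; apply/allP => t /mapP[p _ ->].
  by rewrite big_map big1 // => p _; rewrite dwedge_size ?mulr0.
- by rewrite square_jacobi J zero_lfunE oppr0.
Qed.

Lemma T_ev0 xi eta zeta : T_ev theta [::] delta xi eta zeta = 0.
Proof.
have tau0 x y : tau_ev (M := M) [::] x y = (0 : C) by rewrite /tau_ev big_nil.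
rewrite /T_ev [ev _ _ _](_ : _ = 0); last by rewrite /ev big_nil.
rewrite /Alt_theta_dtau !tau0.
have -> : fm_d (0 : C) = 0 by apply: fm_eq => X; exact: vf0.
have -> : theta_sharp theta 0 = 0.
  by rewrite /theta_sharp big1 // => t _; rewrite scale0r.
by rewrite !vpair0r; ring.
Qed.

Lemma tens2_tau0 xi eta :
  tens2_ev (tau_theta [::] theta) xi eta - tens2_ev (pi_dtau pi [::]) xi eta = 0.
Proof.
rewrite /tens2_ev big_nil subr0 /tau_theta big_allpairs_dep big1 // => t _.
by rewrite big_nil.
Qed.

(** The point of M is used to read off the value of a constant function, namely
    that T vanishes as an element of the third exterior power of g. *)
Lemma admissible_action : M -> admissible q <->
  [/\ is_poisson pi, is_lie_bialgebra delta, action_pi pi theta & action_lie theta delta].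
Proof.
move=> x0; split.
  case=> Hcoc Hpois /theta_morphism_pi Hpi H4 [T0 [T0h T0ev T0sq]].
  split=> //; last first.
    by apply/action_lie_tensor => xi eta; rewrite H4 tens2_tau0.
  have T00 xi eta zeta : ev gp T0 [:: xi; eta; zeta] = 0.
    by have := congr1 (fun f : C => f x0) (T0ev xi eta zeta); rewrite T_ev0.
  split=> //; apply: lie_bracket_of_square => B xi eta zeta.
  have := T0sq B [:: xi; eta; zeta]; rewrite ev_cat gschouten1r /= /contract !T00.
  by rewrite !addr0.
case=> Hpois [Hcoc Hbr] /theta_morphism_pi Hmor Hlie; split=> //.
  by move=> xi eta; rewrite tens2_tau0; move/action_lie_tensor: Hlie.
exists [::]; split=> // [xi eta zeta|B s].
  by rewrite T_ev0 [ev _ _ _](_ : _ = 0) // /ev big_nil.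
by rewrite cats0; exact: square_of_lie_bracket.
Qed.

Lemma poisson_action_conditions : is_poisson_action pi theta delta <->
  action_pi pi theta /\ action_lie theta delta.
Proof.
by split=> -[H1 H2]; split; [apply/action_piE|apply/action_lie_field| |];
  try exact/action_lie_field; try exact/action_piE.
Qed.

End Conditions.

Section Equality.
Context {R : realType} {m : nat} (M : manifold R m) (g : lieAlgebra R).
Local Notation C := (smooth M).
Local Notation X1 := (vfield M).
Local Notation O1 := (form1 M).
Local Notation g' := (ldual g).
Local Notation Cg' := (vsmooth M g').
Local Notation TMp := (@TMpair R m M).
Variables (pi1 pi2 : bivector M) (theta1 theta2 : tensor M g) (delta1 delta2 : cobracket g).

(** The anchors on the two summands give pi^# and theta^*; on constant sections of
    the dual of g the bracket of the double is the dual bracket. *)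
Lemma double_eq : M ->
  (anchor (mp_double pi1 theta1 delta1) = anchor (mp_double pi2 theta2 delta2) /\
   brk (mp_double pi1 theta1 delta1) = brk (mp_double pi2 theta2 delta2)) <->
  [/\ forall a b, ev2 TMp pi1 a b = ev2 TMp pi2 a b,
      forall a, theta_sharp theta1 a = theta_sharp theta2 a &
      forall xi eta, dual_bracket delta1 xi eta = dual_bracket delta2 xi eta].
Proof.
move=> x0.
have fm_dE f (X : X1) : X f = fm_d f X by [].
split=> [[anc br]|[Hpi Hth Hde]].
  have sharp a : pi_sharp pi1 a = pi_sharp pi2 a.
    have := congr1 (fun h => h (a, 0 : Cg')) anc => /=.
    by rewrite /action_field /theta_star !big1 ?oppr0 ?addr0 // => t _; rewrite vpair0l scale0r.
  have star xi : theta_star theta1 xi = theta_star theta2 xi.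
    have := congr1 (fun h => h (0 : O1, xi)) anc => /=.
    have sharp0 (p : bivector M) : pi_sharp p 0 = 0.
      by rewrite /pi_sharp big1 // => t _; rewrite !scale0r subrr.
    by rewrite !sharp0 !add0r /action_field => /oppr_inj.
  split=> [a b|a|xi eta].
  - by rewrite -!pi_sharpE sharp.
  - by apply: vpair_sepr => xi; rewrite -!theta_starE star.
  - have dualE (p : bivector M) (th : tensor M g) (d : cobracket g) :
        (brk (mp_double p th d) (0, vcst M xi) (0, vcst M eta)).2 =
        vcst M (dual_bracket d xi eta).
      have phi0 (z : g') : mp_phi p th 0 (vcst M z) = 0.
        rewrite /mp_phi vder_cst add0r /theta_sharp big1 => [|t _]; last by rewrite scale0r.
        exact: vbil0l.
      rewrite -[LHS]/(action_bracket th d (vcst M xi) (vcst M eta)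
         + mp_phi p th 0 (vcst M eta) - mp_phi p th 0 (vcst M xi)).
      rewrite !phi0 /action_bracket !vder_cst !subr0 !addr0.
      exact: vsmooth_eq.
    have := congr1 (fun h : GA' M g -> GA' M g -> GA' M g =>
       vsval (h (0, vcst M xi) (0, vcst M eta)).2 x0) br.
    by rewrite !dualE.
have sharp : pi_sharp pi1 = pi_sharp pi2.
  by apply/funext => a; apply: vf_eq => f; rewrite !fm_dE !pi_sharpE.
have star : theta_star theta1 = theta_star (M := M) theta2.
  by apply/funext => xi; apply: vf_eq => f; rewrite !fm_dE !theta_starE Hth.
have thE : theta_sharp theta1 = theta_sharp theta2 by exact/funext.
have pi2E : ev2 TMp pi1 = ev2 TMp pi2.
  by apply/funext => a; apply/funext => b.
split; first by rewrite /= /action_field sharp star.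
apply/funext => -[a xi]; apply/funext => -[b eta] /=.
rewrite /koszul_bracket /mp_psi /mp_phi /action_bracket /action_field sharp star thE pi2E.
rewrite (_ : vbil (dual_bracket_bilin delta1) xi eta = vbil (dual_bracket_bilin delta2) xi eta) //.
by apply: vsmooth_eq => x /=.
Qed.

(** As tau vanishes on both sides, r_0 is zero, and so is [r_0, .]. *)
Lemma equivalent_eq : M ->
  equivalent (Quadruple pi1 theta1 [::] delta1) (Quadruple pi2 theta2 [::] delta2) <->
  [/\ forall a b, ev2 TMp pi1 a b = ev2 TMp pi2 a b,
      forall a, theta_sharp theta1 a = theta_sharp theta2 a &
      forall xi eta, dual_bracket delta1 xi eta = dual_bracket delta2 xi eta].
Proof.
move=> x0; split=> [[Hpi Hth [r0 [Hr Hd]]]|[Hpi Hth Hd]]; split=> //.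
  move=> xi eta; apply/lfunP => B; rewrite !dual_bracketE -!ev_multi2 Hd.
  have r00 x y : ev2 (@gpair R g) r0 x y = 0.
    have := congr1 (fun f : C => f x0) (Hr x y).
    by rewrite /tau_ev !big_nil /= add0r.
  by rewrite gschouten1r /= /contract !ev_multi2 !r00; ring.
exists [::]; split=> [xi eta|B s].
  rewrite /tau_ev !big_nil add0r /ev2 big_nil.
  exact: smooth_eq.
rewrite [ev _ (gschouten _ _) s](_ : _ = 0) ?subr0; last by rewrite /ev big_nil.
have hom (d : cobracket g) : homog 2 (multi2 (d B)) by apply/allP => t /mapP[p _ ->].
have [ss|[xi [eta ->]]] : size s != 2 \/ exists x y, s = [:: x; y].
- by case: s => [|a [|b [|c s]]]; [left|left|right; exists a, b|left].
- by rewrite !(ev_homog _ (hom _) ss).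
- by rewrite !ev_multi2 -!dual_bracketE Hd.
Qed.

End Equality.

Theorem theorem4p1 (R : realType) (m : nat) (M : manifold R m)
    (hconn : connected_manifold M) (hH1 : H1_trivial M) (g : lieAlgebra R) :
  [/\ (* the characterisation of admissible quadruples (pi, theta, 0, delta) *)
      forall (pi : bivector M) (theta : tensor M g) (delta : cobracket g),
        admissible (Quadruple pi theta [::] delta) <->
        [/\ is_poisson pi, is_lie_bialgebra delta &
            is_poisson_action pi theta delta],
      (* the dual of the corresponding Lie bialgebroid *)
      forall (pi : bivector M) (theta : tensor M g) (delta : cobracket g),
        admissible (Quadruple pi theta [::] delta) ->
        (exists L, corresponds (Quadruple pi theta [::] delta) L) /\
        (forall L, corresponds (Quadruple pi theta [::] delta) L ->
                   isomorphic L (mp_double pi theta delta)),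
      (* image of the classes of quadruples (pi, theta, 0, delta) *)
      forall L : algebroid (GA' M g), is_lie_bialgebroid L ->
        ((exists (pi : bivector M) (theta : tensor M g) (delta : cobracket g),
            admissible (Quadruple pi theta [::] delta) /\
            corresponds (Quadruple pi theta [::] delta) L) <->
         (exists (pi : bivector M) (theta : tensor M g) (delta : cobracket g),
            poisson_action_data pi theta delta /\ is_double L pi theta delta)) &
      (* the correspondence is one-to-one on these classes *)
      forall (pi1 pi2 : bivector M) (theta1 theta2 : tensor M g)
             (delta1 delta2 : cobracket g) (L : algebroid (GA' M g)),
        admissible (Quadruple pi1 theta1 [::] delta1) ->
        admissible (Quadruple pi2 theta2 [::] delta2) ->
        corresponds (Quadruple pi1 theta1 [::] delta1) L ->
        (corresponds (Quadruple pi2 theta2 [::] delta2) L <->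
         equivalent (Quadruple pi1 theta1 [::] delta1)
                    (Quadruple pi2 theta2 [::] delta2))].
Proof.
have [x0 _] := hconn.1.
have action_iff (pi : bivector M) (theta : tensor M g) (delta : cobracket g) :
    admissible (Quadruple pi theta [::] delta) <->
    [/\ is_poisson pi, is_lie_bialgebra delta & is_poisson_action pi theta delta].
  split=> [/(admissible_action _ _ _ x0)[Hpois Hbi Hpi Hlie]|[Hpois Hbi]].
    by split=> //; apply/poisson_action_conditions.
  by case/poisson_action_conditions => Hpi Hlie; apply/(admissible_action _ _ _ x0).
have double_corresponds (pi : bivector M) (theta : tensor M g) (delta : cobracket g) :
    admissible (Quadruple pi theta [::] delta) ->
    corresponds (Quadruple pi theta [::] delta) (mp_double pi theta delta).
  move=> /(admissible_action _ _ _ x0)[Hpois Hbi Hpi Hlie].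
  by split; [exact: double_lie_bialgebroid|exact/dual_diff_dstar].
have eq_double_iso (pi : bivector M) (theta : tensor M g) (delta : cobracket g)
    (L : algebroid (GA' M g)) :
    anchor L = anchor (mp_double pi theta delta) /\ brk L = brk (mp_double pi theta delta) ->
    is_iso L (mp_double pi theta delta) id.
  by move=> [anc br]; split=> [|//|a|a b]; rewrite ?anc ?br //; exists id.
split=> //.
- move=> pi theta delta Hadm; split.
    by exists (mp_double pi theta delta); exact: double_corresponds.
  by move=> L [_ /dual_diff_dstar HL]; exists id; exact: eq_double_iso.
- move=> L HL; split=> -[pi [theta [delta [H1 H2]]]]; exists pi, theta, delta.
    split; first exact/action_iff.
    by case: H2 => _ /dual_diff_dstar; exact: eq_double_iso.
  split; first exact/action_iff.
  split=> //; apply/dual_diff_dstar; case: H2 => _ _ anc br.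
  split; apply/funext => a; first by rewrite -anc.
  by apply/funext => b; rewrite -br.
- move=> pi1 pi2 theta1 theta2 delta1 delta2 L _ _ [HL /dual_diff_dstar[anc1 br1]].
  split=> [[_ /dual_diff_dstar[anc2 br2]]|Heq].
    apply/(equivalent_eq _ _ _ _ _ _ x0)/(double_eq _ _ _ _ _ _ x0).
    by rewrite -anc1 -anc2 -br1 -br2.
  split=> //; apply/dual_diff_dstar; rewrite anc1 br1.
  by apply/(double_eq _ _ _ _ _ _ x0)/(equivalent_eq _ _ _ _ _ _ x0).
Qed.
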